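(* Let $G$ be a discrete group. The following properties are equivalent: (i) $G$ is amenable. (ii) The wreath product $A\wr G$ is unitarizable for some infinite Abelian group $A$. (iii) The wreath product $A\wr G$ is unitarizable for all amenable groups $A$.
   Context: All groups are discrete groups. Unitarizable: a representation $\pi\colon G\to B(H)$ of a discrete group $G$ on a Hilbert space $H$ (a group homomorphism into the invertible bounded operators) is uniformly bounded if $\sup_{t\in G}\|\pi(t)\|<\infty$; it is unitarizable if there is a bounded invertible operator $S\colon H\to H$ such that $t\mapsto S^{-1}\pi(t)S$ is a unitary representation. The discrete group $G$ is unitarizable if every uniformly bounded representation of $G$ on every Hilbert space is unitarizable. Wreath product: $A^{(G)}$ is the group (under pointwise product) of functions $a\colon G\to A$ equal to the unit except at finitely many points; $G$ acts on it by $(g\cdot a)(t)=a(g^{-1}t)$. Then $A\wr G$ is the semidirect product $A^{(G)}\rtimes G$, i.e. the set of pairs $(a,g)$, $a\in A^{(G)}$, $g\in G$, with product $(a,g)(a',g')=(a\,(g\cdot a'),gg')$. *)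

(* Defs.v *)
From HB Require Import structures.
From mathcomp Require Import all_boot all_order all_algebra.
From mathcomp Require Import finmap complex.
From mathcomp Require Import all_classical all_reals all_analysis.

Set Implicit Arguments.
Unset Strict Implicit.
Unset Printing Implicit Defensive.

Import Order.TTheory GRing.Theory Num.Theory.
Import numFieldNormedType.Exports.

Local Open Scope classical_set_scope.
Local Open Scope ring_scope.

(* A discrete group is amenable when l^oo(G), here the bounded functions
   G -> R, carries a left-invariant mean.  The values of [m] at unbounded
   functions are irrelevant. *)
Definition left_invariant_mean (R : realType) (G : groupType)
    (m : (G -> R) -> R) : Prop :=
  [/\ forall (a : R) (f h : G -> R), bounded_fun f -> bounded_fun h ->
        m (fun x => a * f x + h x) = a * m f + m h,
      forall f : G -> R, bounded_fun f -> (forall x, 0 <= f x) -> 0 <= m f,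
      m (fun=> 1) = 1 &
      forall (g : G) (f : G -> R), bounded_fun f ->
        m (fun x => f (g^-1 * x)%g) = m f].

Definition amenable (R : realType) (G : groupType) : Prop :=
  exists m : (G -> R) -> R, left_invariant_mean m.

(* Complex Hilbert spaces.  [inner] is linear in its first argument and
   conjugate-linear in the second one, and induces the norm. *)
HB.mixin Record CompleteNormedModule_isHilbert (R : realType) H
    of CompleteNormedModule R[i] H := {
  inner : {dot H for (@Num.conj R[i])};
  sqr_norm_inner : forall x : H, `|x| ^+ 2 = inner x x
}.

#[short(type="hilbertType")]
HB.structure Definition Hilbert (R : realType) :=
  {H of CompleteNormedModule_isHilbert R H & CompleteNormedModule R[i] H}.

Section Operators.
Variables (R : realType) (H : hilbertType R).

(* Norms of vectors are complex numbers with zero imaginary part, whence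
   the real part. *)
Definition op_norm (f : H -> H) : \bar R :=
  ereal_sup [set (complex.Re `|f x|)%:E | x in [set x : H | `|x| <= 1]].

Definition bounded_op (f : {linear H -> H}) : Prop := (op_norm f < +oo)%E.

Definition mutually_inverse_ops (S T : {linear H -> H}) : Prop :=
  [/\ bounded_op S, bounded_op T, cancel S T & cancel T S].

Definition unitary_op (f : {linear H -> H}) : Prop :=
  bijective f /\ forall x y : H, inner (f x) (f y) = inner x y.

Variable G : groupType.
Implicit Type pi : G -> {linear H -> H}.

(* The operators [pi t] are invertible in B(H), with inverse [pi t^-1]. *)
Definition representation pi : Prop :=
  [/\ forall t, bounded_op (pi t), pi 1%g =1 id &
      forall s t, pi (s * t)%g =1 pi s \o pi t].

Definition uniformly_bounded pi : Prop :=
  (ereal_sup [set op_norm (pi t) | t in [set: G]] < +oo)%E.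

Definition unitary_representation pi : Prop :=
  representation pi /\ forall t, unitary_op (pi t).

Definition unitarizable_representation pi : Prop :=
  exists S T : {linear H -> H}, mutually_inverse_ops S T /\
    unitary_representation (fun t => T \o pi t \o S : {linear H -> H}).

End Operators.

Definition unitarizable (R : realType) (G : groupType) : Prop :=
  forall (H : hilbertType R) (pi : G -> {linear H -> H}),
    representation pi -> uniformly_bounded pi -> unitarizable_representation pi.

Local Open Scope group_scope.
Local Open Scope fset_scope.

Definition restricted_power (A : groupType) (I : choiceType) : Type :=
  {fsfun I -> A with 1}.

HB.instance Definition _ (A : groupType) (I : choiceType) :=
  Choice.copy (restricted_power A I) {fsfun I -> A with 1}.

Section RestrictedPower.
Variables (A : groupType) (I : choiceType).
Implicit Types a b c : restricted_power A I.

Definition rp_fun a : I -> A := fun_of_fsfun a.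

Definition rp_one : restricted_power A I := [fsfun].

Definition rp_inv a : restricted_power A I :=
  [fsfun t in finsupp a => (rp_fun a t)^-1].

Definition rp_mul a b : restricted_power A I :=
  [fsfun t in finsupp a `|` finsupp b => rp_fun a t * rp_fun b t].

Lemma rp_ext a b : rp_fun a =1 rp_fun b -> a = b.
Proof. by move=> eq_ab; apply/fsfunP. Qed.

Lemma rp_oneE t : rp_fun rp_one t = 1.
Proof. by rewrite /rp_fun fsfunE. Qed.

Lemma rp_invE a t : rp_fun (rp_inv a) t = (rp_fun a t)^-1.
Proof.
rewrite /rp_fun /rp_inv fsfunE; case: ifP => // /negbT /fsfun_dflt ->.
by rewrite invg1.
Qed.

Lemma rp_mulE a b t : rp_fun (rp_mul a b) t = rp_fun a t * rp_fun b t.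
Proof.
rewrite /rp_fun /rp_mul fsfunE in_fsetU; case: ifP => // /negbT.
by rewrite negb_or => /andP[/fsfun_dflt -> /fsfun_dflt ->]; rewrite mul1g.
Qed.

Lemma rp_mulA : associative rp_mul.
Proof. by move=> a b c; apply: rp_ext => t; rewrite !rp_mulE mulgA. Qed.

Lemma rp_mul1g : left_id rp_one rp_mul.
Proof. by move=> a; apply: rp_ext => t; rewrite rp_mulE rp_oneE mul1g. Qed.

Lemma rp_mulg1 : right_id rp_one rp_mul.
Proof. by move=> a; apply: rp_ext => t; rewrite rp_mulE rp_oneE mulg1. Qed.

Lemma rp_mulVg : left_inverse rp_one rp_inv rp_mul.
Proof.
by move=> a; apply: rp_ext => t; rewrite rp_mulE rp_invE rp_oneE mulVg.
Qed.

Lemma rp_mulgV : right_inverse rp_one rp_inv rp_mul.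
Proof.
by move=> a; apply: rp_ext => t; rewrite rp_mulE rp_invE rp_oneE mulgV.
Qed.

HB.instance Definition _ := isGroup.Build (restricted_power A I)
  rp_mulA rp_mul1g rp_mulg1 rp_mulVg rp_mulgV.

End RestrictedPower.

(* The type of pairs (a, g), kept separate from the product type, which
   carries the direct product structure. *)
Definition wreath (A G : groupType) : Type := (restricted_power A G * G)%type.

HB.instance Definition _ (A G : groupType) :=
  Choice.copy (wreath A G) (restricted_power A G * G)%type.

Section Wreath.
Variables A G : groupType.
Implicit Types (g h : G) (a b : restricted_power A G) (u v : wreath A G).

Definition shift g a : restricted_power A G :=
  [fsfun t in [fset g * s | s in finsupp a] => rp_fun a (g^-1 * t)].

Lemma shiftE g a t : rp_fun (shift g a) t = rp_fun a (g^-1 * t).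
Proof.
rewrite /rp_fun /shift fsfunE; case: ifPn => // tNga.
rewrite fsfun_dflt //; apply: contra tNga => gt_a.
by apply/imfsetP; exists (g^-1 * t) => //=; rewrite mulVKg.
Qed.

Lemma shift1 a : shift 1 a = a.
Proof. by apply: rp_ext => t; rewrite shiftE invg1 mul1g. Qed.

Lemma shiftM g h a : shift (g * h) a = shift g (shift h a).
Proof. by apply: rp_ext => t; rewrite !shiftE invgM mulgA. Qed.

Lemma shift_mul g a b : shift g (a * b) = shift g a * shift g b.
Proof.
by apply: rp_ext => t; rewrite [RHS]rp_mulE !shiftE [LHS]rp_mulE.
Qed.

Lemma shift_one g : shift g 1 = 1.
Proof. by apply: rp_ext => t; rewrite shiftE [LHS]rp_oneE [RHS]rp_oneE. Qed.

Definition wr_one : wreath A G := (1, 1).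
Definition wr_inv u : wreath A G := (shift u.2^-1 u.1^-1, u.2^-1).
Definition wr_mul u v : wreath A G := (u.1 * shift u.2 v.1, u.2 * v.2).

Lemma wr_mulA : associative wr_mul.
Proof.
by move=> [a g] [b h] [c k]; rewrite /wr_mul /= shift_mul shiftM !mulgA.
Qed.

Lemma wr_mul1g : left_id wr_one wr_mul.
Proof. by move=> [a g]; rewrite /wr_mul /= shift1 !mul1g. Qed.

Lemma wr_mulg1 : right_id wr_one wr_mul.
Proof. by move=> [a g]; rewrite /wr_mul /= shift_one !mulg1. Qed.

Lemma wr_mulVg : left_inverse wr_one wr_inv wr_mul.
Proof.
by move=> [a g]; rewrite /wr_mul /wr_inv /= -shift_mul !mulVg shift_one.
Qed.

Lemma wr_mulgV : right_inverse wr_one wr_inv wr_mul.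
Proof.
by move=> [a g]; rewrite /wr_mul /wr_inv /= -shiftM !mulgV shift1 mulgV.
Qed.

HB.instance Definition _ := isGroup.Build (wreath A G)
  wr_mulA wr_mul1g wr_mulg1 wr_mulVg wr_mulgV.

End Wreath.

(* Main.v *)
(* If A and G are amenable, so is A wr G, and averaging an inner product over
   an invariant mean unitarizes every uniformly bounded representation of an
   amenable group (Day, Dixmier).

   For the converse direction suppose that G is not amenable.  By Kesten,
   products of random generators return to 1 with exponentially small
   probability.  For every m let each x in G choose m random words of length
   k(m), join x to its translates by these words, and keep only the edges that
   lie on no cycle.  If k(m) is large, the expected number of surviving edges
   from 1 is at least m/2.  The surviving edges of a finite window form a
   forest; orient its trees towards a root.  Then each vertex has at most one
   outgoing edge, and in the limit over all windows the form
   p(xi, eta) = E sum_(x -> y) xi_x conj(eta_y) on functions of vertices and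
   labels has G-invariant symmetrization, although p itself is not invariant.
   It follows that p(g xi, eta) - p(xi, g^-1 eta) is bounded by
   4 |xi| |eta|.  Moreover p commutes with functions of the labels, and
   the characters of an infinite Abelian group A realize enough of these
   functions as operators of A^(G).  If A wr G is unitarizable, the commutator
   of p is that of a bounded form b, so e = p - b is invariant under A wr G,
   hence commutes with all functions of the labels at level m.  This
   expresses p(eta, delta_1), where eta is the indicator of the neighbours of
   1, through p(delta_1, eta') for some eta' with |eta'|^2 <= m, and yields
   m/2 <= 2 + 2 |b| m^(1/2) for all m, which is absurd. *)

(* The obstacle is that the forest carries no invariant orientation: roots are chosen window by
   window, so [p] exists only as an ultralimit. The unoriented edges behave better. An edge lying on
   no cycle of a large window lies on none of a smaller one, so their sums settle down as the window
   grows and the limit is invariant; from this the commutator of [p] is controlled. The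
   contradiction rests on a gap between [m] and its square root. The unit vertex has about [m / 2]
   surviving edges to the vertices it chooses, while the vectors paired there have norms 1 and at
   most the square root of [m]. A form bounded independently of [m] cannot bridge this gap. The half
   comes from [(2 * m) * rho ^ k <= 1/4]: an edge on a cycle starts a closed trail, each step of a
   trail has [2 * m] choices of direction and edge, and the geometric series over the lengths of
   trails stays below 1/2. An infinite [A] is needed because each level requires as many distinct
   characters as there are tables of labels. In the cycle of implications a single group, a direct
   sum of copies of Z/2, is both the witness for (ii) and the test case of (iii). *)
From HB Require Import structures.
From mathcomp Require Import all_boot all_order all_algebra.
From mathcomp Require Import finmap complex.
From mathcomp Require Import all_classical all_reals all_analysis.
From mathcomp Require Import ring lra.
Require Import Defs.

Set Implicit Arguments.
Unset Strict Implicit.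
Unset Printing Implicit Defensive.

Import Order.TTheory GRing.Theory Num.Theory.
Import numFieldNormedType.Exports.

Local Open Scope classical_set_scope.
Local Open Scope ring_scope.

(** * Ultralimits *)

Section UltraLimit.
Variables (R : realType) (I : Type) (F : set_system I).
Hypothesis UF : UltraFilter F.

Let PF : ProperFilter F := @ultra_proper _ _ UF.
#[local] Existing Instance PF.

Definition bounded_net (f : I -> R) := exists M : R, forall i, `|f i| <= M.

Definition ulim (f : I -> R) : R := lim (f @ F).

(** The image of an ultrafilter is an ultrafilter; here it contains a compact interval, so it
    converges. *)
Lemma ulim_cvg (f : I -> R) : bounded_net f -> f @ F --> ulim f.
Proof.
move=> [M fM].
have UfF : UltraFilter (f @ F).
  split=> [|G FG sub]; first exact: fmap_proper_filter.
  apply/seteqP; split => // A GA.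
  have [//|FnA] := in_ultra_setVsetC (f @^-1` A) UF.
  have /filter_ex[x [Ax nAx]] : G (A `&` ~` A).
    by apply: filterI => //; exact: sub.
  by [].
have : compact (`[- M, M]%classic : set R) by exact: segment_compact.
rewrite compact_ultra => /(_ (f @ F) UfF).
have fFM : (f @ F) `[- M, M]%classic.
  by apply: (@filterE _ F) => i; have := fM i; rewrite ler_norml /= in_itv/=.
move=> /(_ fFM)[p [_ /= fp]].
by rewrite /ulim; apply/cvg_ex; exists p.
Qed.

Lemma ulim_unique (f : I -> R) l : f @ F --> l -> ulim f = l.
Proof. by move=> fl; exact: cvg_lim. Qed.

Lemma ulimD f g : bounded_net f -> bounded_net g ->
  ulim (fun i => f i + g i) = ulim f + ulim g.
Proof. by move=> bf bg; apply: ulim_unique; apply: cvgD; exact: ulim_cvg. Qed.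

Lemma ulimZ a f : bounded_net f -> ulim (fun i => a * f i) = a * ulim f.
Proof. by move=> bf; apply: ulim_unique; apply: cvgMr; exact: ulim_cvg. Qed.

Lemma ulim_cst a : ulim (fun=> a) = a.
Proof. by apply: ulim_unique; exact: cvg_cst. Qed.

Lemma ulim_near f g : bounded_net g ->
  (\forall i \near F, f i = g i) -> ulim f = ulim g.
Proof.
move=> bg fg; apply: ulim_unique.
apply: cvg_trans (ulim_cvg bg); apply: near_eq_cvg.
by apply: filterS fg => i ->.
Qed.

Lemma ulim_le f g : bounded_net f -> bounded_net g ->
  (\forall i \near F, f i <= g i) -> ulim f <= ulim g.
Proof.
move=> /ulim_cvg bf /ulim_cvg bg fg; rewrite leNgt; apply/negP => gf.
have m1 : (ulim g + ulim f) / 2 < ulim f by lra.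
have m2 : ulim g < (ulim g + ulim f) / 2 by lra.
have hf := @cvgr_gt R I F (@filter_filter _ _ PF) _ _ bf _ m1.
have hg := @cvgr_lt R I F (@filter_filter _ _ PF) _ _ bg _ m2.
have [i [h1 [/= h2 h3]]] := filter_ex (filterI fg (filterI hf hg)).
by move: (le_lt_trans h1 h3) => /(lt_trans h2); rewrite ltxx.
Qed.

End UltraLimit.

(** * The modulus of a complex number as a real number *)

Section ComplexAbs.
Variable R : realType.
Local Notation C := R[i].
Implicit Types z w : C.

Definition cabs z : R := complex.Re `|z|.

Lemma cabsE z : `|z| = (cabs z)%:C%C.
Proof. by rewrite /cabs RRe_real// normr_real. Qed.

Lemma cabs_ge0 z : 0 <= cabs z.
Proof. by rewrite -ler0c -cabsE. Qed.

Lemma cabs0 : cabs 0 = 0 :> R.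
Proof. by rewrite /cabs normr0. Qed.

Lemma cabs1 : cabs 1 = 1 :> R.
Proof. by rewrite /cabs normr1. Qed.

Lemma cabs_eq0 z : (cabs z == 0) = (z == 0).
Proof. by rewrite -[RHS]normr_eq0 cabsE -(inj_eq (@complexI R)). Qed.

Lemma cabsM z w : cabs (z * w) = cabs z * cabs w.
Proof. by apply: complexI; rewrite -cabsE normrM !cabsE rmorphM. Qed.

Lemma cabsX z n : cabs (z ^+ n) = cabs z ^+ n.
Proof. by apply: complexI; rewrite -cabsE normrX cabsE rmorphXn. Qed.

Lemma cabsD z w : cabs (z + w) <= cabs z + cabs w.
Proof. by rewrite -lecR rmorphD/= -!cabsE ler_normD. Qed.

Lemma cabsN z : cabs (- z) = cabs z.
Proof. by rewrite /cabs normrN. Qed.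

Lemma cabsB z w : cabs (z - w) <= cabs z + cabs w.
Proof. by rewrite -(cabsN w) cabsD. Qed.

Lemma cabs_conj z : cabs (z^*)%C = cabs z.
Proof. by rewrite /cabs normcJ. Qed.

Lemma cabs_real (x : R) : cabs x%:C%C = `|x|.
Proof. by rewrite /cabs normc_def/= expr0n/= addr0 sqrtr_sqr. Qed.

Lemma cabs_sqr z : cabs z ^+ 2 = complex.Re z ^+ 2 + complex.Im z ^+ 2.
Proof. by apply: complexI; rewrite rmorphXn/= -cabsE add_Re2_Im2. Qed.

Lemma cabs_sqrC z : (cabs z ^+ 2)%:C%C = z * (z^*)%C.
Proof. by rewrite -sqr_normc cabsE rmorphXn. Qed.

Lemma Re_le_cabs z : `|complex.Re z| <= cabs z.
Proof. by rewrite -lecR -cabsE normc_ge_Re. Qed.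

Lemma Im_le_cabs z : `|complex.Im z| <= cabs z.
Proof.
rewrite -(ler_pXn2r (n := 2)) ?nnegrE ?cabs_ge0// cabs_sqr real_normK ?num_real//.
by rewrite lerDr sqr_ge0.
Qed.

Lemma cabs_sum (I : Type) (r : seq I) (P : pred I) (f : I -> C) :
  cabs (\sum_(i <- r | P i) f i) <= \sum_(i <- r | P i) cabs (f i).
Proof.
elim/big_rec2: _ => [|i a b _]; first by rewrite cabs0.
by move=> ab; rewrite (le_trans (cabsD _ _))// lerD2l.
Qed.

(** Reduces bounds on moduli to bounds on real parts, as in the Cauchy-Schwarz inequality, the Riesz
    representation and [cabs_culim_le]. *)
Lemma cabs_rotate z : exists2 c : C, cabs c = 1 & c * z = (cabs z)%:C%C.
Proof.
have [->|z0] := eqVneq z 0; first by exists 1; rewrite ?cabs1// mulr0 cabs0.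
have a0 : cabs z != 0 by rewrite cabs_eq0.
exists ((z^*)%C * ((cabs z)^-1)%:C%C).
  by rewrite cabsM cabs_conj cabs_real ger0_norm ?invr_ge0 ?cabs_ge0// divff.
rewrite mulrAC mulrC [_^*%C * z]mulrC -cabs_sqrC -rmorphM/=; congr (_%:C)%C.
by rewrite expr2 mulKf.
Qed.

Lemma ReM_real (x : R) z : complex.Re (x%:C%C * z) = x * complex.Re z.
Proof. by case: z => a b /=; rewrite mul0r subr0. Qed.

Lemma ReD z w : complex.Re (z + w) = complex.Re z + complex.Re w.
Proof. by case: z; case: w. Qed.

Lemma ImD z w : complex.Im (z + w) = complex.Im z + complex.Im w.
Proof. by case: z; case: w. Qed.

Lemma complex_ext z w :
  complex.Re z = complex.Re w -> complex.Im z = complex.Im w -> z = w.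
Proof. by case: z; case: w => a b c d /= -> ->. Qed.

End ComplexAbs.

(** * Ultralimits of complex nets *)

Section ComplexUltraLimit.
Variables (R : realType) (I : Type) (F : set_system I).
Hypothesis UF : UltraFilter F.
Local Notation C := R[i].
Let PF : ProperFilter F := @ultra_proper _ _ UF.
#[local] Existing Instance PF.
Implicit Types f g : I -> C.

Definition cbounded f := exists M : R, forall i, cabs (f i) <= M.

Definition culim f : C :=
  Complex (ulim F (fun i => complex.Re (f i))) (ulim F (fun i => complex.Im (f i))).

Lemma cbounded_Re f : cbounded f -> bounded_net (fun i => complex.Re (f i)).
Proof. by move=> [M fM]; exists M => i; exact: le_trans (Re_le_cabs _) (fM i). Qed.

Lemma cbounded_Im f : cbounded f -> bounded_net (fun i => complex.Im (f i)).
Proof. by move=> [M fM]; exists M => i; exact: le_trans (Im_le_cabs _) (fM i). Qed.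

Lemma cboundedD f g : cbounded f -> cbounded g -> cbounded (fun i => f i + g i).
Proof.
move=> [M fM] [N gN]; exists (M + N) => i.
by rewrite (le_trans (cabsD _ _))// lerD.
Qed.

Lemma cboundedZ (a : C) f : cbounded f -> cbounded (fun i => a * f i).
Proof.
by move=> [M fM]; exists (cabs a * M) => i; rewrite cabsM ler_wpM2l ?cabs_ge0.
Qed.

Lemma culimD f g : cbounded f -> cbounded g ->
  culim (fun i => f i + g i) = culim f + culim g.
Proof.
move=> bf bg; apply: complex_ext; rewrite ?ReD ?ImD/=.
  rewrite -ulimD//; [|exact: cbounded_Re..].
  by congr (ulim F _); apply/funext => i; rewrite ReD.
rewrite -ulimD//; [|exact: cbounded_Im..].
by congr (ulim F _); apply/funext => i; rewrite ImD.
Qed.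

Lemma culimZ a f : cbounded f -> culim (fun i => a * f i) = a * culim f.
Proof.
move=> bf; have bR := cbounded_Re bf; have bI := cbounded_Im bf.
have bZ (h : I -> R) c : bounded_net h -> bounded_net (fun i => c * h i).
  by move=> [M hM]; exists (`|c| * M) => i; rewrite normrM ler_wpM2l.
case: a => a b; apply: complex_ext => /=.
  rewrite -mulNr -!ulimZ// -ulimD//; [|exact: bZ..].
  by congr (ulim F _); apply/funext => i; case: (f i) => c d /=; rewrite mulNr.
rewrite -!ulimZ// -ulimD//; [|exact: bZ..].
by congr (ulim F _); apply/funext => i; case: (f i) => c d /=.
Qed.

Lemma culim_cst a : culim (fun=> a) = a.
Proof. by rewrite /culim !ulim_cst; case: a. Qed.

Lemma culim_near f g : cbounded g ->
  (\forall i \near F, f i = g i) -> culim f = culim g.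
Proof.
move=> bg fg; apply: complex_ext; apply: ulim_near.
- exact: cbounded_Re.
- by apply: filterS fg => i ->.
- exact: cbounded_Im.
- by apply: filterS fg => i ->.
Qed.

Lemma culim_conj f : cbounded f -> culim (fun i => (f i)^*%C) = ((culim f)^*)%C.
Proof.
move=> bf; apply: complex_ext => /=.
  by congr (ulim F _); apply/funext => i; case: (f i).
rewrite -[RHS]mulN1r -ulimZ//; last exact: cbounded_Im.
by congr (ulim F _); apply/funext => i; case: (f i) => a b /=; rewrite mulN1r.
Qed.

Lemma Re_culim_le f g : cbounded f -> cbounded g ->
  (\forall i \near F, complex.Re (f i) <= complex.Re (g i)) ->
  complex.Re (culim f) <= complex.Re (culim g).
Proof. by move=> bf bg fg /=; apply: ulim_le => //; exact: cbounded_Re. Qed.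

Lemma cabs_culim_le f (M : R) : cbounded f ->
  (\forall i \near F, cabs (f i) <= M) -> cabs (culim f) <= M.
Proof.
move=> bf fM; have [c c1 cE] := cabs_rotate (culim f).
have -> : cabs (culim f) = complex.Re (culim (fun i => c * f i)).
  by rewrite culimZ// cE.
have -> : M = complex.Re (culim (fun=> M%:C%C)) by rewrite culim_cst.
apply: Re_culim_le; [exact: cboundedZ| by exists (cabs M%:C%C)|].
apply: filterS fM => i fiM /=; apply: le_trans fiM.
apply: le_trans (ler_norm _) _; apply: le_trans (Re_le_cabs _) _.
by rewrite cabsM c1 mul1r.
Qed.

End ComplexUltraLimit.

Lemma nat_ultrafilter :
  exists U : set_system nat, UltraFilter U /\ \oo `<=` U.
Proof. by have [U [UU sU]] := ultraFilterLemma eventually_filter; exists U. Qed.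

Definition nat_ultra : set_system nat := projT1 (cid nat_ultrafilter).

#[export] Instance nat_ultraP : UltraFilter nat_ultra.
Proof. by rewrite /nat_ultra; case: cid => U []. Qed.

Lemma nat_ultra_ge (P : nat -> Prop) N :
  (forall n, (N <= n)%N -> P n) -> nat_ultra P.
Proof.
move=> NP; rewrite /nat_ultra; case: cid => U [_ sU] /=.
by apply: sU; exists N.
Qed.

(** * Semi-inner products and completions *)

Section Forms.
Variable R : realType.
Local Notation C := R[i].

Lemma discriminant_le (a b c : R) : 0 <= a -> 0 <= c ->
  (forall t, 0 <= a + 2 * t * b + t ^+ 2 * c) -> b ^+ 2 <= a * c.
Proof.
move=> a0 c0 h; have [c00|cn0] := eqVneq c 0.
  have [->|bn0] := eqVneq b 0; first by rewrite expr0n mulr_ge0.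
  (* With [c = 0] and [b] nonzero the polynomial is affine in [t], and at this [t] it takes the
     value -1. *)
  have := h (- (a + 1) / (2 * b)); rewrite c00 mulr0 addr0.
  have -> : 2 * (- (a + 1) / (2 * b)) * b = - (a + 1) by field.
  by lra.
have cp : 0 < c by rewrite lt_def cn0.
have := h (- b / c).
have -> : a + 2 * (- b / c) * b + (- b / c) ^+ 2 * c = (a * c - b ^+ 2) / c.
  by field.
by rewrite pmulr_lge0 ?invr_gt0// subr_ge0.
Qed.

Record psd_form (V : lmodType C) (s : V -> V -> C) : Prop := PsdForm {
  psd_linl : forall a x y z, s (a *: x + y) z = a * s x z + s y z;
  psd_herm : forall x y, s y x = ((s x y)^*)%C;
  psd_ge0 : forall x, 0 <= complex.Re (s x x) }.

Section PsdForm.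
Variables (V : lmodType C) (s : V -> V -> C).

Definition fsq x := complex.Re (s x x).
Definition fnorm x := Num.sqrt (fsq x).

Hypothesis hs : psd_form s.

Lemma form0l z : s 0 z = 0.
Proof.
have := psd_linl hs 1 0 0 z; rewrite scale1r addr0 mul1r.
by move=> /eqP; rewrite -subr_eq subrr eq_sym => /eqP.
Qed.

Lemma formDl x y z : s (x + y) z = s x z + s y z.
Proof. by rewrite -[x in LHS]scale1r (psd_linl hs) mul1r. Qed.

Lemma formZl a x z : s (a *: x) z = a * s x z.
Proof. by rewrite -[a *: x]addr0 (psd_linl hs) form0l addr0. Qed.

Lemma formNl x z : s (- x) z = - s x z.
Proof. by rewrite -scaleN1r formZl mulN1r. Qed.

Lemma formBl x y z : s (x - y) z = s x z - s y z.
Proof. by rewrite formDl formNl. Qed.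

Lemma form0r z : s z 0 = 0.
Proof. by rewrite (psd_herm hs) form0l conjc0. Qed.

Lemma formDr x y z : s z (x + y) = s z x + s z y.
Proof. by rewrite (psd_herm hs) formDl rmorphD/= -!(psd_herm hs). Qed.

Lemma formZr a x z : s z (a *: x) = (a^*)%C * s z x.
Proof. by rewrite (psd_herm hs) formZl rmorphM/= -!(psd_herm hs). Qed.

Lemma formNr x z : s z (- x) = - s z x.
Proof. by rewrite (psd_herm hs) formNl rmorphN/= -!(psd_herm hs). Qed.

Lemma formBr x y z : s z (x - y) = s z x - s z y.
Proof. by rewrite formDr formNr. Qed.

Lemma fsqE x : s x x = (fsq x)%:C%C.
Proof.
apply: complex_ext => //=; have /(congr1 (@complex.Im R)) := psd_herm hs x x.
by case: (s x x) => a b /= ?; lra.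
Qed.

Lemma fsqD x y : fsq (x + y) = fsq x + 2 * complex.Re (s x y) + fsq y.
Proof.
rewrite /fsq formDl !formDr !ReD (psd_herm hs x y).
by case: (s x y) => a b /=; ring.
Qed.

Lemma fsqZ a x : fsq (a *: x) = cabs a ^+ 2 * fsq x.
Proof. by rewrite /fsq formZl formZr mulrA -cabs_sqrC ReM_real. Qed.

Lemma fsq_ge0 x : 0 <= fsq x.
Proof. exact: psd_ge0. Qed.

Lemma sqr_fnorm x : fnorm x ^+ 2 = fsq x.
Proof. by rewrite sqr_sqrtr// fsq_ge0. Qed.

Lemma fnorm_ge0 x : 0 <= fnorm x.
Proof. exact: sqrtr_ge0. Qed.

Lemma Re_form_le x y : complex.Re (s x y) ^+ 2 <= fsq x * fsq y.
Proof.
apply: discriminant_le; rewrite ?fsq_ge0// => t.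
have := fsq_ge0 (x + (t%:C)%C *: y).
rewrite fsqD fsqZ cabs_real real_normK ?num_real// formZr conjc_real ReM_real.
by rewrite mulrA.
Qed.

Lemma CauchySchwarz_sq x y : cabs (s x y) ^+ 2 <= fsq x * fsq y.
Proof.
have [c c1 cE] := cabs_rotate (s x y).
have := Re_form_le (c *: x) y.
by rewrite formZl cE fsqZ c1 expr1n mul1r.
Qed.

Lemma CauchySchwarz_form x y : cabs (s x y) <= fnorm x * fnorm y.
Proof.
rewrite -(ler_pXn2r (n := 2)) ?nnegrE ?mulr_ge0 ?cabs_ge0 ?fnorm_ge0//.
by rewrite exprMn !sqr_fnorm CauchySchwarz_sq.
Qed.

Lemma fnormD x y : fnorm (x + y) <= fnorm x + fnorm y.
Proof.
rewrite -(ler_pXn2r (n := 2)) ?nnegrE ?addr_ge0 ?fnorm_ge0//.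
rewrite sqrrD !sqr_fnorm fsqD lerD2r lerD2l -[leRHS]mulr_natl ler_pM2l//.
apply: le_trans (CauchySchwarz_form x y).
by rewrite (le_trans (ler_norm _))// Re_le_cabs.
Qed.

Lemma fnormZ a x : fnorm (a *: x) = cabs a * fnorm x.
Proof. by rewrite /fnorm fsqZ sqrtrM ?sqr_ge0// sqrtr_sqr ger0_norm// cabs_ge0. Qed.

Lemma fnormN x : fnorm (- x) = fnorm x.
Proof. by rewrite -scaleN1r fnormZ cabsN cabs1 mul1r. Qed.

Lemma fnorm_distC x y : fnorm (x - y) = fnorm (y - x).
Proof. by rewrite -fnormN opprB. Qed.

Lemma fnorm0 : fnorm 0 = 0.
Proof. by rewrite /fnorm /fsq form0l sqrtr0. Qed.

Definition form_cauchy (u : nat -> V) := forall e : R, 0 < e ->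
  exists N, forall m n, (N <= m)%N -> (N <= n)%N -> fnorm (u m - u n) < e.

Definition form_cvg (u : nat -> V) (l : V) := forall e : R, 0 < e ->
  exists N, forall n, (N <= n)%N -> fnorm (u n - l) < e.

Definition form_complete := forall u, form_cauchy u -> exists l, form_cvg u l.

Lemma harmonic_lt (e : R) : 0 < e ->
  exists N : nat, forall n, (N <= n)%N -> n.+1%:R^-1 < e.
Proof.
move=> e0; exists (Num.trunc e^-1) => n Nn.
rewrite invf_plt ?posrE// (lt_le_trans (truncnS_gt _))// ler_nat ltnS//.
Qed.

(* Almost minimizing [fsq v - 2 Re (phi v)] yields approximate Riesz
   representatives of [phi], whether or not [s] is complete. *)
Lemma riesz_seq (phi : V -> C) (M : R) :
  (forall a x y, phi (a *: x + y) = a * phi x + phi y) ->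
  (forall x, cabs (phi x) <= M * fnorm x) ->
  exists v : nat -> V, form_cauchy v /\
    forall n x, cabs (phi x - s x (v n)) <= n.+1%:R^-1 * fnorm x.
Proof.
move=> lphi bphi.
have phiZ a x : phi (a *: x) = a * phi x.
  have phi0 : phi 0 = 0.
    have := lphi 1 0 0; rewrite scale1r addr0 mul1r.
    by move=> /eqP; rewrite -subr_eq subrr eq_sym => /eqP.
  by rewrite -[a *: x]addr0 lphi phi0 addr0.
pose J v := fsq v - 2 * complex.Re (phi v).
have J_lb v : - M ^+ 2 <= J v.
  have h1 := le_trans (ler_norm _) (le_trans (Re_le_cabs (phi v)) (bphi v)).
  have h2 := sqr_ge0 (fnorm v - M).
  rewrite /J -sqr_fnorm; move: h2; rewrite sqrrB.
  by move: h1; set a := _ * fnorm v; rewrite mulrC -/a; lra.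
pose d := inf (range J).
have J_inf : has_inf (range J).
  by split; [exists (J 0), 0 | exists (- M ^+ 2) => _ [v _ <-]].
have dJ v : d <= J v by apply: ge_inf; [exact: J_inf.2|exists v].
have [v vP] : {v : nat -> V & forall n, J (v n) < d + (n.+1%:R^-1) ^+ 2}.
  apply: (@choice _ _ (fun n w => J w < d + (n.+1%:R^-1) ^+ 2)) => n.
  have e0 : 0 < (n.+1%:R^-1 : R) ^+ 2 by rewrite exprn_gt0// invr_gt0.
  by have [_ [w _ <-] ?] := inf_adherent e0 J_inf; exists w.
(* [J (v n)] exceeds the infimum by less than the square of [1 / (n + 1)], so along every line
   through [v n] a quadratic polynomial with that constant term stays nonnegative; its discriminant
   gives the bound. *)
have approx n x : cabs (phi x - s x (v n)) <= n.+1%:R^-1 * fnorm x.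
  have [c c1 cE] := cabs_rotate (phi x - s x (v n)).
  rewrite -(ler_pXn2r (n := 2)) ?nnegrE ?mulr_ge0 ?cabs_ge0 ?fnorm_ge0 ?invr_ge0//.
  rewrite exprMn sqr_fnorm.
  have -> : fsq x = fsq (c *: x) by rewrite fsqZ c1 expr1n mul1r.
  have -> : cabs (phi x - s x (v n)) = - complex.Re (s (c *: x) (v n) - phi (c *: x)).
    by rewrite formZl phiZ -mulrBr -(opprB (phi x)) mulrN cE/= opprK.
  rewrite sqrrN; apply: discriminant_le; rewrite ?sqr_ge0 ?fsq_ge0// => t.
  have := dJ (v n + (t%:C)%C *: (c *: x)); have := vP n.
  rewrite /J addrC [v n + _]addrC lphi !fsqD fsqZ cabs_real real_normK ?num_real//.
  rewrite formZl !ReD !ReM_real; case: (s _ _) => a b; case: (phi (c *: x)) => a' b' /=.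
  move: (complex.Re (phi (v n))) (fsq (v n)) (fsq (c *: x)) (_ ^+ 2) => p q r e h1 h2.
  rewrite mulrBr -!mulrA; lra.
exists v; split=> // e e0.
have [N NP] := harmonic_lt (divr_gt0 e0 (ltr0n R 2)).
exists N => m n Nm Nn; set x := v m - v n.
(* Both [v m] and [v n] nearly represent [phi], and [s x x] is the difference of their two errors at
   [x]. *)
have h : fsq x <= (m.+1%:R^-1 + n.+1%:R^-1) * fnorm x.
  have : cabs (s x x) <= (m.+1%:R^-1 + n.+1%:R^-1) * fnorm x.
    rewrite [in s x _]/x formBr mulrDl.
    have -> : s x (v m) - s x (v n) = (phi x - s x (v n)) - (phi x - s x (v m)).
      by ring.
    by rewrite (le_trans (cabsB _ _))// addrC lerD.
  by rewrite fsqE cabs_real ger0_norm ?fsq_ge0.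
have {}h : fnorm x <= m.+1%:R^-1 + n.+1%:R^-1.
  move: h; rewrite -sqr_fnorm expr2.
  have [->|xn0] := eqVneq (fnorm x) 0; first by rewrite addr_ge0 ?invr_ge0.
  by rewrite ler_pM2r// lt_def xn0 fnorm_ge0.
by apply: le_lt_trans h _; rewrite [e]splitr ltrD ?NP.
Qed.

Lemma riesz (phi : V -> C) (M : R) : form_complete ->
  (forall a x y, phi (a *: x + y) = a * phi x + phi y) ->
  (forall x, cabs (phi x) <= M * fnorm x) ->
  exists v, forall x, phi x = s x v.
Proof.
move=> cs lphi bphi; have [v [/cs[l vl] vP]] := riesz_seq lphi bphi.
exists l => x; apply/eqP; rewrite -subr_eq0 -cabs_eq0.
rewrite eq_le cabs_ge0 andbT; apply/ler_addgt0Pr => e e0; rewrite add0r.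
have e1 : 0 < e / 2 / (fnorm x + 1).
  by rewrite divr_gt0 ?divr_gt0// ltr_pwDr// fnorm_ge0.
have [N1 N1P] := harmonic_lt e1; have [N2 N2P] := vl _ e1.
pose n := maxn N1 N2.
have -> : phi x - s x l = (phi x - s x (v n)) + s x (v n - l).
  by rewrite formBr addrA subrK.
apply: le_trans (cabsD _ _) _.
have h1 := le_trans (vP n x) (ler_wpM2r (fnorm_ge0 x) (ltW (N1P n (leq_maxl _ _)))).
have h2 := le_trans (CauchySchwarz_form x (v n - l))
  (ler_wpM2l (fnorm_ge0 x) (ltW (N2P n (leq_maxr _ _)))).
apply: le_trans (lerD h1 h2) _; rewrite [X in _ + X]mulrC -mulrDl -mulrDl -splitr.
rewrite mulrAC ler_pdivrMr ?ltr_pwDr ?fnorm_ge0// ler_pM2l// lerDl//.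
Qed.

End PsdForm.
End Forms.

(** * The completion of a semi-inner product space *)

Section Dual.
Variable R : realType.
Local Notation C := R[i].
Variables (V : lmodType C) (s : V -> V -> C).

(* The bounded antilinear functionals realize the completion of [(V, s)]
   without taking a quotient. *)
Definition dual_pred : {pred V -> C} := fun phi => `[<
  (forall a x y, phi (a *: x + y) = (a^*)%C * phi x + phi y) /\
  exists M : R, forall x, cabs (phi x) <= M * fnorm s x >].

Lemma dual_submod : submod_closed dual_pred.
Proof.
split=> [|a f g /asboolP[lf [M fM]] /asboolP[lg [N gN]]]; apply/asboolP; split.
- by move=> a x y; rewrite /= /cst/= mulr0 addr0.
- by exists 0 => x; rewrite /cst/= cabs0 mul0r.
- move=> b x y; rewrite !fctE lf lg.
  have sE (c z : C) : c *: z = c * z by [].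
  by rewrite !sE; ring.
- exists (cabs a * M + N) => x; rewrite !fctE.
  apply: le_trans (cabsD _ _) _; rewrite mulrDl lerD// cabsM -mulrA.
  by rewrite ler_wpM2l ?cabs_ge0.
Qed.

HB.instance Definition _ := GRing.isSubmodClosed.Build _ _ dual_pred dual_submod.

Record dual := Dual { dual_fun :> V -> C; dualP : dual_fun \in dual_pred }.

HB.instance Definition _ := [isSub for dual_fun].
HB.instance Definition _ := [Choice of dual by <:].
HB.instance Definition _ := [SubChoice_isSubLmodule of dual by <:].

Hypothesis hs : psd_form s.
Implicit Types phi psi : dual.

Lemma dual_ext phi psi : (forall x, phi x = psi x) -> phi = psi.
Proof. by move=> h; apply/val_inj/funext. Qed.

Lemma dualD phi psi x : (phi + psi) x = phi x + psi x.
Proof. by []. Qed.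

Lemma dualZ a phi x : (a *: phi) x = a * phi x.
Proof. by []. Qed.

Lemma dual_lin phi a x y : phi (a *: x + y) = (a^*)%C * phi x + phi y.
Proof. by case: phi => f /= /asboolP[]. Qed.

Lemma dual_bound phi : exists M : R, forall x, cabs (phi x) <= M * fnorm s x.
Proof. by case: phi => f /= /asboolP[]. Qed.

Fact dual_of_subproof v : s v \in dual_pred.
Proof.
apply/asboolP; split=> [a x y|]; first by rewrite (formDr hs) (formZr hs).
by exists (fnorm s v) => x; exact: CauchySchwarz_form.
Qed.
Definition dual_of v : dual := Dual (dual_of_subproof v).

(** Density of [V] in the completion: the conjugate of an antilinear functional is linear, so
    [riesz_seq] applies to it. *)
Lemma dual_seq phi : exists v : nat -> V, form_cauchy s v /\
  forall n x, cabs (phi x - s (v n) x) <= n.+1%:R^-1 * fnorm s x.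
Proof.
have [M phiM] := dual_bound phi.
have [a x y|x|v [cv vP]] := riesz_seq hs (phi := fun x => ((phi x)^*)%C) (M := M).
- by rewrite dual_lin rmorphD rmorphM/= conjcK.
- by rewrite cabs_conj.
exists v; split=> // n x; have := vP n x.
by rewrite -cabs_conj rmorphB/= conjcK -(psd_herm hs).
Qed.

Definition approx phi : nat -> V := projT1 (cid (dual_seq phi)).

Lemma approxP phi n x :
  cabs (phi x - s (approx phi n) x) <= n.+1%:R^-1 * fnorm s x.
Proof. by rewrite /approx; case: cid => v [cv]. Qed.

Lemma approx_norm phi (M : R) n : 0 <= M ->
  (forall x, cabs (phi x) <= M * fnorm s x) ->
  fnorm s (approx phi n) <= M + n.+1%:R^-1.
Proof.
move=> M0 phiM; set v := approx phi n.
have h : fnorm s v ^+ 2 <= (M + n.+1%:R^-1) * fnorm s v.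
  have : cabs (s v v) <= (M + n.+1%:R^-1) * fnorm s v.
    have -> : s v v = phi v - (phi v - s v v) by rewrite subKr.
    by rewrite (le_trans (cabsB _ _))// mulrDl lerD// approxP.
  by rewrite (fsqE hs) cabs_real ger0_norm ?fsq_ge0// (sqr_fnorm hs).
have [v0|v0] := eqVneq (fnorm s v) 0; first by rewrite v0 addr_ge0 ?invr_ge0.
by move: h; rewrite expr2 ler_pM2r// lt_def v0 fnorm_ge0.
Qed.

Lemma dual_bound_ge0 phi :
  exists2 M : R, 0 <= M & forall x, cabs (phi x) <= M * fnorm s x.
Proof.
have [M phiM] := dual_bound phi; exists `|M| => // x.
by apply: le_trans (phiM x) _; rewrite ler_wpM2r ?fnorm_ge0// ler_norm.
Qed.

Lemma approx_bounded phi : exists M : R, forall n, fnorm s (approx phi n) <= M.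
Proof.
have [M M0 phiM] := dual_bound_ge0 phi; exists (M + 1) => n.
apply: le_trans (approx_norm n M0 phiM) _; rewrite lerD2l.
by rewrite invf_le1// ler1n.
Qed.

Lemma dual_approx_cbounded phi psi : cbounded (fun n => phi (approx psi n)).
Proof.
have [M M0 phiM] := dual_bound_ge0 phi; have [N psiN] := approx_bounded psi.
by exists (M * N) => n; apply: le_trans (phiM _) _; rewrite ler_wpM2l.
Qed.

(** The inner product of the completion, obtained by evaluating [phi] on vectors that approximate
    [psi]. As an ultralimit it is defined, and linear in [phi], without a proof that the values
    converge. *)
Definition ddot phi psi : C := culim nat_ultra (fun n => phi (approx psi n)).

Let UN := nat_ultraP.

Lemma near_inv_small (e K : R) : 0 < e ->
  \forall n \near nat_ultra, n.+1%:R^-1 * K <= e.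
Proof.
move=> e0; have k0 : 0 < `|K| + 1 by rewrite ltr_pwDr.
have [N NP] := harmonic_lt (divr_gt0 e0 k0).
apply: (@nat_ultra_ge _ N) => n Nn.
apply: le_trans (ler_norm _) _; rewrite normrM ger0_norm ?invr_ge0//.
have := ltW (NP _ Nn); rewrite ler_pdivlMr// => h.
by apply: le_trans h; rewrite ler_wpM2l ?invr_ge0// lerDl.
Qed.

Lemma culim0P (f : nat -> C) (K : R) :
  cbounded f -> (forall n, cabs (f n) <= n.+1%:R^-1 * K) -> culim nat_ultra f = 0.
Proof.
move=> bf fK; apply/eqP; rewrite -cabs_eq0 eq_le cabs_ge0 andbT.
apply/ler_addgt0Pr => e e0; rewrite add0r; apply: cabs_culim_le => //.
have := near_inv_small K e0; apply: filterS => n; exact: le_trans.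
Qed.

Lemma ddot_of phi w : ddot phi (dual_of w) = phi w.
Proof.
have [M M0 phiM] := dual_bound_ge0 phi.
apply/eqP; rewrite -subr_eq0 -[phi w](culim_cst UN) -mulN1r -culimZ//; last first.
  by exists (cabs (phi w)).
rewrite -culimD//; [|exact: dual_approx_cbounded|by exists (cabs (-1 * phi w))].
apply/eqP; apply: (@culim0P _ M).
  apply: cboundedD; first exact: dual_approx_cbounded.
  by exists (cabs (-1 * phi w)).
move=> n; rewrite mulN1r; set v := approx _ n.
have -> : phi v - phi w = phi (v - w).
  by rewrite -[v - w]addrC -scaleN1r dual_lin rmorphN rmorph1 mulN1r addrC.
apply: le_trans (phiM _) _; rewrite mulrC ler_wpM2r//.
(* The error of [v] as a representative of [dual_of w], evaluated at [v - w] itself, is the square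
   of the norm of [v - w]. *)
have vw := approxP (dual_of w) n (v - w).
move: vw; rewrite /= -/v -(formBl hs) -cabsN -(formNl hs) opprB (fsqE hs).
rewrite cabs_real ger0_norm ?fsq_ge0// -(sqr_fnorm hs) expr2.
have [->|v0] := eqVneq (fnorm s (v - w)) 0; first by rewrite invr_ge0.
by rewrite ler_pM2r// lt_def v0 fnorm_ge0.
Qed.

Lemma ddot_linl a phi psi chi :
  ddot (a *: phi + psi) chi = a * ddot phi chi + ddot psi chi.
Proof.
rewrite /ddot -culimZ//; last exact: dual_approx_cbounded.
rewrite -culimD//; last exact: dual_approx_cbounded.
exact/cboundedZ/dual_approx_cbounded.
Qed.

(** Replacing [phi] by its approximations as well makes the formula symmetric; Hermitian symmetry
    and positivity are read off from it. *)
Lemma ddotE phi psi :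
  ddot phi psi = culim nat_ultra (fun n => s (approx phi n) (approx psi n)).
Proof.
have [N psiN] := approx_bounded psi; have [M phiM] := approx_bounded phi.
have bs : cbounded (fun n => s (approx phi n) (approx psi n)).
  exists (M * N) => n; apply: le_trans (CauchySchwarz_form hs _ _) _.
  by apply: ler_pM; rewrite ?fnorm_ge0.
apply/eqP; rewrite -subr_eq0 -mulN1r -culimZ// -culimD//; last exact: cboundedZ.
  apply/eqP; apply: (@culim0P _ N) => [|n].
    by apply: cboundedD; [exact: dual_approx_cbounded|exact: cboundedZ].
  by rewrite mulN1r; apply: le_trans (approxP _ _ _) _; rewrite ler_wpM2l ?invr_ge0.
exact: dual_approx_cbounded.
Qed.

Lemma ddot_psd : psd_form ddot.
Proof.
split=> [a phi psi chi|phi psi|phi].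
- exact: ddot_linl.
- rewrite !ddotE -culim_conj//; last first.
    have [N psiN] := approx_bounded psi; have [M phiM] := approx_bounded phi.
    exists (M * N) => n; apply: le_trans (CauchySchwarz_form hs _ _) _.
    by apply: ler_pM; rewrite ?fnorm_ge0.
  by congr (culim _ _); apply/funext => n; rewrite -(psd_herm hs).
- rewrite ddotE; rewrite -[0]/(complex.Re (0 : C)) -(culim_cst UN 0).
  apply: Re_culim_le => //; first by exists (cabs (0 : C)).
    have [M phiM] := approx_bounded phi.
    exists (M * M) => n; apply: le_trans (CauchySchwarz_form hs _ _) _.
    by apply: ler_pM; rewrite ?fnorm_ge0.
  by apply: filterE => n; exact: psd_ge0.
Qed.

Lemma ddot_dual_of v psi : ddot (dual_of v) psi = ((psi v)^*)%C.
Proof. by rewrite (psd_herm ddot_psd) ddot_of. Qed.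

Lemma fnorm_dual_of v : fnorm ddot (dual_of v) = fnorm s v.
Proof. by rewrite /fnorm /fsq ddot_of. Qed.

Lemma dual_le phi x : cabs (phi x) <= fnorm ddot phi * fnorm s x.
Proof. by rewrite -ddot_of -(fnorm_dual_of x); exact: CauchySchwarz_form ddot_psd _ _. Qed.

Lemma dual_norm_le phi (M : R) : 0 <= M ->
  (forall x, cabs (phi x) <= M * fnorm s x) -> fnorm ddot phi <= M.
Proof.
move=> M0 phiM; rewrite -(ler_pXn2r (n := 2)) ?nnegrE ?fnorm_ge0//.
rewrite (sqr_fnorm ddot_psd) /fsq; apply/ler_addgt0Pr => e e0.
apply: le_trans (ler_norm _) (le_trans (Re_le_cabs _) _).
apply: cabs_culim_le => //; first exact: dual_approx_cbounded.
have := near_inv_small M e0; apply: filterS => n nM.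
apply: le_trans (phiM _) _.
apply: le_trans (ler_wpM2l M0 (approx_norm n M0 phiM)) _.
by rewrite mulrDr -expr2 lerD2l mulrC.
Qed.

Lemma ddot_definite phi : fsq ddot phi = 0 -> phi = 0.
Proof.
move=> phi0; apply: dual_ext => x.
apply/eqP; rewrite -cabs_eq0 eq_le cabs_ge0 andbT.
by apply: le_trans (dual_le phi x) _; rewrite /fnorm phi0 sqrtr0 mul0r.
Qed.

(** A Cauchy sequence of functionals is uniformly bounded, so its pointwise ultralimit is again a
    bounded functional, and the Cauchy estimate passes to that limit. *)
Lemma ddot_complete : form_complete ddot.
Proof.
move=> u cu.
have dB k l x : (u k - u l) x = u k x - u l x by [].
have [M uM] : exists M : R, forall k x, cabs (u k x) <= M * fnorm s x.
  have [N NP] := cu 1 ltr01.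
  exists (\sum_(i < N.+1) fnorm ddot (u i) + 1) => k x.
  have [kN|Nk] := ltnP k N.
    apply: le_trans (dual_le _ _) _; rewrite ler_wpM2r ?fnorm_ge0//.
    rewrite (bigD1 (Ordinal (ltnW kN : (k < N.+1)%N)))//= -addrA lerDl addr_ge0//.
    by apply: sumr_ge0 => i _; exact: fnorm_ge0.
  have -> : u k x = u N x + (u k - u N) x by rewrite dB addrC subrK.
  apply: le_trans (cabsD _ _) _; rewrite mulrDl; apply: lerD.
    apply: le_trans (dual_le _ _) _; rewrite ler_wpM2r ?fnorm_ge0//.
    rewrite (bigD1 ord_max)//= lerDl.
    by apply: sumr_ge0 => i _; exact: fnorm_ge0.
  apply: le_trans (dual_le _ _) _; rewrite ler_wpM2r ?fnorm_ge0//.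
  by apply/ltW/NP.
have bu x : cbounded (fun k => u k x) by exists (M * fnorm s x).
pose l x := culim nat_ultra (fun k => u k x).
have lP : l \in dual_pred.
  apply/asboolP; split=> [a x y|].
    rewrite /l -culimZ// -culimD//; last exact: cboundedZ.
    by congr (culim _ _); apply/funext => k; rewrite dual_lin.
  by exists M => x; apply: cabs_culim_le => //; exact: filterE.
exists (Dual lP) => e e0.
have e2 : 0 < e / 2 by rewrite divr_gt0.
have [N NP] := cu _ e2; exists N => n Nn.
apply: (@le_lt_trans _ _ (e / 2)); last by rewrite ltr_pdivrMr// ltr_pMr// ltr1n.
apply: dual_norm_le; first exact: ltW.
move=> x.
have -> : (u n - Dual lP) x = culim nat_ultra (fun k => u n x + -1 * u k x).
  rewrite culimD ?culim_cst ?culimZ//; first by rewrite mulN1r.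
  - by exists (cabs (u n x)).
  - exact: cboundedZ.
apply: cabs_culim_le => //.
  by apply: cboundedD; [exists (cabs (u n x))|exact: cboundedZ].
apply: (@nat_ultra_ge _ N) => k Nk; rewrite mulN1r -dB.
apply: le_trans (dual_le _ _) _; rewrite ler_wpM2r ?fnorm_ge0//.
by apply/ltW/NP.
Qed.

End Dual.

(** * Hilbert spaces built from complete definite forms *)

Section HilbertOfForm.
Variable R : realType.
Local Notation C := R[i].
Variables (V : lmodType C) (s : V -> V -> C).

Definition definite_form := forall x, fsq s x = 0 -> x = 0.

(** The proofs are arguments of the alias, so that the structures declared on it can refer to
    them. *)
Definition hilbert_of (hs : psd_form s) (ds : definite_form)
  (cs : form_complete s) : Type := V.

Variables (hs : psd_form s) (ds : definite_form) (cs : form_complete s).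
Local Notation H := (hilbert_of hs ds cs).

HB.instance Definition _ := GRing.Lmodule.copy H V.

Definition hilbert_norm (x : H) : C := (fnorm s x)%:C%C.

Lemma hilbert_normD (x y : H) :
  hilbert_norm (x + y) <= hilbert_norm x + hilbert_norm y.
Proof. by rewrite -rmorphD/= lecR; exact: fnormD. Qed.

Lemma hilbert_normZ (a : C) (x : H) :
  hilbert_norm (a *: x) = `|a| * hilbert_norm x.
Proof. by rewrite /hilbert_norm (fnormZ hs) rmorphM/= -cabsE. Qed.

Lemma hilbert_norm0_eq0 (x : H) : hilbert_norm x = 0 -> x = 0.
Proof.
move=> /complexI x0; apply: ds; rewrite -(sqr_fnorm hs) x0 expr0n//.
Qed.

HB.instance Definition _ := Lmodule_isNormed.Build C H
  hilbert_normD hilbert_normZ hilbert_norm0_eq0.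

Lemma hilbert_normE (x : H) : `|x| = (fnorm s x)%:C%C.
Proof. by []. Qed.

(** Completeness for filters from completeness for sequences: the centres of balls of radius
    [1 / (n + 1)] that belong to [F] form a Cauchy sequence, and its limit is a limit of [F]. *)
Lemma hilbert_complete (F : set_system H) : ProperFilter F -> cauchy F -> cvg F.
Proof.
move=> FF /cauchyP Fc.
have /choice[u uP] : forall n : nat, exists x : H,
    F (ball x (n.+1%:R^-1 : R)%:C%C).
  by move=> n; apply: Fc; rewrite ltcR invr_gt0.
have uC : form_cauchy s u.
  move=> e e0; have [N NP] := harmonic_lt (divr_gt0 e0 (ltr0n R 2)).
  exists N => m n Nm Nn.
  have [x []] := filter_ex (filterI (uP m) (uP n)).
  rewrite -!ball_normE /ball_/= !hilbert_normE !ltcR => h1 h2.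
  have -> : u m - u n = (u m - x) - (u n - x) by rewrite opprB addrA subrK.
  apply: le_lt_trans (fnormD hs _ _) _; rewrite (fnormN hs) [e]splitr.
  by apply: ltrD; [exact: lt_trans h1 (NP _ Nm)|exact: lt_trans h2 (NP _ Nn)].
have [l ul] := cs uC.
apply/cvg_ex; exists l; apply/cvgrPdist_lt => e e0.
have eE : e = (complex.Re e)%:C%C by rewrite RRe_real// gtr0_real.
have e0' : 0 < complex.Re e by rewrite -ltcR -eE.
have [N1 NP1] := harmonic_lt (divr_gt0 e0' (ltr0n R 2)).
have [N2 NP2] := ul _ (divr_gt0 e0' (ltr0n R 2)).
pose n := maxn N1 N2; apply: filterS (uP n) => x.
rewrite -ball_normE /ball_/= !hilbert_normE eE !ltcR => h1.
have -> : l - x = (u n - x) - (u n - l) by rewrite opprB [RHS]addrC addrA subrK.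
apply: le_lt_trans (fnormD hs _ _) _; rewrite (fnormN hs) [complex.Re e]splitr.
apply: ltrD; last by apply: NP2; rewrite leq_maxr.
by apply: lt_trans h1 (NP1 _ _); rewrite leq_maxl.
Qed.

HB.instance Definition _ := Uniform_isComplete.Build H hilbert_complete.

Definition hilbert_dot (x y : H) : C := s x y.

Fact hilbert_dot_bilinear : bilinear_for
  (GRing.Scale.Law.clone _ _ ( *%R ) _)
  (GRing.Scale.Law.clone _ _ (@Num.conj C \; *%R ) _) hilbert_dot.
Proof.
split=> [z a x y|z a x y]; first exact: (psd_linl hs).
by rewrite /hilbert_dot (formDr hs) (formZr hs).
Qed.

HB.instance Definition _ := bilinear_isBilinear.Build C H H C
  (GRing.Scale.Law.clone _ _ ( *%R ) _)
  (GRing.Scale.Law.clone _ _ (@Num.conj C \; *%R ) _) hilbert_dot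
  hilbert_dot_bilinear.

Fact hilbert_dot_herm (x y : H) :
  hilbert_dot x y = (-1) ^+ false * Num.conj (hilbert_dot y x).
Proof. by rewrite expr0 mul1r; exact: (psd_herm hs). Qed.

HB.instance Definition _ := isHermitianSesquilinear.Build C H false
  (@Num.conj C) hilbert_dot hilbert_dot_herm.

Fact hilbert_dot_gt0 (x : H) : x != 0 -> 0 < hilbert_dot x x.
Proof.
move=> x0; rewrite /hilbert_dot (fsqE hs) ltcR lt_def fsq_ge0// andbT.
by apply: contra x0 => /eqP/ds ->.
Qed.

HB.instance Definition _ := isDotProduct.Build C H hilbert_dot hilbert_dot_gt0.

Fact hilbert_sqr_norm (x : H) : `|x| ^+ 2 = hilbert_dot x x.
Proof. by rewrite hilbert_normE -rmorphXn/= (sqr_fnorm hs) /hilbert_dot (fsqE hs). Qed.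

HB.instance Definition _ := CompleteNormedModule_isHilbert.Build R H hilbert_sqr_norm.

Definition hilbertOf : hilbertType R := H.

End HilbertOfForm.

(** * Hilbert spaces and bounded operators in terms of forms *)

Section HilbertTheory.
Variables (R : realType) (H : hilbertType R).
Local Notation C := R[i].
Local Notation s := (@inner R H).
Local Notation nrm := (fnorm s).

Let normE (x : H) : `|x| = (complex.Re `|x|)%:C%C.
Proof. by rewrite RRe_real// normr_real. Qed.

Lemma inner_psd : psd_form s.
Proof.
split=> [a x y z|x y|x].
- by rewrite linearDl linearZl_LR.
- by rewrite hermC expr0 mul1r.
- by rewrite -sqr_norm_inner normE -rmorphXn/= sqr_ge0.
Qed.

Lemma norm_fnorm (x : H) : `|x| = (nrm x)%:C%C.
Proof.
rewrite normE; congr (_%:C)%C; rewrite /fnorm /fsq -sqr_norm_inner normE.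
by rewrite -rmorphXn/= sqrtr_sqr ger0_norm// -ler0c RRe_real ?normr_real.
Qed.

Lemma inner_definite : definite_form s.
Proof.
by move=> x x0; apply/eqP; rewrite -normr_eq0 norm_fnorm /fnorm x0 sqrtr0.
Qed.

Lemma inner_complete : form_complete s.
Proof.
move=> u uC.
have uc : cauchy (u @ \oo).
  apply: cauchy_exP => e e0.
  have eE : e = (complex.Re e)%:C%C by rewrite RRe_real// gtr0_real.
  have e0' : 0 < complex.Re e by rewrite -ltcR -eE.
  have [N NP] := uC _ e0'; exists (u N); exists N => // n /= Nn.
  by rewrite -ball_normE /ball_/= norm_fnorm eE ltcR; exact: NP.
have /cauchy_cvg/cvg_ex[l ul] := uc.
exists l => e e0; have e0' : 0 < (e%:C)%C by rewrite ltcR.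
move/cvgrPdist_lt: ul => /(_ _ e0')[N _ NP]; exists N => n Nn.
by have := NP n Nn; rewrite /= norm_fnorm ltcR (fnorm_distC inner_psd).
Qed.

Lemma op_norm_le (f : {linear H -> H}) (M : R) : 0 <= M ->
  (op_norm f <= M%:E)%E <-> forall x, nrm (f x) <= M * nrm x.
Proof.
move=> M0; split=> [fM x|fM].
  have [x0|x0] := eqVneq (nrm x) 0.
    have -> : x = 0 by apply/eqP; rewrite -normr_eq0 norm_fnorm x0.
    by rewrite linear0 (fnorm0 inner_psd) mulr0.
  have x1 : 0 < nrm x by rewrite lt_def x0 fnorm_ge0.
  have : ((nrm (f (((nrm x)^-1)%:C%C *: x)))%:E <= M%:E)%E.
    apply: le_trans fM; apply: ereal_sup_ubound.
    exists (((nrm x)^-1)%:C%C *: x); last by rewrite norm_fnorm.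
    rewrite /= norm_fnorm lecR (fnormZ inner_psd) cabs_real.
    by rewrite ger0_norm ?invr_ge0 ?fnorm_ge0// mulVf.
  rewrite lee_fin linearZ/= (fnormZ inner_psd) cabs_real.
  by rewrite ger0_norm ?invr_ge0 ?fnorm_ge0// mulrC ler_pdivrMr.
apply: ge_ereal_sup => _ [x /= x1 <-].
rewrite lee_fin norm_fnorm/=; apply: le_trans (fM x) _.
move: x1; rewrite norm_fnorm -[1]/(1%:C%C) lecR => x1.
by rewrite ler_piMr.
Qed.

Lemma bounded_opP (f : {linear H -> H}) :
  bounded_op f <-> exists2 M, 0 <= M & forall x, nrm (f x) <= M * nrm x.
Proof.
split=> [|[M M0 fM]]; last first.
  by apply: le_lt_trans (ltry M); apply/op_norm_le.
rewrite /bounded_op; case E : (op_norm f) => [r| |]// _.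
  by exists `|r| => //; apply/op_norm_le => //; rewrite E lee_fin ler_norm.
by exists 0 => //; apply/op_norm_le => //; rewrite E leNye.
Qed.

Lemma uniformly_boundedP (G : groupType) (pi : G -> {linear H -> H}) :
  uniformly_bounded pi <->
  exists2 M, 0 <= M & forall t x, nrm (pi t x) <= M * nrm x.
Proof.
split=> [|[M M0 fM]]; last first.
  apply: le_lt_trans (ltry M); apply: ge_ereal_sup => _ [t _ <-].
  exact/op_norm_le.
rewrite /uniformly_bounded; case E : (ereal_sup _) => [r| |]// _.
  exists `|r| => // t; apply/op_norm_le => //.
  apply: (@le_trans _ _ r%:E); last by rewrite lee_fin ler_norm.
  by rewrite -E; apply: ereal_sup_ubound; exists t.
exists 0 => // t; apply/op_norm_le => //; apply: (@le_trans _ _ (-oo)%E).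
  by rewrite -E; apply: ereal_sup_ubound; exists t.
exact: leNye.
Qed.

End HilbertTheory.

(** * Amenable groups are unitarizable *)

Section LinearOf.
Variables (R : pzRingType) (U V : lmodType R) (f : U -> V).
(** Carrying the linearity proof as an argument lets a bare function receive its linear
    structure. *)
Definition linear_fun (_ : linear f) : U -> V := f.
Hypothesis lf : linear f.
HB.instance Definition _ := GRing.isLinear.Build R U V *:%R (linear_fun lf) lf.
Definition linear_of : {linear U -> V} := linear_fun lf.
End LinearOf.

Section Powers.
Variable R : realType.

Lemma expr_small (r e : R) : 0 <= r < 1 -> 0 < e -> exists n : nat, r ^+ n < e.
Proof.
move=> /andP[r0 r1] e0.
have /cvg_expr h : `|r| < 1 by rewrite ger0_norm.
have h' : \forall n \near \oo, `|0 - r ^+ n| < e by move/cvgrPdist_lt: h => /(_ e e0).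
have [n] := filter_ex h'.
by rewrite sub0r normrN ger0_norm ?exprn_ge0// => ?; exists n.
Qed.

(** Stands in for passage to the limit: identities between limits of geometrically convergent
    iterations are shown by bounding their defect by [c * r ^+ n]. *)
Lemma le0_expr (r a c : R) : 0 <= r < 1 -> (forall n, a <= c * r ^+ n) -> a <= 0.
Proof.
move=> r01 h; apply/ler_addgt0Pr => e e0; rewrite add0r.
have c0 : 0 < `|c| + 1 by rewrite ltr_pwDr.
have [n nP] := expr_small r01 (divr_gt0 e0 c0).
apply: le_trans (h n) _.
apply: (@le_trans _ _ ((`|c| + 1) * r ^+ n)).
  have /andP[r0 _] := r01.
  by rewrite ler_wpM2r ?exprn_ge0// (le_trans (ler_norm _))// lerDl.
by rewrite mulrC -ler_pdivlMr// ltW.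
Qed.

End Powers.

Section FormOperator.
Variable R : realType.
Local Notation C := R[i].
Variables (V : lmodType C) (s q : V -> V -> C).
Hypotheses (hs : psd_form s) (hq : psd_form q).
Hypotheses (ds : definite_form s) (cs : form_complete s).
Local Notation nrm := (fnorm s).

Lemma fnorm_eq0 x : nrm x = 0 -> x = 0.
Proof. by move=> x0; apply: ds; rewrite -(sqr_fnorm hs) x0 expr0n. Qed.

Lemma fnorm_le0 x : nrm x <= 0 -> x = 0.
Proof. by move=> x0; apply: fnorm_eq0; apply/eqP; rewrite eq_le x0 fnorm_ge0. Qed.

Lemma form_ext x y : (forall z, s x z = s y z) -> x = y.
Proof.
move=> h; apply/eqP; rewrite -subr_eq0; apply/eqP/ds.
by rewrite /fsq (formBl hs) h subrr.
Qed.

Lemma form_operator (K : R) : (forall x, fnorm q x <= K * nrm x) ->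
  exists Q : V -> V, linear Q /\ forall x y, q x y = s (Q x) y.
Proof.
move=> qK.
have /choice[Q QP] : forall x, exists v, forall y, q y x = s y v.
  move=> x; apply: (riesz hs (M := fnorm q x * K) cs) => [a y z|y].
    exact: psd_linl.
  apply: le_trans (CauchySchwarz_form hq _ _) _.
  by rewrite mulrC -mulrA ler_wpM2l ?fnorm_ge0.
have qE x y : q x y = s (Q x) y by rewrite (psd_herm hq) QP -(psd_herm hs).
exists Q; split=> // a x y; apply: form_ext => z.
by rewrite -qE (psd_linl hs) (psd_linl hq) !qE.
Qed.

End FormOperator.

(** * Square roots of positive operators *)

Section SquareRoot.
Variable R : realType.
Local Notation C := R[i].
Variables (V : lmodType C) (s q : V -> V -> C).
Hypotheses (hs : psd_form s) (hq : psd_form q).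
Hypotheses (ds : definite_form s) (cs : form_complete s).
Local Notation nrm := (fnorm s).
Variable d : R.
Hypotheses (d0 : 0 < d) (dq : forall x, d * fsq s x <= fsq q x)
  (qs : forall x, fsq q x <= fsq s x).

Let r := 1 - d.

(** The Cauchy-Schwarz inequality for the semidefinite form [s (X x) y], taken at [y = X x]. *)
Lemma selfadjoint_bound (X : V -> V) (c : R) : 0 <= c -> linear X ->
  (forall x y, s (X x) y = s x (X y)) ->
  (forall x, 0 <= complex.Re (s (X x) x) <= c * fsq s x) ->
  forall x, nrm (X x) <= c * nrm x.
Proof.
move=> c0 lX aX pX x.
have hX : psd_form (fun x y => s (X x) y).
  split=> [a u v w|u v|u]; first by rewrite lX (psd_linl hs).
    by rewrite aX (psd_herm hs).
  by have /andP[] := pX u.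
have := CauchySchwarz_sq hX x (X x).
rewrite (fsqE hs) cabs_real ger0_norm ?fsq_ge0// => h.
have {h} : fsq s (X x) ^+ 2 <= (c * fsq s x) * (c * fsq s (X x)).
  apply: le_trans h _; apply: ler_pM; rewrite /fsq.
  - by have /andP[] := pX x.
  - by have /andP[] := pX (X x).
  - by have /andP[] := pX x.
  - by have /andP[] := pX (X x).
have [X0|X0] := eqVneq (fsq s (X x)) 0.
  by rewrite /fnorm X0 sqrtr0 mulr_ge0 ?sqrtr_ge0.
rewrite mulrA expr2 ler_pM2r ?lt_def ?X0 ?fsq_ge0// => h.
rewrite -(ler_pXn2r (n := 2)) ?nnegrE ?mulr_ge0 ?fnorm_ge0//.
by rewrite exprMn !(sqr_fnorm hs) expr2 mulrAC.
Qed.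

(** Write [q x y = s (Q x) y] and [X = 1 - Q]; the bounds on [q] say that [X] has norm at most
    [r = 1 - d < 1]. The iteration [Y' = (X + Y^2) / 2] then converges geometrically to some [Z]
    with [2 Z = X + Z^2], so [T = 1 - Z] is self-adjoint with [T^2 = 1 - X = Q]. *)
Lemma sqrt_operator : exists T : V -> V, [/\ linear T,
  forall x y, s (T x) (T y) = q x y & forall y, exists x, T x = y].
Proof.
(* For [d > 1] the two bounds on [q] force every vector to be zero, and the identity works. *)
have [[] d1|nz] := pselect (d <= 1); last first.
  have V0 (x : V) : x = 0.
    apply: ds; apply/eqP; rewrite eq_le fsq_ge0// andbT.
    have h := le_trans (dq x) (qs x).
    rewrite leNgt; apply/negP => x0; apply: nz.
    by rewrite -(ler_pM2r x0) mul1r.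
  exists idfun; split=> [a x y|x y|y]; [by []| |by exists y].
  by rewrite (V0 x) (form0l hs) (form0l hq).
have qle x : fnorm q x <= 1 * nrm x by rewrite mul1r ler_sqrt// fsq_ge0.
have [Q [lQ QE]] := form_operator hs hq ds cs qle.
have QA x y : s (Q x) y = s x (Q y).
  by rewrite -QE (psd_herm hq) QE -(psd_herm hs).
have r0 : 0 <= r by rewrite subr_ge0.
have r1 : r < 1 by rewrite ltrBlDr ltrDl.
have r01 : 0 <= r < 1 by rewrite r0.
pose X x := x - Q x.
have lX : linear X.
  by move=> a x y; rewrite /X lQ scalerBr opprD addrACA.
have XA x y : s (X x) y = s x (X y).
  by rewrite /X (formBl hs) (formBr hs) QA.
have Xr : forall x, nrm (X x) <= r * nrm x.
  apply: selfadjoint_bound => // x.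
  have -> : complex.Re (s (X x) x) = fsq s x - fsq q x.
    rewrite /X (formBl hs) -QE /fsq.
    by case: (s x x) => a b; case: (q x x).
  by rewrite subr_ge0 qs/= /r mulrBl mul1r lerD2l lerN2.
pose h : C := (2^-1 : R)%:C%C.
have ch : cabs h = 2^-1 by rewrite /h cabs_real ger0_norm.
pose Y n : V -> V := iter n (fun f x => h *: (X x + f (f x))) (fun=> 0).
have lY n : linear (Y n).
  elim: n => [a x y|n IH a x y] /=; first by rewrite scaler0 addr0.
  have -> : X (a *: x + y) + Y n (Y n (a *: x + y)) =
      a *: (X x + Y n (Y n x)) + (X y + Y n (Y n y)).
    by rewrite lX !IH addrACA [in RHS]scalerDr.
  by rewrite scalerDr !scalerA mulrC.
have YB n x y : Y n (x - y) = Y n x - Y n y.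
  by rewrite -[x - y]addrC -scaleN1r lY scaleN1r addrC.
have YA n x y : s (Y n x) y = s x (Y n y).
  elim: n x y => [x y|n IH x y] /=; first by rewrite (form0l hs) (form0r hs).
  rewrite (formZl hs) (formZr hs) conjc_real; congr (_ * _).
  by rewrite (formDl hs) (formDr hs) XA !IH.
have Yr n x : nrm (Y n x) <= r * nrm x.
  elim: n x => [x|n IH x] /=; first by rewrite (fnorm0 hs) mulr_ge0 ?fnorm_ge0.
  rewrite (fnormZ hs) ch mulrC ler_pdivrMr//.
  apply: le_trans (fnormD hs _ _) _; rewrite mulrDr mulr1; apply: lerD => //.
  apply: le_trans (IH _) _; rewrite ler_wpM2l//; apply: le_trans (IH _) _.
  by rewrite ler_piMl ?fnorm_ge0// ltW.
(* The difference of two squares splits as [Y' (Y' - Y) + (Y' - Y) Y]; each summand gains a factor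
   [r], and the half in the iteration absorbs their number. *)
have Yc n k x : nrm (Y (n + k)%N x - Y n x) <= r ^+ n * nrm x.
  elim: n x => [x|n IH x].
    rewrite add0n expr0 mul1r /= subr0; apply: le_trans (Yr _ _) _.
    by rewrite ler_piMl ?fnorm_ge0// ltW.
  rewrite addSn /= -scalerBr opprD addrACA subrr add0r (fnormZ hs) ch mulrC.
  rewrite ler_pdivrMr//.
  have -> : Y (n + k)%N (Y (n + k)%N x) - Y n (Y n x) =
      Y (n + k)%N (Y (n + k)%N x - Y n x) + (Y (n + k)%N (Y n x) - Y n (Y n x)).
    by rewrite YB addrA subrK.
  apply: le_trans (fnormD hs _ _) _; rewrite mulrDr mulr1 exprS; apply: lerD.
    apply: le_trans (Yr _ _) _; rewrite -mulrA ler_wpM2l//.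
  apply: le_trans (IH _) _; rewrite [r * _]mulrC -mulrA.
  by rewrite ler_wpM2l ?exprn_ge0.
have /choice[Z ZP] : forall x, exists l, form_cvg s (fun n => Y n x) l.
  move=> x; apply: cs => e e0.
  have c0 : 0 < nrm x + 1 by rewrite ltr_pwDr// fnorm_ge0.
  have [N NP] := expr_small r01 (divr_gt0 (divr_gt0 e0 (ltr0n R 2)) c0).
  have YN k : (N <= k)%N -> nrm (Y k x - Y N x) < e / 2.
    move=> Nk; rewrite -(subnKC Nk); apply: le_lt_trans (Yc _ _ _) _.
    move: NP; rewrite ltr_pdivlMr//; apply: le_lt_trans.
    by rewrite ler_wpM2l ?exprn_ge0// lerDl.
  exists N => m n Nm Nn.
  have -> : Y m x - Y n x = (Y m x - Y N x) - (Y n x - Y N x).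
    by rewrite opprB addrA subrK.
  apply: le_lt_trans (fnormD hs _ _) _; rewrite (fnormN hs) [e]splitr.
  by apply: ltrD; exact: YN.
have Zc n x : nrm (Z x - Y n x) <= r ^+ n * nrm x.
  apply/ler_addgt0Pr => e e0; have [N NP] := ZP x e e0.
  have -> : Z x - Y n x = (Y (n + N)%N x - Y n x) - (Y (n + N)%N x - Z x).
    by rewrite opprB [RHS]addrC addrA subrK.
  apply: le_trans (fnormD hs _ _) _; rewrite (fnormN hs); apply: lerD => //.
  by apply/ltW/NP; rewrite leq_addl.
have lZ : linear Z.
  move=> a x y; apply/eqP; rewrite -subr_eq0; apply/eqP/(fnorm_le0 hs ds).
  apply: (@le0_expr _ r _ (nrm (a *: x + y) + (cabs a * nrm x + nrm y))) => // n.
  have -> : Z (a *: x + y) - (a *: Z x + Z y) =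
    (Z (a *: x + y) - Y n (a *: x + y)) - (a *: (Z x - Y n x) + (Z y - Y n y)).
    by rewrite lY scalerBr [_ - _ + (_ - _)]addrACA -opprD opprB addrA subrK.
  apply: le_trans (fnormD hs _ _) _; rewrite (fnormN hs) mulrDl; apply: lerD.
    by rewrite mulrC.
  apply: le_trans (fnormD hs _ _) _; rewrite mulrDl; apply: lerD.
    by rewrite (fnormZ hs) -mulrA ler_wpM2l ?cabs_ge0// mulrC.
  by rewrite mulrC.
have ZA x y : s (Z x) y = s x (Z y).
  apply/eqP; rewrite -subr_eq0 -cabs_eq0 eq_le cabs_ge0 andbT.
  apply: (@le0_expr _ r _ (nrm x * nrm y + nrm x * nrm y)) => // n.
  have -> : s (Z x) y - s x (Z y) = s (Z x - Y n x) y - s x (Z y - Y n y).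
    by rewrite (formBl hs) (formBr hs) YA opprB addrA subrK.
  apply: le_trans (cabsB _ _) _; rewrite mulrDl; apply: lerD.
    apply: le_trans (CauchySchwarz_form hs _ _) _.
    by rewrite mulrAC ler_wpM2r ?fnorm_ge0// mulrC.
  apply: le_trans (CauchySchwarz_form hs _ _) _.
  by rewrite -mulrA ler_wpM2l ?fnorm_ge0// mulrC.
have ZE x : Z x + Z x = X x + Z (Z x).
  apply/eqP; rewrite -subr_eq0; apply/eqP/(fnorm_le0 hs ds).
  pose c := r * nrm x + r * nrm x + (r * nrm x + nrm (Z x)).
  apply: (@le0_expr _ r _ c) => // n.
  have YE : Y n.+1 x + Y n.+1 x = X x + Y n (Y n x).
    rewrite /= -scalerDl -[RHS]scale1r; congr (_ *: _).
    by rewrite /h -rmorphD/= -[RHS](rmorph1 (real_complex R)); congr (_%:C)%C; field.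
  have -> : Z x + Z x - (X x + Z (Z x)) =
      (Z x - Y n.+1 x + (Z x - Y n.+1 x)) -
      (Y n (Z x - Y n x) + (Z (Z x) - Y n (Z x))).
    rewrite [in RHS]addrACA -[in RHS]opprD YE YB [_ - _ + (_ - _)]addrC addrA subrK.
    by rewrite opprB [in RHS]addrA !opprD !addrA subrK.
  apply: le_trans (fnormD hs _ _) _; rewrite (fnormN hs) mulrDl; apply: lerD.
    apply: le_trans (fnormD hs _ _) _; rewrite mulrDl.
    by rewrite mulrAC -exprS; apply: lerD.
  apply: le_trans (fnormD hs _ _) _; rewrite mulrDl; apply: lerD.
    apply: le_trans (Yr _ _) _; rewrite -mulrA ler_wpM2l//.
    by rewrite mulrC.
  by rewrite mulrC.
pose T x := x - Z x.
have TT x : T (T x) = Q x.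
  have ZB y z : Z (y - z) = Z y - Z z.
    by rewrite -[y - z]addrC -scaleN1r lZ scaleN1r addrC.
  rewrite /T ZB.
  have -> : x - Z x - (Z x - Z (Z x)) = x - (Z x + Z x) + Z (Z x).
    by rewrite opprB opprD !addrA [RHS]addrAC.
  by rewrite ZE opprD addrA subrK /X subKr.
have TA x y : s (T x) y = s x (T y) by rewrite /T (formBl hs) (formBr hs) ZA.
exists T; split.
- by move=> a x y; rewrite /T lZ scalerBr opprD addrACA.
- by move=> x y; rewrite -TA TT -QE.
- move=> y.
  (* Surjectivity: by the lower bound [q] is complete too, so the Riesz representation for [q]
     solves [Q v = y], that is [T (T v) = y]. *)
  have cq : form_complete q.
    move=> u uC; have sC : form_cauchy s u.
      move=> e e0; have sd : 0 < Num.sqrt d by rewrite sqrtr_gt0.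
      have [N NP] := uC _ (mulr_gt0 sd e0); exists N => m n Nm Nn.
      have h1 := NP _ _ Nm Nn; rewrite -(ltr_pM2l sd); apply: le_lt_trans h1.
      by rewrite /fnorm -sqrtrM ?(ltW d0)// ler_sqrt ?fsq_ge0.
    have [l lP] := cs sC; exists l => e e0; have [N NP] := lP e e0.
    exists N => n Nn; apply: le_lt_trans (NP n Nn).
    by have := qle (u n - l); rewrite mul1r.
  have bq x : cabs (s x y) <= (Num.sqrt d)^-1 * nrm y * fnorm q x.
    apply: le_trans (CauchySchwarz_form hs _ _) _.
    rewrite mulrAC ler_wpM2r ?fnorm_ge0// mulrC ler_pdivlMr ?sqrtr_gt0//.
    by rewrite /fnorm mulrC -sqrtrM ?(ltW d0)// ler_sqrt ?fsq_ge0.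
  have [v vP] := riesz hq cq (fun a x z => psd_linl hs a x z y) bq.
  exists (T v); rewrite TT; apply: (form_ext hs ds) => z.
  by rewrite -QE (psd_herm hq) -vP -(psd_herm hs).
Qed.

End SquareRoot.

(** * Invariant means, extended to complex functions *)

Section MeanOfBounded.
Variables (R : realType) (G : groupType).
Local Notation C := R[i].

Lemma bounded_funP (T : Type) (f : T -> R) : bounded_fun f <-> bounded_net f.
Proof.
split=> [[M [_ fM]]|[M fM]].
  by exists (M + 1) => x; apply: (fM (M + 1)); rewrite ?ltrDl.
exists M; split=> [|x Mx y _]; first exact: num_real.
exact: le_trans (fM y) (ltW Mx).
Qed.

Variable m : (G -> R) -> R.
Hypothesis mP : left_invariant_mean m.

Lemma meanP (a : R) (f h : G -> R) : bounded_net f -> bounded_net h ->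
  m (fun x => a * f x + h x) = a * m f + m h.
Proof. by move=> bf bh; case: mP => + _ _ _; apply; apply/bounded_funP. Qed.

Lemma bounded_cst (T : Type) (c : R) : bounded_net (fun _ : T => c).
Proof. by exists `|c|. Qed.

Lemma bounded_lin (T : Type) (a : R) (f h : T -> R) :
  bounded_net f -> bounded_net h -> bounded_net (fun x => a * f x + h x).
Proof.
move=> [M fM] [N hN]; exists (`|a| * M + N) => x.
by rewrite (le_trans (ler_normD _ _))// lerD// normrM ler_wpM2l.
Qed.

Lemma mean0 : m (fun=> 0) = 0.
Proof.
have := meanP 1 (bounded_cst G 0) (bounded_cst G 0).
under eq_fun do rewrite mul1r addr0.
by rewrite mul1r => /eqP; rewrite -subr_eq subrr eq_sym => /eqP.
Qed.

Lemma meanZ a f : bounded_net f -> m (fun x => a * f x) = a * m f.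
Proof.
move=> bf; have := meanP a bf (bounded_cst G 0).
by under eq_fun do rewrite addr0; rewrite mean0 addr0.
Qed.

Lemma mean_cst c : m (fun=> c) = c.
Proof.
case: mP => _ _ m1 _; have := meanZ c (bounded_cst G 1).
by under eq_fun do rewrite mulr1; rewrite m1 mulr1.
Qed.

Lemma mean_le f h : bounded_net f -> bounded_net h ->
  (forall x, f x <= h x) -> m f <= m h.
Proof.
move=> bf bh fh; rewrite -subr_ge0.
have -> : m h - m f = m (fun x => - 1 * f x + h x).
  by rewrite meanP// mulN1r addrC.
case: mP => _ m_ge0 _ _; apply: m_ge0.
  by apply/bounded_funP; exact: bounded_lin.
by move=> x; rewrite mulN1r addrC subr_ge0.
Qed.

Lemma mean_inv g f : bounded_net f -> m (fun x => f (g^-1 * x)%g) = m f.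
Proof. by move=> bf; case: mP => _ _ _; apply; apply/bounded_funP. Qed.

Lemma mean_bound f (M : R) : (forall x, `|f x| <= M) -> `|m f| <= M.
Proof.
move=> fM; have bf : bounded_net f by exists M.
have h1 : m (fun=> - M) <= m f.
  apply: mean_le => //; first exact: bounded_cst.
  by move=> x; have := fM x; rewrite ler_norml => /andP[].
have h2 : m f <= m (fun=> M).
  apply: mean_le => //; first exact: bounded_cst.
  by move=> x; have := fM x; rewrite ler_norml => /andP[].
by rewrite ler_norml; rewrite !mean_cst in h1 h2; rewrite h1 h2.
Qed.

Definition cmean (f : G -> C) : C :=
  Complex (m (fun x => complex.Re (f x))) (m (fun x => complex.Im (f x))).

Lemma cmeanP (a : C) (f h : G -> C) : cbounded f -> cbounded h ->
  cmean (fun x => a * f x + h x) = a * cmean f + cmean h.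
Proof.
move=> bf bh; have bfR := cbounded_Re bf; have bfI := cbounded_Im bf.
have bhR := cbounded_Re bh; have bhI := cbounded_Im bh.
case: a => a b; apply: complex_ext; rewrite ?ReD ?ImD/=.
  rewrite -addrA -mulNr -!meanP//; last exact: bounded_lin.
  by congr m; apply/funext => x; rewrite ReD; case: (f x) => c d /=; ring.
rewrite -addrA -!meanP//; last exact: bounded_lin.
by congr m; apply/funext => x; rewrite ImD; case: (f x) => c d /=; ring.
Qed.

Lemma cmean_conj (f : G -> C) : cbounded f ->
  cmean (fun x => (f x)^*%C) = ((cmean f)^*)%C.
Proof.
move=> bf; apply: complex_ext => /=.
  by congr m; apply/funext => x; case: (f x).
rewrite -[RHS]mulN1r -meanZ; last exact: cbounded_Im.
by congr m; apply/funext => x; case: (f x) => a b /=; rewrite mulN1r.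
Qed.

Lemma cmean_inv g (f : G -> C) : cbounded f ->
  cmean (fun x => f (g^-1 * x)%g) = cmean f.
Proof.
move=> bf; apply: complex_ext => /=.
  by rewrite (@mean_inv g (fun x => complex.Re (f x)))//; exact: cbounded_Re.
by rewrite (@mean_inv g (fun x => complex.Im (f x)))//; exact: cbounded_Im.
Qed.

End MeanOfBounded.

(** * The theorem of Day and Dixmier *)

Section Dixmier.
Variables (R : realType) (G : groupType).
Local Notation C := R[i].

(** The square root [T] of [q / K] turns [q / K] into [inner]; conjugating the representation by [T]
    therefore turns invariance of [q] into preservation of [inner]. The lower bound on [q] makes [T]
    boundedly invertible. *)
Lemma unitarizable_of_form (H : hilbertType R) (pi : G -> {linear H -> H})
    (q : H -> H -> C) (d K : R) :
  representation pi -> psd_form q -> 0 < d -> 0 < K ->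
  (forall x, d * fsq inner x <= fsq q x) ->
  (forall x, fsq q x <= K * fsq inner x) ->
  (forall t x y, q (pi t x) (pi t y) = q x y) ->
  unitarizable_representation pi.
Proof.
move=> rpi hq d0 K0 dq qK piq.
have hs := @inner_psd R H; have ds := @inner_definite R H.
have hq' : psd_form (fun x y => (K^-1%:C)%C * q x y).
  split=> [a x y z|x y|x].
  - by rewrite (psd_linl hq); ring.
  - by rewrite (psd_herm hq) [RHS]rmorphM/= oppr0.
  - by rewrite ReM_real mulr_ge0 ?invr_ge0 ?(ltW K0)//; exact: psd_ge0 hq _.
have [T [lT TE Tsur]] : exists T : H -> H, [/\ linear T,
    forall x y, inner (T x) (T y) = (K^-1%:C)%C * q x y & forall y, exists x, T x = y].
  apply: (sqrt_operator hs hq' ds (@inner_complete R H) (d := K^-1 * d)).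
  - by rewrite mulr_gt0 ?invr_gt0.
  - by move=> x; rewrite {2}/fsq ReM_real -mulrA ler_pM2l ?invr_gt0.
  - move=> x; rewrite {1}/fsq ReM_real mulrC ler_pdivrMr// mulrC.
    exact: qK.
have TB x y : T (x - y) = T x - T y.
  by rewrite -[x - y]addrC -scaleN1r lT scaleN1r addrC.
have Tnorm x : (d / K) * fsq inner x <= fsq inner (T x) <= fsq inner x.
  rewrite {2 3}/fsq TE ReM_real [d / K]mulrC -mulrA ler_pM2l ?invr_gt0// dq/=.
  by rewrite mulrC ler_pdivrMr// mulrC qK.
have dK : 0 < d / K by rewrite divr_gt0.
have Tinj : injective T.
  move=> x y Txy; apply/eqP; rewrite -subr_eq0; apply/eqP/ds/eqP.
  rewrite eq_le fsq_ge0// andbT -(pmulr_rle0 _ dK).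
  have /andP[+ _] := Tnorm (x - y); rewrite TB Txy subrr.
  by rewrite /fsq (form0l hs).
have /choice[S TS] := Tsur.
have ST x : S (T x) = x by apply: Tinj; rewrite TS.
have lS : linear S by move=> a x y; apply: Tinj; rewrite lT !TS.
have nle (c : R) (x y : H) : 0 <= c -> fsq (@inner R H) x <= c * fsq inner y ->
    fnorm inner x <= Num.sqrt c * fnorm inner y.
  by move=> c0 h; rewrite /fnorm -sqrtrM// ler_sqrt// mulr_ge0// (fsq_ge0 hs).
have bT : bounded_op (linear_of lT).
  apply/bounded_opP; exists (Num.sqrt 1); first exact: sqrtr_ge0.
  by move=> x; apply: nle => //; rewrite mul1r; have /andP[] := Tnorm x.
have bS : bounded_op (linear_of lS).
  apply/bounded_opP; exists (Num.sqrt (d / K)^-1); first exact: sqrtr_ge0.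
  move=> x; apply: nle; first by rewrite invr_ge0 ltW.
  by rewrite mulrC ler_pdivlMr// mulrC; have /andP[] := Tnorm (S x); rewrite TS.
have [bpi pi1 piM] := rpi.
exists (linear_of lS), (linear_of lT); split; first by split.
have piV t : cancel (pi t) (pi t^-1%g).
  by move=> x; have := piM t^-1%g t x; rewrite mulVg pi1.
have piV' t : cancel (pi t^-1%g) (pi t).
  by move=> x; have := piM t t^-1%g x; rewrite mulgV pi1.
split.
  split=> [t|x|t u x]/=.
  - have /bounded_opP[a a0 aP] := bT; have /bounded_opP[b b0 bP] := bS.
    have /bounded_opP[c c0 cP] := bpi t.
    apply/bounded_opP; exists (a * (c * b)); first by rewrite !mulr_ge0.
    move=> x /=; apply: le_trans (aP _) _; rewrite -mulrA ler_wpM2l//.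
    by apply: le_trans (cP _) _; rewrite -mulrA ler_wpM2l//; exact: bP.
  - by rewrite pi1; exact: TS.
  - by rewrite piM/= /linear_of/= /linear_fun ST.
move=> t; split.
  exists (fun x => T (pi t^-1%g (S x))) => x /=; rewrite /linear_fun.
    by rewrite ST piV TS.
  by rewrite ST piV' TS.
move=> x y /=; rewrite /linear_fun TE piq -TE !TS//.
Qed.

Theorem Dixmier : amenable R G -> unitarizable R G.
Proof.
move=> [m mP] H pi rpi /uniformly_boundedP[M0 M00 piM0].
have hs := @inner_psd R H.
pose M := M0 + 1; have M1 : 0 < M by rewrite ltr_pwDr.
have piM t x : fnorm inner (pi t x) <= M * fnorm inner x.
  by apply: le_trans (piM0 t x) _; rewrite ler_wpM2r ?fnorm_ge0// lerDl.
have [bpi pi1 piMM] := rpi.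
(* With [t^-1] here, applying [pi u] to both vectors translates [t] on the left by [u^-1], which the
   mean ignores. *)
pose f x y t := inner (pi t^-1%g x) (pi t^-1%g y).
have bf x y : cbounded (f x y).
  exists (M * fnorm inner x * (M * fnorm inner y)) => t.
  apply: le_trans (CauchySchwarz_form hs _ _) _.
  by apply: ler_pM; rewrite ?fnorm_ge0.
pose q x y := cmean m (f x y).
have hq : psd_form q.
  split=> [a x y z|x y|x].
  - rewrite /q -(cmeanP mP)//; congr cmean; apply/funext => t.
    by rewrite /f linearP (psd_linl hs).
  - rewrite /q -(cmean_conj mP)//; congr cmean; apply/funext => t.
    by rewrite /f (psd_herm hs).
  - rewrite /q/= -(mean_cst mP 0); apply: (mean_le mP).
    + exact: bounded_cst.
    + exact: cbounded_Re.
    + by move=> t; exact: psd_ge0.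
apply: (@unitarizable_of_form H pi q ((M ^+ 2)^-1) (M ^+ 2)) => //.
- by rewrite invr_gt0 exprn_gt0.
- by rewrite exprn_gt0.
- move=> x; rewrite {2}/fsq/= -(mean_cst mP (_ * _)); apply: (mean_le mP).
  + exact: bounded_cst.
  + exact: cbounded_Re.
  (* The lower bound: [x] is the image under [pi t] of [pi t^-1 x], so its norm is at most [M] times
     that of the latter. *)
  move=> t; rewrite -/(fsq _ _) mulrC ler_pdivrMr ?exprn_gt0// mulrC.
  rewrite -!(sqr_fnorm hs) -exprMn ler_pXn2r ?nnegrE ?mulr_ge0 ?fnorm_ge0 ?(ltW M1)//.
  apply: le_trans (piM t _).
  by have := piMM t t^-1%g x; rewrite mulgV pi1 /= => <-.
- move=> x; rewrite {1}/fsq/= -(mean_cst mP (_ * _)); apply: (mean_le mP).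
  + exact: cbounded_Re.
  + exact: bounded_cst.
  move=> t; rewrite -/(fsq _ _) -!(sqr_fnorm hs) -exprMn.
  by rewrite ler_pXn2r ?nnegrE ?mulr_ge0 ?fnorm_ge0 ?(ltW M1).
- move=> t x y; rewrite /q -(cmean_inv mP t (bf x y)); congr cmean.
  apply/funext => u; rewrite /f invgM invgK !piMM//.
Qed.

End Dixmier.

(** * Amenability of wreath products *)

(** An ultrafilter refining the filter of tails. Mostly [D] consists of finite sets ordered by
    inclusion, so that whatever holds for all large windows holds in the limit. *)
Lemma directed_ultrafilter (D : Type) (le : D -> D -> Prop) (d0 : D) :
  (forall x, le x x) -> (forall x y z, le x y -> le y z -> le x z) ->
  (forall x y, exists2 z, le x z & le y z) ->
  exists U : set_system D, UltraFilter U /\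
    forall d (S : set D), (forall e, le d e -> S e) -> U S.
Proof.
move=> refl trans dir.
pose F : set_system D := [set S | exists d, forall e, le d e -> S e].
have FF : ProperFilter F.
  split=> [[d dP]|]; first by have := dP d (refl d).
  split=> [|S T [d dS] [e eT]|S T ST [d dS]].
  - by exists d0.
  - have [z dz ez] := dir d e; exists z => w zw; split.
      exact/dS/(trans _ _ _ dz).
    exact/eT/(trans _ _ _ ez).
  - by exists d => e /dS/ST.
have [U [UU FU]] := ultraFilterLemma FF.
by exists U; split=> // d S dS; apply: FU; exists d.
Qed.

Section RestrictedPowerTheory.
Variables (A : groupType) (I : choiceType).
Local Notation P := (restricted_power A I).
Implicit Types a b c : P.
Local Open Scope group_scope.

Lemma rpM a b t : rp_fun (a * b) t = rp_fun a t * rp_fun b t.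
Proof. exact: rp_mulE. Qed.

Lemma rp1 t : rp_fun (1 : P) t = 1.
Proof. exact: rp_oneE. Qed.

Lemma rpV a t : rp_fun a^-1 t = (rp_fun a t)^-1.
Proof. exact: rp_invE. Qed.

Definition rp_single (i : I) (x : A) : P := [fsfun t in [fset i]%fset => x].

Lemma rp_singleE i x t : rp_fun (rp_single i x) t = if t == i then x else 1.
Proof. by rewrite /rp_fun fsfunE in_fset1. Qed.

Lemma rp_singleM i x y : rp_single i (x * y) = rp_single i x * rp_single i y.
Proof.
by apply: rp_ext => t; rewrite rpM !rp_singleE; case: ifP => // _; rewrite mulg1.
Qed.

Lemma rp_singleV i x : rp_single i x^-1 = (rp_single i x)^-1.
Proof.
by apply: rp_ext => t; rewrite rpV !rp_singleE; case: ifP => // _; rewrite invg1.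
Qed.

Lemma rp_single_comm i x b :
  rp_fun b i = 1 -> rp_single i x * b = b * rp_single i x.
Proof.
move=> bi; apply: rp_ext => t; rewrite !rpM !rp_singleE.
by case: eqP => [->|_]; rewrite ?bi ?mulg1 ?mul1g.
Qed.

End RestrictedPowerTheory.

Section AmenableRestrictedPower.
Variables (R : realType) (A : groupType) (I : choiceType).
Local Notation P := (restricted_power A I).
Variable mA : (A -> R) -> R.
Hypothesis mAP : left_invariant_mean mA.

(** Integrates the coordinates one after the other. Finitely additive means need not commute, so the
    order of [l] is part of the definition. *)
Fixpoint iter_mean (l : seq I) (f : P -> R) : R :=
  if l is i :: l' then
    mA (fun x => iter_mean l' (fun c => f (rp_single i x * c)%g))
  else f 1%g.

Lemma iter_mean_bound l (f : P -> R) (M : R) :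
  (forall c, `|f c| <= M) -> `|iter_mean l f| <= M.
Proof.
elim: l f => [|i l IH] f fM /=; first exact: fM.
by apply: (mean_bound mAP) => x; apply: IH => c; exact: fM.
Qed.

Lemma iter_mean_bounded l (f : A -> P -> R) (M : R) :
  (forall x c, `|f x c| <= M) -> bounded_net (fun x => iter_mean l (f x)).
Proof. by move=> fM; exists M => x; exact: iter_mean_bound. Qed.

Lemma iter_meanP l a (f h : P -> R) : bounded_net f -> bounded_net h ->
  iter_mean l (fun c => a * f c + h c) = a * iter_mean l f + iter_mean l h.
Proof.
elim: l f h => [|i l IH] f h [M fM] [N hN] //=.
rewrite -(meanP mAP); first congr mA; first (apply/funext => x).
- apply: (IH (fun c => f (rp_single i x * c)%g) (fun c => h (rp_single i x * c)%g)).
    by exists M.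
  by exists N.
- by apply: (@iter_mean_bounded _ _ M).
- by apply: (@iter_mean_bounded _ _ N).
Qed.

Lemma iter_mean_ge0 l (f : P -> R) : bounded_net f -> (forall c, 0 <= f c) ->
  0 <= iter_mean l f.
Proof.
elim: l f => [|i l IH] f [M fM] f0 /=; first exact: f0.
case: (mAP) => _ + _ _; apply.
  by apply/bounded_funP; exact: (@iter_mean_bounded _ _ M).
by move=> x; apply: IH => //; exists M.
Qed.

Lemma iter_mean1 l : iter_mean l (fun=> 1) = 1.
Proof.
elim: l => //= i l IH; rewrite -[RHS](mean_cst mAP 1); congr mA.
by apply/funext => x; rewrite IH.
Qed.

(** Split [b] into its value at [i] and a part trivial at [i]. The two commute with what they must
    pass; invariance of [mA] removes the first and induction the second. *)
Lemma iter_mean_inv l (b : P) (f : P -> R) : uniq l -> bounded_net f ->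
  (forall t, t \notin l -> rp_fun b t = 1%g) ->
  iter_mean l (fun c => f (b^-1 * c)%g) = iter_mean l f.
Proof.
elim: l b f => [|i l IH] b f /=.
  move=> _ _ bl; have -> : b = 1%g by apply: rp_ext => t; rewrite bl// rp1.
  by rewrite invg1 mul1g.
move=> /andP[il ul] [M fM] bl.
pose b' := ((rp_single i (rp_fun b i))^-1 * b)%g.
have b'i : rp_fun b' i = 1%g by rewrite rpM rpV rp_singleE eqxx mulVg.
have b'l t : t \notin l -> rp_fun b' t = 1%g.
  move=> tl; have [->//|ti] := eqVneq t i.
  rewrite rpM rpV rp_singleE (negbTE ti) invg1 mul1g bl// inE negb_or ti//.
have bE : b = (rp_single i (rp_fun b i) * b')%g by rewrite mulVKg.
pose phi x := iter_mean l (fun c => f (rp_single i x * c)%g).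
have bphi : bounded_net phi by apply: (@iter_mean_bounded _ _ M).
transitivity (mA (fun x => phi ((rp_fun b i)^-1 * x)%g)).
  congr mA; apply/funext => x; rewrite /phi.
  rewrite -(IH b' (fun c => f (rp_single i ((rp_fun b i)^-1 * x) * c)%g))//; last by exists M.
  congr iter_mean; apply/funext => c; congr f.
  rewrite {1}bE invgM rp_singleM rp_singleV !mulgA; congr (_ * c)%g.
  have b'Vi : rp_fun (b'^-1)%g i = 1%g by rewrite rpV b'i invg1.
  rewrite -mulgA -rp_singleV -rp_singleM -rp_single_comm//.
by rewrite (mean_inv mAP).
Qed.

Lemma amenable_restricted_power : amenable R P.
Proof.
have [U [UU Usup]] := @directed_ultrafilter {fset I}
  (fun X Y => X `<=` Y)%fset fset0 (fun X => fsubset_refl X)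
  (fun X Y Z XY YZ => fsubset_trans XY YZ)
  (fun X Y => ex_intro2 _ _ (X `|` Y)%fset (fsubsetUl X Y) (fsubsetUr X Y)).
pose N (f : P -> R) (W : {fset I}) := iter_mean (enum_fset W) f.
have bN f : bounded_net f -> bounded_net (N f).
  by move=> [M fM]; exists M => W; exact: iter_mean_bound.
exists (fun f => ulim U (N f)); split.
- move=> a f h /bounded_funP bf /bounded_funP bh.
  rewrite -ulimZ; last exact: bN.
  rewrite -ulimD; last exact: bN.
    by congr ulim; apply/funext => W; rewrite /N iter_meanP.
  have [M fM] := bN _ bf; exists (`|a| * M) => W.
  by rewrite normrM ler_wpM2l.
- move=> f /bounded_funP bf f0; rewrite -(ulim_cst UU 0); apply: ulim_le.
  + exact: bounded_cst.
  + exact: bN.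
  + by apply: filterE => W; exact: iter_mean_ge0.
- by rewrite -[RHS](ulim_cst UU 1); congr ulim; apply/funext => W; exact: iter_mean1.
- move=> b f /bounded_funP bf; apply: ulim_near; first exact: bN.
  (* Once the window contains the support of [b], the iterated mean over it is already invariant
     under [b]. *)
  apply: (Usup (finsupp b)) => W bW; apply: iter_mean_inv => //.
  move=> t tW; rewrite /rp_fun fsfun_dflt//; apply: contra tW.
  by move=> /(fsubsetP bW).
Qed.

End AmenableRestrictedPower.

Section AmenableWreath.
Variables (R : realType) (A G : groupType).
Local Notation P := (restricted_power A G).

Lemma amenable_wreath : amenable R A -> amenable R G -> amenable R (wreath A G).
Proof.
move=> [mA mAP] [mG mGP]; have [mP mPP] := amenable_restricted_power G mAP.
(* The pair [(shift g a, g)] is the product of [(1, g)] and [(a, 1)]. Left translation by [(b, h)]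
   then translates [g] by [h^-1] and [a] by a shift of [b^-1], and each mean absorbs one of them. *)
pose N (f : wreath A G -> R) g := mP (fun a => f (shift g a, g)).
have bf' f g : bounded_net f -> bounded_net (fun a => f (shift g a, g)).
  by move=> [M fM]; exists M.
have bN f : bounded_net f -> bounded_net (N f).
  by move=> [M fM]; exists M => g; exact: (mean_bound mPP).
exists (fun f => mG (N f)); split.
- move=> a f h /bounded_funP bf /bounded_funP bh.
  rewrite -(meanP mGP); [|exact: bN..].
  by congr mG; apply/funext => g; rewrite /N (meanP mPP)//; exact: bf'.
- move=> f /bounded_funP bf f0; case: (mGP) => _ + _ _; apply.
    exact/bounded_funP/bN.
  move=> g; case: (mPP) => _ + _ _; apply=> //.
  exact/bounded_funP/bf'.
- rewrite -[RHS](mean_cst mGP 1); congr mG; apply/funext => g.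
  exact: mean_cst mPP 1.
- move=> [b h] f /bounded_funP bf; rewrite -(mean_inv mGP h (bN _ bf)).
  congr mG; apply/funext => g; rewrite /N.
  rewrite -[RHS](mean_inv mPP (shift g^-1 b)%g); last exact: bf'.
  congr mP; apply/funext => a; congr f.
  rewrite -[LHS]/((shift h^-1 b^-1 * shift h^-1 (shift g a), h^-1 * g)%g).
  congr (_, _); apply: rp_ext => t.
  rewrite rpM !shiftE rpM !rpV !shiftE !invgM !invgK !mulgA.
  by rewrite mulgV mul1g.
Qed.

End AmenableWreath.

Section InfiniteAbelianAmenable.
Variable R : realType.

Lemma amenable_I2 : amenable R 'I_2.
Proof.
exists (fun f => 2^-1 * \sum_(x : 'I_2) f x); split.
- move=> a f h _ _; by rewrite big_split/= -mulr_sumr mulrDr mulrCA.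
- by move=> f _ f0; rewrite mulr_ge0 ?invr_ge0// sumr_ge0.
- by rewrite sumr_const card_ord mulVf.
- move=> g f _; congr (_ * _).
  by rewrite [RHS](reindex_inj (@mulgI _ g^-1%g)).
Qed.

(** A restricted power of a finite group, so that its amenability is an instance of
    [amenable_restricted_power]. *)
Definition infinite_abelian : groupType := restricted_power 'I_2 nat.

Lemma infinite_abelian_comm (x y : infinite_abelian) : (x * y = y * x)%g.
Proof. by apply: rp_ext => t; rewrite !rpM; exact: addrC. Qed.

Lemma infinite_abelian_infinite : infinite_set [set: infinite_abelian].
Proof.
pose f n : infinite_abelian := rp_single n (1%R : 'I_2).
have fI : injective f.
  move=> m n /(congr1 (fun a => rp_fun a m)); rewrite !rp_singleE eqxx.
  by case: eqP.
move=> fin; apply: infinite_nat.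
rewrite -[setT](preimage_setT f); apply: finite_preimage fin.
by move=> x y _ _; exact: fI.
Qed.

Lemma infinite_abelian_amenable : amenable R infinite_abelian.
Proof.
have [m mP] := amenable_I2.
exact: amenable_restricted_power mP.
Qed.

End InfiniteAbelianAmenable.

(** * Bounded derivations of unitarizable groups are inner *)

Section PairForm.
Variable R : realType.
Local Notation C := R[i].
Variables (V W : lmodType C) (s : V -> V -> C) (t : W -> W -> C).
Hypotheses (hs : psd_form s) (ht : psd_form t).

Definition pair_form (x y : (V * W)%type) : C := s x.1 y.1 + t x.2 y.2.

Lemma pair_form_psd : psd_form pair_form.
Proof.
split=> [a x y z|x y|x].
- by rewrite /pair_form (psd_linl hs) (psd_linl ht); ring.
- by rewrite /pair_form rmorphD/= -(psd_herm hs) -(psd_herm ht).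
- by rewrite /pair_form ReD addr_ge0 ?(psd_ge0 hs) ?(psd_ge0 ht).
Qed.

Lemma fsq_pair x : fsq pair_form x = fsq s x.1 + fsq t x.2.
Proof. by rewrite /fsq ReD. Qed.

Lemma fnorm_pair1 x : fnorm s x.1 <= fnorm pair_form x.
Proof.
rewrite /fnorm ler_sqrt fsq_pair ?lerDl ?(fsq_ge0 ht)//.
by rewrite addr_ge0 ?(fsq_ge0 hs) ?(fsq_ge0 ht).
Qed.

Lemma fnorm_pair2 x : fnorm t x.2 <= fnorm pair_form x.
Proof.
rewrite /fnorm ler_sqrt fsq_pair ?lerDr ?(fsq_ge0 hs)//.
by rewrite addr_ge0 ?(fsq_ge0 hs) ?(fsq_ge0 ht).
Qed.

Lemma fnorm_pair_le x : fnorm pair_form x <= fnorm s x.1 + fnorm t x.2.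
Proof.
rewrite -(ler_pXn2r (n := 2)) ?nnegrE ?addr_ge0 ?fnorm_ge0//.
rewrite (sqr_fnorm pair_form_psd) fsq_pair sqrrD (sqr_fnorm hs) (sqr_fnorm ht).
rewrite lerD2r lerDl mulrn_wge0// mulr_ge0 ?fnorm_ge0//.
Qed.

Lemma pair_form_definite :
  definite_form s -> definite_form t -> definite_form pair_form.
Proof.
move=> ds dt [x y]; rewrite fsq_pair/= => /eqP.
rewrite paddr_eq0 ?(fsq_ge0 hs) ?(fsq_ge0 ht)// => /andP[/eqP/ds -> /eqP/dt ->].
by [].
Qed.

Lemma pair_form_complete :
  form_complete s -> form_complete t -> form_complete pair_form.
Proof.
move=> cs ct u uC.
have [|l lP] := cs (fun n => (u n).1).
  move=> e e0; have [N NP] := uC e e0; exists N => m n Nm Nn.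
  by apply: le_lt_trans (NP m n Nm Nn); exact: (fnorm_pair1 (u m - u n)).
have [|k kP] := ct (fun n => (u n).2).
  move=> e e0; have [N NP] := uC e e0; exists N => m n Nm Nn.
  by apply: le_lt_trans (NP m n Nm Nn); exact: (fnorm_pair2 (u m - u n)).
exists (l, k) => e e0; have e2 : 0 < e / 2 by rewrite divr_gt0.
have [N1 NP1] := lP _ e2; have [N2 NP2] := kP _ e2; exists (maxn N1 N2) => n.
rewrite geq_max => /andP[n1 n2]; apply: le_lt_trans (fnorm_pair_le _) _ => /=.
by rewrite [e]splitr ltrD ?NP1 ?NP2.
Qed.

End PairForm.

(** * The derivation defined by a form, on the completion *)

Section InnerDerivation.
Variables (R : realType) (G : groupType).
Local Notation C := R[i].
Variables (V : lmodType C) (s : V -> V -> C) (act : G -> V -> V).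
Hypothesis hs : psd_form s.
Hypothesis act_lin : forall g, linear (act g).
Hypothesis act1 : forall x, act 1%g x = x.
Hypothesis actM : forall g h x, act (g * h)%g x = act g (act h x).
Hypothesis act_iso : forall g x y, s (act g x) (act g y) = s x y.
Variable p : V -> V -> C.
Hypothesis p_linl : forall a x y z, p (a *: x + y) z = a * p x z + p y z.
Hypothesis p_linr : forall a x y z, p z (a *: x + y) = (a^*)%C * p z x + p z y.
Variable c : R.
Hypothesis c0 : 0 <= c.
Let d g x y := p (act g x) y - p x (act g^-1%g y).
Hypothesis d_le : forall g x y, cabs (d g x y) <= c * (fnorm s x * fnorm s y).

Let D := dual s.
Let dd := ddot hs.
Let hd : psd_form dd := ddot_psd hs.
Let j := dual_of hs.

Let act_norm g x : fnorm s (act g x) = fnorm s x.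
Proof. by rewrite /fnorm /fsq act_iso. Qed.

Let actKV g x : act g (act g^-1%g x) = x.
Proof. by rewrite -actM mulgV act1. Qed.

Fact dual_act_subproof g (phi : D) : (fun x => phi (act g^-1%g x)) \in dual_pred s.
Proof.
apply/asboolP; split=> [a x y|]; first by rewrite act_lin dual_lin.
by have [M phiM] := dual_bound phi; exists M => x; rewrite -(act_norm g^-1%g x).
Qed.
Let rho g phi : D := Dual (dual_act_subproof g phi).

Fact dual_d_subproof g x : (fun v => ((d g v x)^*)%C) \in dual_pred s.
Proof.
apply/asboolP; split=> [a v w|].
  rewrite /d act_lin !p_linl -rmorphM -rmorphD; congr (_^*)%C => /=.
  by rewrite /=; ring.
by exists (c * fnorm s x) => v; rewrite cabs_conj -mulrA [fnorm s x * _]mulrC.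
Qed.
Let psi g x : D := Dual (dual_d_subproof g x).

Let psi_norm g x : fnorm dd (psi g x) <= c * fnorm s x.
Proof.
apply: dual_norm_le; first by rewrite mulr_ge0 ?fnorm_ge0.
by move=> v; rewrite /= cabs_conj -mulrA [fnorm s x * _]mulrC.
Qed.

Let psi_lin g a x y : psi g (a *: x + y) = a *: psi g x + psi g y.
Proof.
apply: dual_ext => v; rewrite dualD dualZ /= /d act_lin !p_linr.
rewrite -[a in RHS]conjcK -rmorphM -rmorphD; congr (_^*)%C => /=.
by ring.
Qed.

Fact dual_der_subproof g (phi : D) : (fun x => dd phi (psi g x)) \in dual_pred s.
Proof.
apply/asboolP; split=> [a x y|].
  by rewrite psi_lin (formDr hd) (formZr hd).
exists (fnorm dd phi * c) => x; apply: le_trans (CauchySchwarz_form hd _ _) _.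
by rewrite -mulrA ler_wpM2l ?fnorm_ge0 ?psi_norm.
Qed.
(** The extension of [d g] to a bounded operator of the completion: at [j x] its value on [y] is
    [d g x y], because pairing [j x] with [psi g y] undoes the conjugation in [psi]. *)
Let der g phi : D := Dual (dual_der_subproof g phi).

Let rho_lin g : linear (rho g).
Proof. by move=> a phi chi; apply: dual_ext. Qed.

Let der_lin g : linear (der g).
Proof. by move=> a phi chi; apply: dual_ext => x; rewrite /= (psd_linl hd). Qed.

Let rho_norm g phi : fnorm dd (rho g phi) <= fnorm dd phi.
Proof.
apply: dual_norm_le => [|x]; first exact: fnorm_ge0.
by rewrite /= -(act_norm g^-1%g x); exact: dual_le.
Qed.

Let der_norm g phi : fnorm dd (der g phi) <= c * fnorm dd phi.
Proof.
apply: dual_norm_le => [|x]; first by rewrite mulr_ge0 ?fnorm_ge0.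
rewrite /=; apply: le_trans (CauchySchwarz_form hd _ _) _.
by rewrite -mulrA mulrCA ler_wpM2l ?fnorm_ge0.
Qed.

Let rho_of g x : rho g (j x) = j (act g x).
Proof. by apply: dual_ext => y /=; rewrite -(act_iso g) actKV. Qed.

(** The defect [E] vanishes on the image of [V], is bounded, and that image is dense. *)
Let rho_adj g phi chi : dd (rho g phi) chi = dd phi (rho g^-1%g chi).
Proof.
pose E chi := dd (rho g phi) chi - dd phi (rho g^-1%g chi).
have EB x y : E (x - y) = E x - E y.
  rewrite /E (formBr hd).
  have -> : rho g^-1%g (x - y) = rho g^-1%g x - rho g^-1%g y.
    by rewrite -[x - y]addrC -scaleN1r rho_lin scaleN1r addrC.
  by rewrite (formBr hd); ring.
have Ej x : E (j x) = 0.
  by rewrite /E rho_of /dd /j !ddot_of /= subrr.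
have EM x : cabs (E x) <= (fnorm dd phi + fnorm dd phi) * fnorm dd x.
  rewrite /E mulrDl; apply: le_trans (cabsB _ _) _; apply: lerD.
    apply: le_trans (CauchySchwarz_form hd _ _) _.
    by rewrite ler_wpM2r ?fnorm_ge0.
  apply: le_trans (CauchySchwarz_form hd _ _) _.
  by rewrite ler_wpM2l ?fnorm_ge0.
apply/eqP; rewrite -subr_eq0 -/(E chi) -cabs_eq0 eq_le cabs_ge0 andbT.
apply/ler_addgt0Pr => e e0; rewrite add0r.
have k0 : 0 < fnorm dd phi + fnorm dd phi + 1.
  by rewrite ltr_pwDr// addr_ge0 ?fnorm_ge0.
have [N NP] := harmonic_lt (divr_gt0 e0 k0).
have hN : fnorm dd (chi - j (approx hs chi N)) <= N.+1%:R^-1.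
  apply: dual_norm_le; first by rewrite invr_ge0.
  by move=> x; exact: approxP.
have -> : E chi = E (chi - j (approx hs chi N)) by rewrite EB Ej subr0.
apply: le_trans (EM _) _.
apply: (@le_trans _ _ ((fnorm dd phi + fnorm dd phi + 1) * N.+1%:R^-1)).
  apply: ler_pM => //; rewrite ?addr_ge0 ?fnorm_ge0//.
  by rewrite lerDl.
by have := ltW (NP N (leqnn N)); rewrite ler_pdivlMr// mulrC.
Qed.

Let rho1 phi : rho 1%g phi = phi.
Proof. by apply: dual_ext => x /=; rewrite invg1 act1. Qed.

Let rhoM g h phi : rho (g * h)%g phi = rho g (rho h phi).
Proof. by apply: dual_ext => x /=; rewrite invgM actM. Qed.

Let der1 phi : der 1%g phi = 0.
Proof.
apply: dual_ext => x /=.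
have -> : psi 1%g x = 0.
  by apply: dual_ext => v /=; rewrite /d invg1 !act1 subrr conjc0.
exact: (form0r hd).
Qed.

(** The Leibniz rule. For the forms [d] it is a telescoping sum: insert [p (h v) (g^-1 x)] between
    [p (g h v) x] and [p v (h^-1 g^-1 x)]. *)
Let derM g h phi : der (g * h)%g phi = rho g (der h phi) + der g (rho h phi).
Proof.
apply: dual_ext => x; rewrite dualD /= rho_adj -(formDr hd); congr (dd phi _).
apply: dual_ext => v; rewrite dualD /= invgK -rmorphD; congr (_^*)%C => /=.
by rewrite /d invgM !actM; ring.
Qed.

Let H2 := hilbertOf (pair_form_psd hd hd)
  (pair_form_definite hd hd (@ddot_definite _ _ _ hs) (@ddot_definite _ _ _ hs))
  (pair_form_complete hd hd (@ddot_complete _ _ _ hs) (@ddot_complete _ _ _ hs)).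

Let tri g (z : H2) : H2 := (rho g z.1 + der g z.2, rho g z.2).

Let tri_lin g : linear (tri g).
Proof.
move=> a x y; rewrite /tri; congr (_, _); last exact: rho_lin.
by rewrite /= rho_lin der_lin scalerDr addrACA.
Qed.

(* The derivation [der] makes the block triangular operators [tri g]
   a uniformly bounded representation.  An equivalent invariant inner product
   provides an invariant complement of the first summand; it is the graph of
   an operator, which gives the form [b]. *)
Lemma inner_derivation : unitarizable R G ->
  exists b : V -> V -> C, exists K : R, [/\ 0 <= K,
    forall a x y z, b (a *: x + y) z = a * b x z + b y z,
    forall a x y z, b z (a *: x + y) = (a^*)%C * b z x + b z y,
    forall x y, cabs (b x y) <= K * (fnorm s x * fnorm s y) &
    forall g x y, p (act g x) y - p x (act g^-1%g y) =
                  b (act g x) y - b x (act g^-1%g y)].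
Proof.
move=> /(_ H2 (fun g => linear_of (tri_lin g))).
set Pi := (X in representation X).
have fE (z : H2) : fnorm inner z = fnorm (pair_form dd dd) z by [].
have tri_norm g z : fnorm inner (tri g z) <= (2 + c) * fnorm inner z.
  rewrite !fE; apply: le_trans (fnorm_pair_le hd hd _) _ => /=.
  have h1 := le_trans (rho_norm g z.1) (fnorm_pair1 hd hd z).
  have h2 := le_trans (rho_norm g z.2) (fnorm_pair2 hd hd z).
  have h3 := le_trans (der_norm g z.2) (ler_wpM2l c0 (fnorm_pair2 hd hd z)).
  have h4 := fnormD hd (rho g z.1) (der g z.2).
  move: h1 h2 h3 h4; rewrite -/dd mulrDl => h1 h2 h3 h4.
  by apply: le_trans (lerD (le_trans h4 (lerD h1 h3)) h2) _; lra.
have c2 : 0 <= 2 + c by rewrite addr_ge0.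
have bPi g : bounded_op (Pi g).
  by apply/bounded_opP; exists (2 + c) => // z; exact: tri_norm.
have rho_add g x y : rho g (x + y) = rho g x + rho g y.
  by have := rho_lin g 1 x y; rewrite !scale1r.
have rPi : representation Pi.
  split=> // [z|g h z]; rewrite /Pi/= /linear_fun /tri/=.
    by rewrite !rho1 der1 addr0; case: z.
  by congr (_, _); rewrite ?rhoM// derM rho_add addrA.
have uPi : uniformly_bounded Pi.
  by apply/uniformly_boundedP; exists (2 + c) => // g z; exact: tri_norm.
move=> /(_ rPi uPi)[S [T [[bS bT ST TS] [_ uT]]]].
have /bounded_opP[MS MS0 SM] := bS; have /bounded_opP[MT MT0 TM] := bT.
have hi := @inner_psd R H2.
pose q (z w : H2) : C := inner (T z) (T w).
have hq : psd_form q.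
  split=> [a x y z|x y|x]; rewrite /q.
  - by rewrite linearP (psd_linl hi).
  - by rewrite (psd_herm hi).
  - exact: psd_ge0 hi _.
have qPi g z w : q (Pi g z) (Pi g w) = q z w.
  have [_ h] := uT g; have := h (T z) (T w).
  by rewrite /q /= !TS.
have q_le z : fnorm q z <= MT * fnorm inner z by exact: TM.
have q_ge z : fnorm inner z <= MS * fnorm q z.
  by rewrite -{1}(TS z); exact: SM.
pose e1 (a : D) : H2 := (a, 0); pose e2 (b : D) : H2 := (0, b).
have e1_lin : linear e1 by move=> a x y; rewrite /e1; congr (_, _); rewrite /= scaler0 addr0.
have e12 (z : H2) : z = e1 z.1 + e2 z.2.
  by case: z => a b; rewrite /e1 /e2; congr (_, _); rewrite /= ?addr0 ?add0r.
have e1_norm a : fnorm inner (e1 a) = fnorm dd a.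
  by rewrite fE /fnorm fsq_pair/= /fsq (form0l hd) addr0.
have e2_norm a : fnorm inner (e2 a) = fnorm dd a.
  by rewrite fE /fnorm fsq_pair/= /fsq (form0l hd) add0r.
pose q1 a b := q (e1 a) (e1 b).
have hq1 : psd_form q1.
  split=> [a x y z|x y|x]; rewrite /q1.
  - by rewrite e1_lin (psd_linl hq).
  - exact: psd_herm hq _ _.
  - exact: psd_ge0 hq _.
have q1_ge a : fnorm dd a <= MS * fnorm q1 a by rewrite -e1_norm; exact: q_ge.
have q1_le a : fnorm q1 a <= MT * fnorm dd a by rewrite -e1_norm; exact: q_le.
have dq1 : definite_form q1.
  move=> a a0; apply: (@ddot_definite _ _ _ hs); apply/eqP.
  rewrite -(sqr_fnorm hd) sqrf_eq0 eq_le fnorm_ge0 andbT.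
  by apply: le_trans (q1_ge a) _; rewrite /fnorm a0 sqrtr0 mulr0.
have cq1 : form_complete q1.
  move=> u uC; have uD : form_cauchy dd u.
    move=> e e0; have k0 : 0 < MS + 1 by rewrite ltr_pwDr.
    have [N NP] := uC _ (divr_gt0 e0 k0); exists N => m n Nm Nn.
    apply: le_lt_trans (q1_ge _) _; have := NP m n Nm Nn.
    rewrite ltr_pdivlMr//; apply: le_lt_trans; rewrite mulrC.
    by rewrite ler_wpM2l ?fnorm_ge0// lerDl.
  have [l lP] := ddot_complete uD; exists l => e e0.
  have k0 : 0 < MT + 1 by rewrite ltr_pwDr.
  have [N NP] := lP _ (divr_gt0 e0 k0); exists N => n Nn.
  apply: le_lt_trans (q1_le _) _; have := NP n Nn.
  rewrite ltr_pdivlMr//; apply: le_lt_trans; rewrite mulrC.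
  by rewrite ler_wpM2l ?fnorm_ge0// lerDl.
(* The Riesz representation in the first summand corrects [e2 b] to a vector that is [q]-orthogonal
   to this summand. *)
have /choice[B BP] : forall b : D, exists v : D, forall a, q (e1 a) (e1 v + e2 b) = 0.
  move=> b; have [|a|v vP] := @riesz _ _ q1 hq1 (fun a => q (e1 a) (e2 b)) (fnorm q (e2 b)) cq1.
  - by move=> a x y; rewrite e1_lin (psd_linl hq).
  - by rewrite mulrC; exact: CauchySchwarz_form hq _ _.
  exists (- v) => a.
  have -> : e1 (- v) = - e1 v by rewrite -[RHS]scaleN1r -[RHS]addr0 -[0 in RHS]/(e1 0) -e1_lin addr0 scaleN1r.
  by rewrite (formDr hq) (formNr hq) vP /q1 addNr.
have lin0 (f : D -> D) : linear f -> f 0 = 0.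
  by move=> lf; have := lf (-1) 0 0; rewrite scaler0 add0r scaleN1r addNr.
have Buniq (z : H2) : (forall a, q (e1 a) z = 0) -> z.1 = B z.2.
  move=> zP; apply/eqP; rewrite -subr_eq0; apply/eqP/dq1; rewrite /fsq /q1.
  have e1B x y : e1 (x - y) = e1 x - e1 y.
    by rewrite -[x - y]addrC -scaleN1r e1_lin scaleN1r addrC.
  have {2}-> : e1 (z.1 - B z.2) = z - (e1 (B z.2) + e2 z.2).
    have zE : z - e2 z.2 = e1 z.1 by apply/eqP; rewrite subr_eq -e12.
    by rewrite e1B opprD [- _ - _]addrC addrA zE.
  by rewrite (formBr hq) zP BP subrr.
have BPl x y : B (x + y) = B x + B y.
  have := Buniq (e1 (B x) + e2 x + (e1 (B y) + e2 y)).
  rewrite /= !addr0 !add0r => <-// a.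
  by rewrite (formDr hq) !BP addr0.
have BZ a x : B (a *: x) = a *: B x.
  have := Buniq (a *: (e1 (B x) + e2 x)).
  rewrite /= !addr0 !add0r => <-// a'.
  by rewrite (formZr hq) BP mulr0.
(* Orthogonality makes [q1 (B b) (B b)] the negative of [q (e1 (B b)) (e2 b)], and the
   Cauchy-Schwarz inequality cancels one factor. *)
have Bnorm b : fnorm dd (B b) <= MS * MT * fnorm dd b.
  apply: le_trans (q1_ge _) _; rewrite -mulrA ler_wpM2l//.
  rewrite -e2_norm; apply: le_trans (q_le _).
  have := CauchySchwarz_form hq (e1 (B b)) (e2 b).
  have -> : q (e1 (B b)) (e2 b) = - q1 (B b) (B b).
    have := BP b (B b); rewrite (formDr hq) => /eqP.
    by rewrite addr_eq0 -/(q1 _ _) => /eqP ->; rewrite opprK.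
  rewrite cabsN (fsqE hq1) cabs_real ger0_norm ?(fsq_ge0 hq1)// -(sqr_fnorm hq1).
  rewrite -/(fnorm q1 _) expr2.
  have [->|n0] := eqVneq (fnorm q1 (B b)) 0; first by rewrite fnorm_ge0.
  by rewrite ler_pM2l// lt_def n0 fnorm_ge0.
(* [Pi g] preserves [q] and the first summand, hence also its [q]-orthogonal complement, which is
   the graph of [B] by [Buniq]. Comparing components of the image of a point of the graph gives the
   formula. *)
have Bder g b : B (rho g b) = rho g (B b) + der g b.
  have zP a : q (e1 a) (Pi g (e1 (B b) + e2 b)) = 0.
    have -> : e1 a = Pi g (Pi g^-1%g (e1 a)).
      by have [_ h1 hM] := rPi; rewrite -[RHS](hM g g^-1%g) mulgV h1.
    rewrite qPi; have -> : Pi g^-1%g (e1 a) = e1 (rho g^-1%g a).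
      rewrite /Pi/= /linear_fun /tri /e1/=; congr (_, _).
        by rewrite (lin0 _ (der_lin _)) addr0.
      exact: lin0 (rho_lin _).
    exact: BP.
  by have := Buniq _ zP; rewrite /Pi/= /linear_fun /tri/= !addr0 !add0r => ->.
have jlin : linear j.
  by move=> a x y; apply: dual_ext => z; rewrite dualD dualZ /= (psd_linl hs).
exists (fun x y => B (j x) y), (MS * MT); split.
- exact: mulr_ge0.
- by move=> a x y z; rewrite jlin BPl BZ dualD dualZ.
- by move=> a x y z; rewrite dual_lin.
- move=> x y; apply: le_trans (dual_le _ _ _) _; rewrite mulrA ler_wpM2r ?fnorm_ge0//.
  by apply: le_trans (Bnorm _) _; rewrite (fnorm_dual_of hs).
(* By [Bder] the commutator of [B] with [rho g] is [der g], and the form of the latter is [d g]. *)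
- move=> g x y; rewrite -[LHS]/(d g x y).
  have -> : d g x y = der g (j x) y.
    by rewrite /= /dd ddot_dual_of /= conjcK.
  by rewrite -rho_of Bder dualD /= addrAC subrr add0r.
Qed.

End InnerDerivation.

(** * Kesten's theorem *)

Lemma norm_ulim_le (R : realType) (I : Type) (F : set_system I) (f : I -> R) (M : R) :
  UltraFilter F -> bounded_net f -> (\forall i \near F, `|f i| <= M) ->
  `|ulim F f| <= M.
Proof.
move=> UF bf fM; rewrite ler_norml; apply/andP; split.
  rewrite -(ulim_cst UF (- M)); apply: ulim_le => //; first exact: bounded_cst.
  by apply: filterS fM => i; rewrite ler_norml => /andP[].
rewrite -[leRHS](ulim_cst UF M); apply: ulim_le => //; first exact: bounded_cst.
by apply: filterS fM => i; rewrite ler_norml => /andP[].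
Qed.

(** * Sums of finitely supported functions on a group *)

Section FiniteSupportSums.
Variables (R : realType) (G : groupType).
Implicit Types (f h : G -> R) (W : {fset G}).

Definition supp_in W f := forall x, x \notin W -> f x = 0.
Definition fin_supp f := exists W, supp_in W f.

(** The summation set is picked by choice; by [gsumE] every finite set containing the support gives
    the same value. Without finite support the sum is empty. *)
Definition gsum f : R :=
  \sum_(x <- enum_fset (xget fset0 [set W | supp_in W f])) f x.

Lemma gsumE W f : supp_in W f -> gsum f = \sum_(x <- enum_fset W) f x.
Proof.
move=> fW; rewrite /gsum; set X := xget _ _.
have fX : supp_in X f by apply: (@xgetPex _ _ [set W | supp_in W f]); exists W.
rewrite (@big_fset_incl _ _ _ _ X (X `|` W)%fset) ?fsubsetUl//; last first.
  by move=> x _; exact: fX.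
by rewrite (@big_fset_incl _ _ _ _ W (X `|` W)%fset) ?fsubsetUr// => x _; exact: fW.
Qed.

Lemma supp_inS W W' f : (W `<=` W')%fset -> supp_in W f -> supp_in W' f.
Proof. by move=> /fsubsetP WW' fW x xW'; apply: fW; apply: contra xW' => /WW'. Qed.

Lemma fin_supp2 f h : fin_supp f -> fin_supp h ->
  exists W, supp_in W f /\ supp_in W h.
Proof.
move=> [W fW] [W' hW']; exists (W `|` W')%fset.
by split; [apply: supp_inS fW; exact: fsubsetUl|apply: supp_inS hW'; exact: fsubsetUr].
Qed.

Lemma fin_supp_lin a f h : fin_supp f -> fin_supp h ->
  fin_supp (fun x => a * f x + h x).
Proof.
move=> ff fh; have [W [fW hW]] := fin_supp2 ff fh.
by exists W => x xW; rewrite fW// hW// mulr0 addr0.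
Qed.

Lemma fin_suppMr f h : fin_supp f -> fin_supp (fun x => h x * f x).
Proof. by move=> [W fW]; exists W => x xW; rewrite fW// mulr0. Qed.

Lemma fin_suppX f n : fin_supp f -> fin_supp (fun x => f x ^+ n.+1).
Proof. by move=> [W fW]; exists W => x xW; rewrite fW// expr0n. Qed.

Lemma fin_supp_sum (T : finType) (F : T -> G -> R) :
  (forall t, fin_supp (F t)) -> fin_supp (fun x => \sum_t F t x).
Proof.
move=> /choice[W FW]; exists (\bigcup_(t <- enum T) W t)%fset => x xW.
rewrite big1// => t _; apply: FW; apply: contra xW => xt.
by apply/bigfcupP; exists t; rewrite // mem_enum.
Qed.

Lemma gsum_lin a f h : fin_supp f -> fin_supp h ->
  gsum (fun x => a * f x + h x) = a * gsum f + gsum h.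
Proof.
move=> ff fh; have [W [fW hW]] := fin_supp2 ff fh.
rewrite (gsumE fW) (gsumE hW) (@gsumE W).
  by rewrite big_split/= mulr_sumr.
by move=> x xW; rewrite fW// hW// mulr0 addr0.
Qed.

Lemma gsum0 : gsum (fun=> 0) = 0.
Proof. by rewrite (@gsumE fset0)// big_seq_fset0. Qed.

Lemma gsumZ a f : fin_supp f -> gsum (fun x => a * f x) = a * gsum f.
Proof.
move=> ff; have f0 : fin_supp (fun=> 0 : R) by exists fset0.
have := gsum_lin a ff f0; rewrite gsum0 addr0.
by under eq_fun do rewrite addr0.
Qed.

Lemma gsum_sum (T : finType) (F : T -> G -> R) : (forall t, fin_supp (F t)) ->
  gsum (fun x => \sum_t F t x) = \sum_t gsum (F t).
Proof.
move=> Ff; have [W FW] := choice Ff.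
pose X := (\bigcup_(t <- enum T) W t)%fset.
have FX t : supp_in X (F t).
  move=> x xX; apply: FW; apply: contra xX => xt.
  by apply/bigfcupP; exists t; rewrite // mem_enum.
rewrite (@gsumE X).
  by rewrite exchange_big/=; apply: eq_bigr => t _; rewrite (gsumE (FX t)).
by move=> x xX; rewrite big1// => t _; exact: FX.
Qed.

Lemma gsum_le f h : fin_supp f -> fin_supp h -> (forall x, f x <= h x) ->
  gsum f <= gsum h.
Proof.
move=> ff fh fleh; have [W [fW hW]] := fin_supp2 ff fh.
by rewrite (gsumE fW) (gsumE hW); apply: ler_sum.
Qed.

Lemma gsum_ge0 f : fin_supp f -> (forall x, 0 <= f x) -> 0 <= gsum f.
Proof. by move=> [W fW] f0; rewrite (gsumE fW) sumr_ge0. Qed.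

Lemma gsum_abs f : fin_supp f -> `|gsum f| <= gsum (fun x => `|f x|).
Proof.
move=> [W fW]; rewrite (gsumE fW) (@gsumE W); first exact: ler_norm_sum.
by move=> x xW; rewrite fW// normr0.
Qed.

Lemma fin_supp_shift g f : fin_supp f -> fin_supp (fun x => f (g * x)%g).
Proof.
move=> [W fW]; exists [fset (g^-1 * x)%g | x in W]%fset => x xW; apply: fW.
apply: contra xW => gx; apply/imfsetP; exists (g * x)%g => //=.
by rewrite mulKg.
Qed.

Lemma gsum_shift g f : fin_supp f -> gsum (fun x => f (g * x)%g) = gsum f.
Proof.
move=> [W fW]; rewrite (gsumE fW) (@gsumE [fset (g^-1 * x)%g | x in W]%fset).
  rewrite big_imfset/=; last by move=> x y _ _; exact: mulgI.
  by apply: eq_bigr => x _; rewrite mulVKg.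
move=> x xW; apply: fW.
apply: contra xW => gx; apply/imfsetP; exists (g * x)%g => //=.
by rewrite mulKg.
Qed.

Lemma gsum_ge_term f x : fin_supp f -> (forall y, 0 <= f y) -> f x <= gsum f.
Proof.
move=> [W fW] f0; have fxW : supp_in (x |` W)%fset f.
  by apply: supp_inS fW; exact: fsubsetUr.
rewrite (gsumE fxW) (big_fsetD1 x) ?fset1U1//= lerDl.
by apply: sumr_ge0 => i _.
Qed.

End FiniteSupportSums.

(** * From non-amenability to exponentially small return probabilities *)

Section Kesten.
Variables (R : realType) (G : groupType).
Implicit Types (xi : G -> R) (W : {fset G}).

Definition nsq xi := gsum (fun x => xi x ^+ 2).

Lemma nsq_ge0 xi : fin_supp xi -> 0 <= nsq xi.
Proof. by move=> fx; apply: gsum_ge0 => [|x]; [exact: fin_suppX|exact: sqr_ge0]. Qed.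

Definition variation (S : seq G) xi :=
  \sum_(s <- S) gsum (fun x => (xi (s * x)%g - xi x) ^+ 2).

Lemma fin_supp_diff g xi : fin_supp xi -> fin_supp (fun x => xi (g * x)%g - xi x).
Proof.
move=> fx; have := @fin_supp_lin _ _ (-1) xi _ fx (fin_supp_shift g fx).
by under eq_fun do rewrite mulN1r addrC.
Qed.

Lemma variation_term (S : seq G) s xi : fin_supp xi -> s \in S ->
  gsum (fun x => (xi (s * x)%g - xi x) ^+ 2) <= variation S xi.
Proof.
move=> fx sS; rewrite /variation (big_rem s)//= lerDl.
apply: sumr_ge0 => t _; apply: gsum_ge0 => [|x]; last exact: sqr_ge0.
exact/fin_suppX/fin_supp_diff.
Qed.

(** With [u] the shifted [xi] and [e = 1 / (n + 1)], the difference of squares is the product of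
    [u - xi] and [u + xi], hence at most [(u - xi)^2 / e + e (u^2 + xi^2)]. The first term sums to
    at most [e] times [nsq xi] and the second to twice that, whence the 3. *)
Lemma square_shift_le xi (f : G -> R) s (M N : R) (n : nat) :
  fin_supp xi -> (forall x, `|f x| <= M) ->
  gsum (fun x => (xi (s * x)%g - xi x) ^+ 2) <= (n.+1%:R^-1) ^+ 2 * nsq xi ->
  `|gsum (fun x => f (s^-1 * x)%g * xi x ^+ 2) - gsum (fun x => f x * xi x ^+ 2)|
    <= M * (3 * n.+1%:R^-1 * nsq xi).
Proof.
move=> fx fM hs; set e := n.+1%:R^-1.
have M0 : 0 <= M by apply: le_trans (fM 1%g).
have e0 : 0 < e by rewrite invr_gt0.
have fx2 : fin_supp (fun x => xi x ^+ 2) by exact: fin_suppX.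
pose u x := xi (s * x)%g; have fu : fin_supp u by exact: fin_supp_shift.
have fu2 : fin_supp (fun x => u x ^+ 2) by exact: fin_suppX.
have fd2 : fin_supp (fun x => (u x - xi x) ^+ 2).
  exact/fin_suppX/fin_supp_diff.
have -> : gsum (fun x => f (s^-1 * x)%g * xi x ^+ 2) = gsum (fun x => f x * u x ^+ 2).
  rewrite -(@gsum_shift _ _ s); last exact: fin_suppMr.
  by congr gsum; apply/funext => x; rewrite mulKg.
have -> : gsum (fun x => f x * u x ^+ 2) - gsum (fun x => f x * xi x ^+ 2) =
    gsum (fun x => f x * (u x ^+ 2 - xi x ^+ 2)).
  rewrite addrC -mulN1r -gsum_lin; [|exact: fin_suppMr..].
  by congr gsum; apply/funext => x; ring.
have ff : fin_supp (fun x => f x * (u x ^+ 2 - xi x ^+ 2)).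
  apply: fin_suppMr; have := fin_supp_lin (-1) fx2 fu2.
  by under eq_fun do rewrite mulN1r addrC.
apply: le_trans (gsum_abs ff) _.
pose h x := M * (e^-1 * (u x - xi x) ^+ 2 + (e * u x ^+ 2 + e * xi x ^+ 2)).
have fe (c : R) w : fin_supp w -> fin_supp (fun x => c * w x).
  by move=> fw; exact: (@fin_suppMr _ _ w (fun=> c)).
have fin_eu : fin_supp (fun x => e * u x ^+ 2 + e * xi x ^+ 2).
  by apply: fin_supp_lin => //; exact: fe.
have fh : fin_supp h by apply: fe; apply: fin_supp_lin.
apply: (@le_trans _ _ (gsum h)).
  apply: gsum_le => //; first by have [W fW] := ff; exists W => x xW; rewrite fW// normr0.
  move=> x; rewrite normrM; apply: ler_pM => //.
  rewrite subr_sqr normrM.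
  have h1 : 0 <= e^-1 * (`|u x - xi x| - e * `|u x + xi x| / 2 ) ^+ 2.
    by rewrite mulr_ge0 ?sqr_ge0// invr_ge0 ltW.
  have h2 := sqr_ge0 (u x - xi x).
  have h3 : `|u x - xi x| ^+ 2 = (u x - xi x) ^+ 2 by rewrite real_normK ?num_real.
  have h4 : `|u x + xi x| ^+ 2 = (u x + xi x) ^+ 2 by rewrite real_normK ?num_real.
  have h5 : e^-1 * (`|u x - xi x| - e * `|u x + xi x| / 2 ) ^+ 2 =
    e^-1 * `|u x - xi x| ^+ 2 + e * `|u x + xi x| ^+ 2 / 4 - `|u x - xi x| * `|u x + xi x|.
    by field; exact: lt0r_neq0.
  move: h1; rewrite h5 h3 h4 => h1.
  have h6 : e * (u x + xi x) ^+ 2 <= e * (2 * (u x ^+ 2 + xi x ^+ 2)).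
    rewrite ler_pM2l// -subr_ge0.
    have -> : 2 * (u x ^+ 2 + xi x ^+ 2) - (u x + xi x) ^+ 2 = (u x - xi x) ^+ 2 by ring.
    by [].
  have h7 : 0 <= e * (u x ^+ 2 + xi x ^+ 2).
    by rewrite mulr_ge0 ?(ltW e0)// addr_ge0 ?sqr_ge0.
  by lra.
rewrite /h gsumZ; last by apply: fin_supp_lin.
rewrite ler_wpM2l// gsum_lin// gsum_lin//; last exact: fe.
rewrite gsumZ// (gsum_shift s fx2) -/(nsq xi).
have : e^-1 * gsum (fun x => (u x - xi x) ^+ 2) <= e * nsq xi.
  by rewrite mulrC ler_pdivrMr// mulrAC -expr2.
by lra.
Qed.

(* Otherwise an ultralimit of [f |-> sum_x xi(x)^2 f(x)] along almost invariant
   unit vectors [xi] would be an invariant mean. *)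
Lemma not_amenable_variation : ~ amenable R G ->
  exists S : seq G, exists2 k : R, 0 < k &
    forall xi, fin_supp xi -> k * nsq xi <= variation S xi.
Proof.
move=> nam; apply/not_existsP => h; apply: nam.
(* If the inequality fails for every [S] and [k], each pair of a finite set and an integer yields a
   vector almost invariant under that set up to [1 / (n + 1)]. *)
have /choice[xi xiP] : forall d : {fset G} * nat, exists xi : G -> R,
    fin_supp xi /\ variation (enum_fset d.1) xi < (d.2.+1%:R^-1) ^+ 2 * nsq xi.
  move=> [W n]; apply/not_existsP => h'; apply: (h (enum_fset W)).
  exists ((n.+1%:R^-1) ^+ 2); first by rewrite exprn_gt0// invr_gt0.
  by move=> xi fx; rewrite leNgt; apply/negP => lt; apply: (h' xi).
have fx d : fin_supp (xi d) by have [] := xiP d.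
have fx2 d : fin_supp (fun x => xi d x ^+ 2) by exact: fin_suppX.
have v0 d : 0 <= variation (enum_fset d.1) (xi d).
  apply: sumr_ge0 => t _; apply: gsum_ge0 => [|x]; last exact: sqr_ge0.
  exact/fin_suppX/fin_supp_diff.
have n0 d : 0 < nsq (xi d).
  have := le_lt_trans (v0 d) (xiP d).2.
  by rewrite pmulr_rgt0// exprn_gt0// invr_gt0.
have [U [UU UP]] := @directed_ultrafilter ({fset G} * nat)%type
  (fun d e => (d.1 `<=` e.1)%fset /\ (d.2 <= e.2)%N) (fset0, 0%N)
  (fun d => conj (fsubset_refl d.1) (leqnn d.2))
  (fun d e f de ef => conj (fsubset_trans de.1 ef.1) (leq_trans de.2 ef.2))
  (fun d e => ex_intro2 _ _ ((d.1 `|` e.1)%fset, maxn d.2 e.2)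
     (conj (fsubsetUl _ _) (leq_maxl _ _)) (conj (fsubsetUr _ _) (leq_maxr _ _))).
pose N f d := (nsq (xi d))^-1 * gsum (fun x => f x * xi d x ^+ 2).
have N_le f (M : R) d : (forall x, `|f x| <= M) -> `|N f d| <= M.
  move=> fM; rewrite /N normrM ger0_norm ?invr_ge0 ?(ltW (n0 d))//.
  rewrite mulrC ler_pdivrMr//.
  apply: le_trans (gsum_abs (fin_suppMr _ (fx2 d))) _.
  rewrite /nsq -gsumZ//; apply: gsum_le.
  - have [W fW] := fin_suppMr f (fx2 d).
    by exists W => x xW; rewrite fW// normr0.
  - exact: (@fin_suppMr _ _ _ (fun=> M)).
  - by move=> x; rewrite normrM (ger0_norm (sqr_ge0 _)) ler_wpM2r ?sqr_ge0.
have bN f : bounded_net f -> bounded_net (N f).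
  by move=> [M fM]; exists M => d; exact: N_le.
have NP a f k d : N (fun x => a * f x + k x) d = a * N f d + N k d.
  rewrite /N mulrCA -mulrDr -gsum_lin; [|exact: fin_suppMr..].
  by congr (_ * gsum _); apply/funext => x; ring.
exists (fun f => ulim U (N f)); split.
- move=> a f k /bounded_funP bf /bounded_funP bk.
  rewrite -ulimZ; last exact: bN.
  rewrite -ulimD; last exact: bN.
    by congr ulim; apply/funext => d; rewrite NP.
  have [M fM] := bN _ bf; exists (`|a| * M) => W.
  by rewrite normrM ler_wpM2l.
- move=> f /bounded_funP bf f0; rewrite -(ulim_cst UU 0); apply: ulim_le.
  + exact: bounded_cst.
  + exact: bN.
  + apply: filterE => d; rewrite mulr_ge0 ?invr_ge0 ?(ltW (n0 d))//.
    apply: gsum_ge0 => [|x]; first exact: fin_suppMr.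
    by rewrite mulr_ge0// sqr_ge0.
- rewrite -[RHS](ulim_cst UU 1); congr ulim; apply/funext => d.
  rewrite /N; under eq_fun do rewrite mul1r.
  by rewrite mulVf// gt_eqF.
- move=> g f /bounded_funP bf; have [M fM] := bf.
  have M0 : 0 <= M by apply: le_trans (fM 1%g).
  have bgf : bounded_net (fun x => f (g^-1 * x)%g) by exists M.
  apply/eqP; rewrite -subr_eq0 -normr_eq0 eq_le normr_ge0 andbT.
  apply/ler_addgt0Pr => e e0; rewrite add0r.
  have k0 : 0 < M * 3 + 1 by rewrite ltr_pwDr// mulr_ge0.
  have [n nP] := harmonic_lt (divr_gt0 e0 k0).
  have NB d : ([fset g]%fset `<=` d.1)%fset /\ (n <= d.2)%N ->
      `|N (fun x => f (g^-1 * x)%g) d - N f d| <= e.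
    move=> [gd nd]; rewrite /N -mulrBr normrM ger0_norm ?invr_ge0 ?(ltW (n0 d))//.
    rewrite mulrC ler_pdivrMr//.
    apply: le_trans (@square_shift_le (xi d) f g M (nsq (xi d)) d.2 (fx d) fM _) _.
      apply: le_trans (ltW (xiP d).2); apply: variation_term => //.
      by apply: (fsubsetP gd); rewrite in_fset1.
    rewrite mulrA ler_wpM2r ?(ltW (n0 d))//.
    have := ltW (nP d.2 nd); rewrite ler_pdivlMr// => h1.
    apply: le_trans h1; rewrite mulrA mulrC ler_wpM2l ?invr_ge0//.
    by rewrite lerDl.
  have -> : ulim U (N (fun x => f (g^-1 * x)%g)) - ulim U (N f) =
      ulim U (fun d => N (fun x => f (g^-1 * x)%g) d - N f d).
    rewrite -mulN1r -ulimZ; last exact: bN.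
    rewrite -ulimD; [|exact: bN|].
      by congr ulim; apply/funext => d; rewrite mulN1r.
    by have [K KP] := bN _ bf; exists K => d; rewrite mulN1r normrN.
  have bd : bounded_net (fun d => N (fun x => f (g^-1 * x)%g) d - N f d).
    exists (M + M) => d; apply: le_trans (ler_normB _ _) _.
    by apply: lerD; apply: N_le.
  by apply: norm_ulim_le => //; exact: (UP ([fset g]%fset, n)).
Qed.

Section Averaging.
Variables (T : finType) (e : T -> G).

Definition translates xi : G -> R := fun x => \sum_(t : T) xi ((e t)^-1 * x)%g.

Lemma fin_supp_translates xi : fin_supp xi -> fin_supp (translates xi).
Proof. by move=> fx; apply: fin_supp_sum => t; exact: fin_supp_shift. Qed.

End Averaging.

Lemma sqr_sum_le (T : finType) (P : pred T) (a : T -> R) :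
  (\sum_(t | P t) a t) ^+ 2 <= #|P|%:R * \sum_(t | P t) a t ^+ 2.
Proof.
apply: discriminant_le => // [|t].
  by apply: sumr_ge0 => t _; exact: sqr_ge0.
have -> : #|P|%:R + 2 * t * (\sum_(x | P x) a x) + t ^+ 2 * (\sum_(x | P x) a x ^+ 2) =
    \sum_(x | P x) (1 + t * a x) ^+ 2.
  rewrite -sumr_const !mulr_sumr -!big_split/=; apply: eq_bigr => x _; ring.
by apply: sumr_ge0 => x _; exact: sqr_ge0.
Qed.

(** Measured from [a t0] one of the deviations is zero, so the Cauchy-Schwarz inequality costs a
    factor [#|T| - 1] instead of [#|T|]. In [kesten] the pinned term belongs to the identity
    generator, and the gain is a sum that dominates the variation. *)
Lemma sqr_sum_pinned_le (T : finType) (a : T -> R) (t0 : T) :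
  (\sum_t a t) ^+ 2 <=
  #|T|%:R * (\sum_t a t ^+ 2) - \sum_t (a t - a t0) ^+ 2.
Proof.
pose b t := a t - a t0.
have b0 : b t0 = 0 by rewrite /b subrr.
pose B := \sum_t b t; pose B2 := \sum_t b t ^+ 2; pose p : R := #|T|%:R.
have E1 : \sum_t a t = p * a t0 + B.
  rewrite /p -sumr_const mulr_suml -big_split/=; apply: eq_bigr => t _.
  by rewrite /b; ring.
have E2 : \sum_t a t ^+ 2 = p * a t0 ^+ 2 + 2 * a t0 * B + B2.
  rewrite /p -sumr_const mulr_suml mulr_sumr -!big_split/=; apply: eq_bigr => t _.
  by rewrite /b; ring.
have T0 : (0 < #|T|)%N by apply/card_gt0P; exists t0.
have hB : B ^+ 2 <= (p - 1) * B2.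
  rewrite /B /B2 (bigD1 t0)//= b0 add0r [\sum_t _](bigD1 t0)//= b0 expr0n add0r.
  apply: le_trans (sqr_sum_le _ _) _.
  have -> : #|[pred t | t != t0]| = #|T|.-1 by rewrite -(cardC1 t0); apply: eq_card.
  by rewrite /p -{2}(prednK T0) -natr1 addrK.
rewrite E1 E2 -/B2 -/p -subr_ge0.
have -> : p * (p * a t0 ^+ 2 + 2 * a t0 * B + B2) - B2 - (p * a t0 + B) ^+ 2 =
  (p - 1) * B2 - B ^+ 2 by ring.
by rewrite subr_ge0.
Qed.

Lemma ler_sum_inj (T T' : finType) (f : T' -> T) (h : T -> R) :
  injective f -> (forall t, 0 <= h t) -> \sum_i h (f i) <= \sum_t h t.
Proof.
move=> fI h0; rewrite -(big_map f xpredT h) big_uniq/=; last first.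
  by rewrite map_inj_uniq ?index_enum_uniq.
rewrite [leRHS](bigID (mem (map f (index_enum T'))))/= lerDl.
exact: sumr_ge0.
Qed.

(** The spectral gap makes [translates ev] contract the l^2 norm by [Num.sqrt r] relative to the
    trivial factor [#|J|]; the value at 1 of an iterate of the unit mass is at most its l^2 norm. *)
Lemma kesten : ~ amenable R G ->
  exists (J : finType) (ev : J -> G) (inv : J -> J) (j0 : J) (rho : R),
    [/\ involutive inv, forall j, ev (inv j) = (ev j)^-1%g,
        0 <= rho < 1 &
        forall n, iter n (translates ev) (fun x => (x == 1%g)%:R) 1%g <=
                  (rho * #|J|%:R) ^+ n].
Proof.
move=> /not_amenable_variation[S [k k0 kS]].
(* The members of [S], their inverses, and the identity [None], which serves as the pinned term in
   [sqr_sum_pinned_le]. *)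
pose J : finType := option ('I_(size S) * bool)%type.
pose ev (j : J) : G := match j with
  | None => 1%g
  | Some (i, true) => nth 1%g S i
  | Some (i, false) => (nth 1%g S i)^-1%g
  end.
pose inv (j : J) : J := match j with
  | None => None | Some (i, b) => Some (i, ~~ b) end.
pose p : R := #|J|%:R.
have p1 : 1 <= p by rewrite ler1n; apply/card_gt0P; exists None.
have p0 : 0 < p by exact: lt_le_trans ltr01 p1.
pose r := 1 - k / p ^+ 2.
have trans_le xi : fin_supp xi -> nsq (translates ev xi) <= r * p ^+ 2 * nsq xi.
  move=> fx; have ft t : fin_supp (fun x => xi ((ev t)^-1 * x)%g).
    exact: fin_supp_shift.
  have fd t : fin_supp (fun x => xi ((ev t)^-1 * x)%g - xi x).
    exact: fin_supp_diff.
  have fd2 : fin_supp (fun x => \sum_t (xi ((ev t)^-1 * x)%g - xi x) ^+ 2).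
    by apply: fin_supp_sum => t; exact: fin_suppX.
  have ft2 : fin_supp (fun x => \sum_t xi ((ev t)^-1 * x)%g ^+ 2).
    by apply: fin_supp_sum => t; exact: fin_suppX.
  have f1 : nsq (translates ev xi) <= gsum (fun x =>
      p * (\sum_t xi ((ev t)^-1 * x)%g ^+ 2) +
      (- 1) * (\sum_t (xi ((ev t)^-1 * x)%g - xi x) ^+ 2)).
    apply: gsum_le.
    - exact/fin_suppX/fin_supp_translates.
    - apply: fin_supp_lin => //.
      exact: (@fin_suppMr _ _ _ (fun=> -1)).
    - move=> x; rewrite mulN1r.
      have := sqr_sum_pinned_le (fun t => xi ((ev t)^-1 * x)%g) None.
      by rewrite /= invg1 mul1g.
  apply: le_trans f1 _; rewrite gsum_lin//; last exact: (@fin_suppMr _ _ _ (fun=> -1)).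
  rewrite gsumZ// !gsum_sum; [|by move=> t; exact: fin_suppX..].
  have -> : \sum_t gsum (fun x => xi ((ev t)^-1 * x)%g ^+ 2) = p * nsq xi.
    have <- : \sum_(t : J) nsq xi = p * nsq xi by rewrite sumr_const -mulr_natl.
    apply: eq_bigr => t _.
    exact: (gsum_shift (ev t)^-1%g (fin_suppX 1 fx)).
  have -> : r * p ^+ 2 * nsq xi = p * (p * nsq xi) + -1 * (k * nsq xi).
    by rewrite /r; field; exact: lt0r_neq0.
  rewrite lerD2l !mulN1r lerN2; apply: le_trans (kS _ fx) _.
  rewrite /variation (big_nth 1%g) big_mkord.
  pose h (t : J) := gsum (fun x => (xi ((ev t)^-1 * x)%g - xi x) ^+ 2).
  have h0 t : 0 <= h t.
    by apply: gsum_ge0 => [|x]; [exact: fin_suppX|exact: sqr_ge0].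
  have -> : \sum_(i < size S) gsum (fun x => (xi (nth 1%g S i * x)%g - xi x) ^+ 2) =
      \sum_(i < size S) h (Some (i, false)).
    by apply: eq_bigr => i _; rewrite /h /= invgK.
  by apply: (ler_sum_inj (f := fun i => Some (i, false))) => // i j [].
pose dl : G -> R := fun x => (x == 1%g)%:R.
have fdl : fin_supp dl.
  by exists [fset 1%g]%fset => x; rewrite in_fset1 /dl => /negbTE ->.
have ndl : nsq dl = 1.
  rewrite /nsq (@gsumE _ _ [fset 1%g]%fset); last first.
    by move=> x; rewrite in_fset1 /dl => /negbTE ->; rewrite expr0n.
  by rewrite big_seq_fset1 /dl eqxx expr1n.
(* The contraction estimate for the unit mass at 1, whose image has nonnegative norm. *)
have r0 : 0 <= r.
  have := le_trans (nsq_ge0 (fin_supp_translates ev fdl)) (trans_le _ fdl).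
  by rewrite ndl mulr1 pmulr_lge0// exprn_gt0.
have r1 : r < 1 by rewrite /r ltrBlDr ltrDl divr_gt0// exprn_gt0.
exists J, ev, inv, None, (Num.sqrt r); split.
- by move=> [[i b]|]//=; rewrite negbK.
- by move=> [[i []]|]/=; rewrite ?invgK ?invg1.
- by rewrite sqrtr_ge0/= -[ltRHS]sqrtr1 ltr_sqrt.
- move=> n; pose f n := iter n (translates ev) dl.
  have ff : forall n, fin_supp (f n).
    by elim=> [|i IH]//=; exact: fin_supp_translates.
  have fn : nsq (f n) <= (r * p ^+ 2) ^+ n.
    elim: n => [|n IH]; first by rewrite expr0 /= ndl.
    rewrite exprS; apply: le_trans (trans_le _ (ff n)) _.
    by rewrite ler_wpM2l// mulr_ge0// sqr_ge0.
  have rp : 0 <= Num.sqrt r * p by rewrite mulr_ge0 ?sqrtr_ge0 ?(ltW p0).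
  have h1 : f n 1%g ^+ 2 <= ((Num.sqrt r * p) ^+ n) ^+ 2.
    rewrite [leRHS]exprAC [(_ * p) ^+ 2]exprMn sqr_sqrtr//; apply: le_trans fn.
    apply: (gsum_ge_term (f := fun x => f n x ^+ 2)); first exact: fin_suppX.
    by move=> x; exact: sqr_ge0.
  rewrite -/(f n 1%g); have [f0|f0] := leP 0 (f n 1%g).
    by rewrite -(ler_pXn2r (n := 2)) ?nnegrE ?exprn_ge0.
  by apply: le_trans (ltW f0) _; exact: exprn_ge0.
Qed.

End Kesten.

(** * Characters of infinite Abelian groups *)

Section Characters.
Variables (R : realType) (A : groupType).
Hypothesis Acomm : forall x y : A, (x * y = y * x)%g.
Local Notation C := R[i].
Implicit Types S : set (A * C).

Definition is_character (chi : A -> C) :=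
  (forall a b, chi (a * b)%g = chi a * chi b) /\ forall a, cabs (chi a) = 1.

(** The graph of a character of a subgroup, given as a set of pairs so that Zorn's lemma can use
    plain unions. [pchar_one] makes the graph single-valued. *)
Record partial_character S : Prop := PartialCharacter {
  pchar1 : S (1%g, 1);
  pcharM : forall a b z w, S (a, z) -> S (b, w) -> S ((a * b)%g, z * w);
  pcharV : forall a z, S (a, z) -> S (a^-1%g, z^-1);
  pchar_one : forall z, S (1%g, z) -> z = 1;
  pchar_norm : forall a z, S (a, z) -> cabs z = 1 }.

Lemma cabs1_neq0 (z : C) : cabs z = 1 -> z != 0.
Proof. by move=> z1; rewrite -cabs_eq0 z1 oner_eq0. Qed.

Lemma pchar_fun S a z w : partial_character S -> S (a, z) -> S (a, w) -> z = w.
Proof.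
move=> hS Sz Sw; have w0 := cabs1_neq0 (pchar_norm hS Sw).
have := pcharM hS Sz (pcharV hS Sw); rewrite mulgV => /(pchar_one hS) zw.
by apply: (mulIf (invr_neq0 w0)); rewrite zw divff.
Qed.

Lemma pcharX S a z n : partial_character S -> S (a, z) -> S ((a ^+ n)%g, z ^+ n).
Proof.
move=> hS Sz; elim: n => [|n IH]; first exact: pchar1 hS.
by rewrite expgS exprS; exact: pcharM hS _ _ _ _ Sz IH.
Qed.

(** Extension to the subgroup generated by the domain and [a], with [a] sent to [t]. Two natural
    exponents, one on each side, replace an integer exponent. *)
Definition pchar_adjoin S a (t : C) : set (A * C) := fun xz =>
  exists i j b w, [/\ S (b, w), (xz.1 * a ^+ j = b * a ^+ i)%g &
                      xz.2 * t ^+ j = w * t ^+ i].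

Lemma pchar_adjoinP S a (t : C) : partial_character S -> cabs t = 1 ->
  (forall n y, S ((a ^+ n)%g, y) -> y = t ^+ n) ->
  [/\ partial_character (pchar_adjoin S a t), S `<=` pchar_adjoin S a t &
      pchar_adjoin S a t (a, t)].
Proof.
move=> hS t1 ht; have t0 := cabs1_neq0 t1.
have tn n : t ^+ n != 0 by rewrite expf_neq0.
split; last first.
- by exists 1%N, 0%N, 1%g, 1; split; rewrite ?expg0 ?expr0 ?mulg1 ?mulr1 ?mul1g ?mul1r//;
    exact: pchar1 hS.
- by move=> [x z] Sxz; exists 0%N, 0%N, x, z; split; rewrite ?expg0 ?expr0 ?mulg1 ?mulr1.
split.
- by exists 0%N, 0%N, 1%g, 1; split; rewrite ?expg0 ?expr0 ?mulg1 ?mulr1//; exact: pchar1 hS.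
- move=> x y z w [i [j [b [v [Sb /= xE zE]]]]] [i' [j' [b' [v' [Sb' /= yE wE]]]]].
  exists (i + i')%N, (j + j')%N, (b * b')%g, (v * v'); split=> /=.
  + exact: pcharM hS _ _ _ _ Sb Sb'.
  + rewrite !expgnDr -mulgA [(y * _)%g]mulgA [(y * _)%g]Acomm -mulgA yE.
    by rewrite mulgA xE -!mulgA; congr (b * _)%g; rewrite mulgA [(_ * b')%g]Acomm mulgA.
  + by rewrite !exprD mulrACA zE wE mulrACA.
- move=> x z [i [j [b [w [Sb /= xE zE]]]]].
  have w0 := cabs1_neq0 (pchar_norm hS Sb).
  exists j, i, b^-1%g, w^-1; split=> /=.
  + exact: pcharV hS _ _ Sb.
  + have -> : (x^-1 * a ^+ i = x^-1 * (b^-1 * (b * a ^+ i)))%g by rewrite mulKg.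
    by rewrite -xE [(b^-1 * _)%g]Acomm -mulgA mulKg Acomm.
  + have z0 : z != 0.
      by apply: contraTneq (mulf_neq0 w0 (tn i)) => z0; rewrite -zE z0 mul0r eqxx.
    apply: (mulfI (mulf_neq0 w0 z0)).
    have -> : w * z * (z^-1 * t ^+ i) = (w * t ^+ i) * (z / z) by ring.
    rewrite divff// mulr1 -zE.
    by rewrite mulrACA divff// mul1r.
- move=> z [i [j [b [w [Sb /= xE zE]]]]]; rewrite mul1g in xE.
  have w0 := cabs1_neq0 (pchar_norm hS Sb).
  have [ij|ji] := leqP i j.
    have wE : w = t ^+ (j - i).
      apply: ht; suff -> : (a ^+ (j - i) = b)%g by [].
      by rewrite expgnFr// xE mulgK.
    by apply: (mulIf (tn j)); rewrite zE wE -exprD subnK// mul1r.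
  have wE : w^-1 = t ^+ (i - j).
    apply: ht; suff -> : (a ^+ (i - j) = b^-1)%g by exact: pcharV hS _ _ Sb.
    rewrite expgnFr ?(ltnW ji)// xE invgM mulgA mulgV mul1g//.
  apply: (mulIf (tn j)); rewrite zE mul1r -(subnK (ltnW ji)) exprD -wE.
  by rewrite mulVKf.
- move=> x z [i [j [b [w [Sb /= xE zE]]]]].
  have := congr1 (@cabs R) zE.
  by rewrite !cabsM !cabsX t1 !expr1n !mulr1 (pchar_norm hS Sb).
Qed.

(** Divisibility of the circle: if [m] is the least positive exponent with [a ^+ m] in the domain,
    an [m]-th root of its value will do; without such an exponent, 1 will do. *)
Lemma pchar_root S a : partial_character S ->
  exists2 t : C, cabs t = 1 & forall n y, S ((a ^+ n)%g, y) -> y = t ^+ n.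
Proof.
move=> hS.
have [[n0 [n00 [w0 Sw0]]]|no] :=
  pselect (exists n, (0 < n)%N /\ exists w, S ((a ^+ n)%g, w)); last first.
  exists 1; first exact: cabs1.
  move=> [|n] y Sy; first exact: pchar_one hS _ Sy.
  by exfalso; apply: no; exists n.+1; split=> //; exists y.
pose P n := `[< (0 < n)%N /\ exists w, S ((a ^+ n)%g, w) >].
have exP : exists n, P n by exists n0; apply/asboolP; split=> //; exists w0.
case: (ex_minnP exP) => m /asboolP[m0 [w Sw]] m_min.
pose t := (m.-root w : C).
have tm : t ^+ m = w by exact: rootCK.
have t1 : cabs t = 1.
  have := pchar_norm hS Sw; rewrite -tm cabsX => /eqP.
  by rewrite pexpr_eq1// ?cabs_ge0// => /eqP.
exists t => // n y Sy.
have Sq : S ((a ^+ (n %% m))%g, y * (w ^+ (n %/ m))^-1).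
  have -> : (a ^+ (n %% m) = a ^+ n * (a ^+ m ^+ (n %/ m))^-1)%g.
    have -> : (a ^+ n = a ^+ (n %% m) * a ^+ m ^+ (n %/ m))%g.
      by rewrite -expgnA -expgnDr addnC mulnC -divn_eq.
    by rewrite mulgK.
  apply: (pcharM hS) => //; apply: (pcharV hS); exact: pcharX.
have r0 : (n %% m = 0)%N.
  apply/eqP; rewrite -leqn0 leqNgt; apply/negP => rpos.
  have : P (n %% m)%N by apply/asboolP; split=> //; eexists; exact: Sq.
  by move=> /m_min; rewrite leqNgt ltn_mod m0.
move: Sq; rewrite r0 => /(pchar_one hS) yE.
have wn : w ^+ (n %/ m) != 0.
  by rewrite expf_neq0// (cabs1_neq0 (pchar_norm hS Sw)).
have -> : y = w ^+ (n %/ m) by rewrite -[LHS](mulfVK wn) yE mul1r.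
by rewrite -tm -exprM {2}(divn_eq n m) r0 addn0 mulnC.
Qed.

Lemma pchar_extend S0 : partial_character S0 ->
  exists2 chi, is_character chi & forall a z, S0 (a, z) -> chi a = z.
Proof.
move=> hS0.
(* Joining [S0] to every member keeps the condition true for the union of the empty chain. *)
have [|M [hM Mmax]] := @Zorn_bigcup (A * C)%type
    (fun S => partial_character (S `|` S0)).
  move=> F FP Ftot; split.
  - by right; exact: pchar1 hS0.
  - have key x y : ((\bigcup_(X in F) X) `|` S0) x -> ((\bigcup_(X in F) X) `|` S0) y ->
        (exists2 X, F X & (X `|` S0) x /\ (X `|` S0) y) \/ (S0 x /\ S0 y).
      move=> [[X FX Xx]|Sx] [[Y FY Yy]|Sy]; last by right.
      + left; have [XY|YX] := Ftot _ _ FX FY.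
          by exists Y => //; split; left=> //; exact: XY.
        by exists X => //; split; left=> //; exact: YX.
      + by left; exists X => //; split; [left|right].
      + by left; exists Y => //; split; [right|left].
    move=> a b z w Sa Sb; have [[X FX [Xa Xb]]|[Sa' Sb']] := key _ _ Sa Sb.
      have [Xab|S0ab] := pcharM (FP _ FX) Xa Xb; last by right.
      by left; exists X.
    by right; exact: pcharM hS0 _ _ _ _ Sa' Sb'.
  - move=> a z [[X FX Xa]|Sa]; last by right; exact: pcharV hS0 _ _ Sa.
    have [Xab|S0ab] := pcharV (FP _ FX) (or_introl Xa); last by right.
    by left; exists X.
  - move=> z [[X FX Xa]|Sa]; last exact: pchar_one hS0 _ Sa.
    exact: pchar_one (FP _ FX) _ (or_introl Xa).
  - move=> a z [[X FX Xa]|Sa]; last exact: pchar_norm hS0 _ _ Sa.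
    exact: pchar_norm (FP _ FX) _ _ (or_introl Xa).
pose M' := M `|` S0.
have total a : exists z, M' (a, z).
  apply: contrapT => na; have [t t1 ht] := pchar_root a hM.
  have [hE sE aE] := pchar_adjoinP hM t1 ht.
  apply: (Mmax (pchar_adjoin M' a t)).
    split; first by move=> x Mx; apply: sE; left.
    by move=> sub; apply: na; exists t; left; exact: sub.
  suff -> : pchar_adjoin M' a t `|` S0 = pchar_adjoin M' a t by [].
  by apply/seteqP; split=> [x [//|Sx]|x]; [apply: sE; right|left].
have [chi chiP] := choice total.
exists chi; last by move=> a z Sa; apply: pchar_fun hM (chiP a) (or_intror Sa).
split=> [a b|a]; last exact: pchar_norm hM _ _ (chiP a).
exact: pchar_fun hM (chiP _) (pcharM hM (chiP a) (chiP b)).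
Qed.

(** A root of [1 + X + ... + X^(n-1)], whose value at 1 is [n] and not 0. *)
Lemma root_of_unity_neq1 (n : nat) : (1 < n)%N ->
  exists2 t : C, t ^+ n = 1 & t != 1.
Proof.
move=> n1; pose p : {poly C} := \sum_(i < n) 'X^i.
have szp : size p = n.
  have -> : p = \poly_(i < n) 1.
    by rewrite poly_def; apply: eq_bigr => i _; rewrite scale1r.
  by rewrite size_poly_eq// oner_eq0.
have /closed_rootP[t /rootP pt] : size p != 1%N by rewrite szp neq_ltn n1 orbT.
have pE x : p.[x] = \sum_(i < n) x ^+ i.
  by rewrite horner_sum; apply: eq_bigr => i _; rewrite hornerXn.
exists t.
  by apply/eqP; rewrite -subr_eq0 subrX1 -pE pt mulr0.
apply: contra_eqN pt => /eqP ->; rewrite pE.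
under eq_bigr do rewrite expr1n.
by rewrite sumr_const card_ord pnatr_eq0 -lt0n ltnW.
Qed.

(** Adjoin [a] to the trivial character of the trivial subgroup: its value may be any root of unity
    other than 1 that is compatible with the order of [a], and -1 if that order is infinite. *)
Lemma character_separates (a : A) : a != 1%g ->
  exists2 chi, is_character chi & chi a != 1.
Proof.
move=> a1; pose S1 : set (A * C) := [set (1%g, 1)].
have hS1 : partial_character S1.
  split=> [//|x y z w [-> ->] [-> ->]|x z [-> ->]|z [//]|x z [_ ->]].
  - by rewrite mulg1 mulr1.
  - by rewrite invg1 invr1.
  - exact: cabs1.
have [t [t1 tn ht]] : exists t : C, [/\ cabs t = 1, t != 1 &
    forall n, (a ^+ n = 1)%g -> t ^+ n = 1].
  have [[n0 [n00 an0]]|no] := pselect (exists n, (0 < n)%N /\ (a ^+ n = 1)%g); last first.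
    exists (-1); split.
    - by rewrite cabsN cabs1.
    - by rewrite -subr_eq0 -opprD oppr_eq0 (_ : 1 + 1 = 2%:R) ?pnatr_eq0.
    - move=> [|n] an; first by rewrite expr0.
      by exfalso; apply: no; exists n.+1.
  pose P n := (0 < n)%N && (a ^+ n == 1)%g.
  have exP : exists n, P n by exists n0; rewrite /P n00 an0 eqxx.
  case: (ex_minnP exP) => m /andP[m0 /eqP am] m_min.
  have m1 : (1 < m)%N.
    rewrite ltn_neqAle m0 andbT; apply: contra_neq a1 => m1.
    by rewrite -am -m1 expg1.
  have [t tm tn] := root_of_unity_neq1 m1.
  exists t; split=> // [|n an].
    have /eqP : cabs t ^+ m = 1 by rewrite -cabsX tm cabs1.
    by rewrite pexpr_eq1// ?cabs_ge0// => /eqP.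
  have /eqP r0 : (n %% m == 0)%N.
    rewrite -leqn0 leqNgt; apply/negP => rpos.
    have : P (n %% m)%N.
      rewrite /P rpos/=; move: an; rewrite {1}(divn_eq n m) expgnDr mulnC expgnA am.
      by rewrite expg1n mul1g => ->.
    by move=> /m_min; rewrite leqNgt ltn_mod m0.
  by rewrite (divn_eq n m) r0 addn0 mulnC exprM tm expr1n.
have [|hE _ aE] := pchar_adjoinP (a := a) hS1 t1.
  by move=> n y [an ->]; rewrite ht.
have [chi hchi chiE] := pchar_extend hE.
by exists chi => //; rewrite (chiE _ _ aE).
Qed.

Lemma character_expr chi n : is_character chi -> is_character (fun a => chi a ^+ n).
Proof.
move=> [chiM chi1]; split=> [a b|a]; first by rewrite chiM exprMn.
by rewrite cabsX chi1 expr1n.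
Qed.

(** Among finitely many characters two powers of [chi] coincide, so its values are roots of some
    [X^n - 1]. *)
Lemma finite_range_character chi : is_character chi ->
  finite_set [set chi' | is_character chi'] -> finite_set (range chi).
Proof.
move=> hchi fin; have [chiM chi1] := hchi.
have [i [j [ij cij]]] : exists i j, (i < j)%N /\ forall a, chi a ^+ i = chi a ^+ j.
  apply: contrapT => no; apply: infinite_nat.
  rewrite -[setT](preimage_setT (fun n => (fun a => chi a ^+ n))).
  have : finite_set ((fun n a => chi a ^+ n) @^-1` [set chi' | is_character chi']).
    apply: finite_preimage fin => m n _ _ mn.
    have mnE a : chi a ^+ m = chi a ^+ n by exact: (congr1 (fun f => f a) mn).
    case: (ltngtP m n) => // lt; exfalso; apply: no; first by exists m, n.
    by exists n, m; split=> // a; rewrite mnE.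
  by apply: sub_finite_set => n _ /=; exact: character_expr.
pose n := (j - i)%N; have n0 : (0 < n)%N by rewrite subn_gt0.
have chin a : chi a ^+ n = 1.
  have c0 : chi a ^+ i != 0 by rewrite expf_neq0// (cabs1_neq0 (chi1 a)).
  by apply: (mulIf c0); rewrite -exprD subnK ?(ltnW ij)// mul1r cij.
have [r rE] := closed_field_poly_normal ('X^n - 1 : {poly C}).
apply: (@sub_finite_set _ _ [set` r]); last by apply/finite_seqP; exists r.
move=> _ [a _ <-] /=.
have : root ('X^n - 1 : {poly C}) (chi a).
  by rewrite /root !hornerE chin subrr.
rewrite rE rootZ; last by rewrite lead_coefDl ?size_polyXn ?size_polyN ?size_poly1 ?ltnS// lead_coefXn oner_neq0.
by rewrite root_prod_XsubC.
Qed.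

(** If there were only finitely many characters, listing their values would embed [A] in a finite
    set: characters separate points, and each has finite range. *)
Lemma infinite_characters : infinite_set [set: A] ->
  infinite_set [set chi | is_character chi].
Proof.
move=> infA fin; apply: infA; have [cs csE] : exists cs : seq (A -> C),
    [set chi | is_character chi] = [set` cs] by apply/finite_seqP.
have hcs chi : chi \in cs -> is_character chi.
  by move=> ch; have : [set` cs] chi by []; rewrite -csE.
pose Phi (l : seq (A -> C)) a := [seq chi a | chi <- l].
have finPhi l : {subset l <= cs} -> finite_set (range (Phi l)).
  elim: l => [|chi l IH] sub.
    by apply: (@sub_finite_set _ _ [set [::]]); [move=> _ [a _ <-]|exact: finite_set1].
  have h1 : finite_set (range chi).
    by apply: finite_range_character => //; apply/hcs/sub; rewrite mem_head.
  have h2 : finite_set (range (Phi l)).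
    by apply: IH => c cl; apply: sub; rewrite inE cl orbT.
  apply: (@sub_finite_set _ _ ((fun zl => zl.1 :: zl.2) @` (range chi `*` range (Phi l)))).
    by move=> _ [a _ <-]; exists (chi a, Phi l a) => //; split; exists a.
  exact/finite_image/finite_setX.
have inj : injective (Phi cs).
  move=> a b ab; apply: contrapT => /eqP nab.
  have aE : a = (a * b^-1 * b)%g by rewrite -mulgA mulVg mulg1.
  have [|chi hchi] := @character_separates (a * b^-1)%g.
    by apply: contra nab => /eqP h; rewrite aE h mul1g.
  move=> /eqP; apply; have [chiM chi1] := hchi.
  have chics : chi \in cs by have : [set chi | is_character chi] chi by []; rewrite csE.
  have cab : chi a = chi b.
    have := congr1 (fun l => nth 0 l (index chi cs)) ab.
    by rewrite /Phi !(nth_map chi) ?index_mem// !nth_index.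
  have b0 := cabs1_neq0 (chi1 b).
  by apply: (mulIf b0); rewrite -chiM -aE cab mul1r.
rewrite -[setT](preimage_range (Phi cs)); apply: finite_preimage; last exact: finPhi.
by move=> x y _ _; exact: inj.
Qed.

(** With [X] the set of tables of labels, this attaches pairwise different characters to different
    tables. *)
Lemma character_family (X : finType) : infinite_set [set: A] ->
  exists chi : X -> A -> C, (forall x, is_character (chi x)) /\
    forall x y, x != y -> exists a, chi x a != chi y a.
Proof.
move=> /infinite_characters inf.
have [B BP Bn] := infinite_set_fset #|X| inf.
pose chi (x : X) := nth (fun=> 1) (enum_fset B) (enum_rank x).
have rk (x : X) : (enum_rank x < size (enum_fset B))%N.
  exact: leq_trans (ltn_ord _) Bn.
exists chi; split=> [x|x y xy]; first by apply: BP; exact: mem_nth.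
apply: contrapT => no; move/eqP: xy; apply.
have : chi x = chi y.
  apply/funext => a; apply: contrapT => /eqP nab; by apply: no; exists a.
by move=> /eqP; rewrite nth_uniq ?fset_uniq// => /eqP/val_inj/enum_rank_inj.
Qed.

End Characters.

(** * Random labels *)

Section Expectation.
Variables (K : numFieldType) (I : choiceType) (J : finType) (j0 : J).
Local Notation Om := (I -> J).
Implicit Types (f h : Om -> K) (w : Om) (c : I) (l : seq I).

Definition upd w c (t : J) : Om := fun c' => if c' == c then t else w c'.

Definition avg c f : Om -> K := fun w => #|J|%:R^-1 * \sum_(t : J) f (upd w c t).

(* Averages [f] over the coordinates in [l]; the others are set to [j0]. *)
Fixpoint Ex l f : K := if l is c :: l' then Ex l' (avg c f) else f (fun=> j0).

Definition depends_on l f := forall w w', {in l, w =1 w'} -> f w = f w'.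

Let p0 : (#|J|%:R : K) != 0.
Proof. by rewrite pnatr_eq0 -lt0n; apply/card_gt0P; exists j0. Qed.

Lemma avg_lin c a f h w :
  avg c (fun w => a * f w + h w) w = a * avg c f w + avg c h w.
Proof. by rewrite /avg big_split/= -mulr_sumr mulrDr mulrCA. Qed.

Lemma avg_le c f h : (forall w, f w <= h w) -> forall w, avg c f w <= avg c h w.
Proof. by move=> fh w; rewrite ler_wpM2l ?invr_ge0//; apply: ler_sum. Qed.

Lemma avg_id c f : (forall w t, f (upd w c t) = f w) -> avg c f = f.
Proof.
move=> fc; apply/funext => w; rewrite /avg (eq_bigr (fun=> f w))//.
by rewrite sumr_const -[f w *+ _]mulr_natl mulKf.
Qed.

Lemma upd_comm w c c' t t' : c != c' -> upd (upd w c t) c' t' = upd (upd w c' t') c t.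
Proof.
move=> cc'; apply/funext => d; rewrite /upd.
by case: (eqVneq d c) => [->|//]; rewrite (negbTE cc').
Qed.

Lemma avg_comm c c' f : avg c (avg c' f) = avg c' (avg c f).
Proof.
have [->//|cc'] := eqVneq c c'; apply/funext => w; rewrite /avg.
congr (_ * _); rewrite -!mulr_sumr exchange_big/=; congr (_ * _).
by apply: eq_bigr => t _; apply: eq_bigr => t' _; rewrite upd_comm.
Qed.

Lemma Ex_lin l a f h : Ex l (fun w => a * f w + h w) = a * Ex l f + Ex l h.
Proof.
elim: l f h => [//|c l IH] f h /=; rewrite -IH; congr Ex.
by apply/funext => w; exact: avg_lin.
Qed.

Lemma Ex_le l f h : (forall w, f w <= h w) -> Ex l f <= Ex l h.
Proof. by elim: l f h => [|c l IH] f h fh /=; [exact: fh|exact/IH/avg_le]. Qed.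

Lemma Ex_cst l a : Ex l (fun=> a) = a.
Proof. by elim: l => [//|c l IH] /=; rewrite avg_id. Qed.

Lemma ExZ l a f : Ex l (fun w => a * f w) = a * Ex l f.
Proof.
have := Ex_lin l a f (fun=> 0); rewrite Ex_cst addr0.
by under eq_fun do rewrite addr0.
Qed.

Lemma ExD l f h : Ex l (fun w => f w + h w) = Ex l f + Ex l h.
Proof.
have := Ex_lin l 1 f h; rewrite mul1r.
by under eq_fun do rewrite mul1r.
Qed.

Lemma Ex_sum l (T : Type) (r : seq T) (P : pred T) (F : T -> Om -> K) :
  Ex l (fun w => \sum_(i <- r | P i) F i w) = \sum_(i <- r | P i) Ex l (F i).
Proof.
elim: r => [|i r IH].
  by rewrite big_nil; under eq_fun do rewrite big_nil; rewrite Ex_cst.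
rewrite big_cons; under eq_fun do rewrite big_cons.
by case: (P i) => //; rewrite ExD IH.
Qed.

Lemma Ex_norm_le l f : `|Ex l f| <= Ex l (fun w => `|f w|).
Proof.
elim: l f => [//|c l IH] f /=; apply: le_trans (IH _) _; apply: Ex_le => w.
rewrite /avg normrM ger0_norm ?invr_ge0// ler_wpM2l ?invr_ge0//.
exact: ler_norm_sum.
Qed.

Lemma Ex_cat_cons l l' c f : Ex (l ++ c :: l') f = Ex (c :: l ++ l') f.
Proof. by elim: l f => [//|d l IH] f /=; rewrite IH/= avg_comm. Qed.

Lemma Ex_perm l l' f : perm_eq l l' -> Ex l f = Ex l' f.
Proof.
elim: l l' f => [|c l IH] l' f.
  by rewrite perm_sym => /perm_nilP ->.
move=> cl; have cl' : c \in l' by rewrite -(perm_mem cl) mem_head.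
case/splitPr: cl' cl => l1 l2; rewrite Ex_cat_cons => cl /=.
by apply: IH; rewrite -(perm_cons c) (perm_trans cl)// perm_catC/= perm_cons perm_catC.
Qed.

Lemma Ex_cat_indep l l' f : depends_on l f -> (forall c, c \in l' -> c \notin l) ->
  Ex (l' ++ l) f = Ex l f.
Proof.
move=> fl; elim: l' => [//|c l' IH] cl /=; rewrite avg_id.
  by apply: IH => d dl'; apply: cl; rewrite inE dl' orbT.
move=> w t; apply: fl => d dl; rewrite /upd; case: eqVneq => // dc.
by have := cl c (mem_head _ _); rewrite -dc dl.
Qed.

Lemma Ex_depends l l' f : uniq l -> uniq l' -> {subset l <= l'} ->
  depends_on l f -> Ex l' f = Ex l f.
Proof.
move=> ul ul' ll' fl.
rewrite (@Ex_perm l' ([seq c <- l' | c \notin l] ++ l)); last first.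
  apply: uniq_perm => // [|c].
    rewrite cat_uniq filter_uniq// ul andbT/=.
    by apply/hasPn => c cl; rewrite mem_filter negb_and negbK (cl : c \in l).
  rewrite mem_cat mem_filter; case: (boolP (c \in l)) => [/ll' ->|_].
    by rewrite orbT.
  by rewrite orbF.
by apply: Ex_cat_indep => // c; rewrite mem_filter => /andP[].
Qed.

Lemma Ex_reindex (s : I -> I) l f : injective s ->
  Ex (map s l) (fun w => f (w \o s)) = Ex l f.
Proof.
move=> sI; elim: l f => [//|c l IH] f /=; rewrite -IH; congr Ex.
apply/funext => w; rewrite /avg; congr (_ * _); apply: eq_bigr => t _.
by congr f; apply/funext => d; rewrite /upd/= (inj_eq sI).
Qed.

(** Independence of distinct coordinates: each constraint selects one of [#|J|] equally likely
    values. *)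
Lemma Ex_cylinder l (cs : seq (I * J)) : uniq l -> uniq (unzip1 cs) ->
  {subset unzip1 cs <= l} ->
  Ex l (fun w => (all (fun ct => w ct.1 == ct.2) cs)%:R) = (#|J|%:R^-1) ^+ size cs.
Proof.
move=> ul ucs csl; rewrite (@Ex_depends (unzip1 cs))//; last first.
  move=> w w' ww'; congr (_%:R); congr nat_of_bool; apply: eq_in_all => ct ctcs.
  by rewrite ww'//; apply/mapP; exists ct.
elim: cs ucs {csl} => [|[c t] cs IH] /=; first by rewrite expr0.
move=> /andP[ccs ucs]; rewrite exprS -IH// -ExZ; congr Ex; apply/funext => w.
rewrite /avg; congr (_ * _); rewrite (bigD1 t)//= big1 ?addr0; last first.
  by move=> t' /negbTE tt'; rewrite /upd eqxx tt'.
rewrite /upd !eqxx/=; congr (_%:R); congr nat_of_bool; apply: eq_in_all => ct ctcs.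
by case: (eqVneq ct.1 c) => // ct1; case/negP: ccs; rewrite -ct1; apply/mapP; exists ct.
Qed.

End Expectation.

Section ExpectationComplex.
Variables (R : realType) (I : choiceType) (J : finType) (j0 : J).

Lemma Ex_real l (f : (I -> J) -> R) :
  Ex j0 l (fun w => (f w)%:C%C) = (Ex j0 l f)%:C%C.
Proof.
elim: l f => [//|c l IH] f /=; rewrite -IH; congr Ex; apply/funext => w.
by rewrite /avg rmorphM fmorphV rmorph_nat rmorph_sum.
Qed.

End ExpectationComplex.

(** * The random forest *)

Section RandomGraph.
Variables (G : groupType) (J : finType) (ev : J -> G) (m k : nat).
Local Notation Om := (G * nat * nat -> J).
Implicit Types (W : {fset G}) (w : Om) (c : G * nat) (ok : pred (G * nat)).

Definition eval_word (t : seq J) : G := foldr (fun j g => ev j * g)%g 1%g t.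

(** In a configuration [w], the entry [w (x, j, i)] is letter [i] of the word number [j] chosen by
    the vertex [x]. *)
Definition word w c : seq J := [seq w (c.1, c.2, i) | i <- iota 0 k].

Definition target w c : G := (c.1 * eval_word (word w c))%g.

Definition ends w c x y :=
  (c.1 = x /\ target w c = y) \/ (c.1 = y /\ target w c = x).

(* The pair [c = (x, j)] stands for the edge from [x] to [target c]; [ok]
   selects the edges that may be used. *)
Definition adj W w ok : rel G := fun x y => [&& x \in W, y \in W &
  has (fun j => (ok (x, j) && (target w (x, j) == y)) ||
                (ok (y, j) && (target w (y, j) == x))) (iota 0 m)].

Lemma adjP W w ok x y : reflect
  (exists c, [/\ (c.2 < m)%N, ok c, c.1 \in W, target w c \in W & ends w c x y])
  (adj W w ok x y).
Proof.
apply: (iffP and3P) => [[xW yW /hasP[j + /orP[/andP[okj /eqP e]|/andP[okj /eqP e]]]]|].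
- rewrite mem_iota => /= jm; exists (x, j); split=> //=; first by rewrite e.
  by left.
- rewrite mem_iota => /= jm; exists (y, j); split=> //=; first by rewrite e.
  by right.
- move=> [[z j] [/= jm okc zW tW [[/= ? ?]|[/= ? ?]]]]; subst; split=> //.
    by apply/hasP; exists j; rewrite ?mem_iota// okc eqxx.
  by apply/hasP; exists j; rewrite ?mem_iota// okc eqxx orbT.
Qed.

Lemma ends_sym w c x y : ends w c x y -> ends w c y x.
Proof. by case; [right|left]. Qed.

Lemma adj_sym W w ok x y : adj W w ok x y -> adj W w ok y x.
Proof.
by move=> /adjP[c [? ? ? ? /ends_sym ?]]; apply/adjP; exists c.
Qed.

Definition conn W w ok x y := exists2 p, path (adj W w ok) x p & last x p = y.

Lemma conn_refl W w ok x : conn W w ok x x.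
Proof. by exists [::]. Qed.

Lemma conn_trans W w ok y x z : conn W w ok x y -> conn W w ok y z -> conn W w ok x z.
Proof.
move=> [p px <-] [q qy qz]; exists (p ++ q); last by rewrite last_cat.
by rewrite cat_path px.
Qed.

Lemma adj_conn W w ok x y : adj W w ok x y -> conn W w ok x y.
Proof. by move=> xy; exists [:: y] => //=; rewrite xy. Qed.

Lemma conn_sym W w ok x y : conn W w ok x y -> conn W w ok y x.
Proof.
move=> [p + <-]; elim: p x => [|z p IH] x /=; first by move=> _; exact: conn_refl.
move=> /andP[xz zp]; apply: conn_trans (IH _ zp) _; apply: adj_conn.
exact: adj_sym.
Qed.

Lemma conn_sub W W' w ok ok' x y : (W `<=` W')%fset -> subpred ok ok' ->
  conn W w ok x y -> conn W' w ok' x y.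
Proof.
move=> WW' sub [p px py]; exists p => //; apply: sub_path px => a b /adjP[c].
move=> [cm okc cW tW e]; apply/adjP; exists c; split=> //; first exact: sub.
- exact: (fsubsetP WW').
- exact: (fsubsetP WW').
Qed.

(* The edge [c] lies on no cycle contained in [W]. *)
Definition good W w c := [/\ (c.2 < m)%N, c.1 \in W, target w c \in W &
  ~ conn W w (predC1 c) c.1 (target w c)].

Definition edge W w x y := exists2 c, good W w c & ends w c x y.

(** The vertex of the component that comes first in the enumeration of [W]. Enumerations do not
    respect translations, so neither do roots and parents. The default 1 occurs only for [x] outside
    [W]. *)
Definition root_of W w x : G :=
  head 1%g [seq r <- enum_fset W | `[< conn W w predT x r >]].

(** A good edge is a bridge of the graph of all edges in [W]: removing it cuts its component in two.
    It is oriented towards the side of the root, so one root for each component of the full graph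
    suffices. *)
Definition parent W w x y := exists c,
  [/\ good W w c, ends w c x y & conn W w (predC1 c) y (root_of W w x)].

Lemma edge_sym W w x y : edge W w x y -> edge W w y x.
Proof. by move=> [c gc /ends_sym ec]; exists c. Qed.

Lemma edge_in W w x y : edge W w x y -> x \in W /\ y \in W.
Proof. by move=> [c [_ ? ? _] [[<- <-]|[<- <-]]]. Qed.

Lemma parent_edge W w x y : parent W w x y -> edge W w x y.
Proof. by move=> [c [gc ec _]]; exists c. Qed.

Lemma root_of_conn W w x : x \in W -> conn W w predT x (root_of W w x).
Proof.
move=> xW; rewrite /root_of; set s := [seq _ <- _ | _].
have : x \in s by rewrite mem_filter xW andbT; apply/asboolP; exact: conn_refl.
have : all (fun r => `[< conn W w predT x r >]) s by exact: filter_all.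
by case: s => //= r s /andP[/asboolP].
Qed.

Lemma root_of_eq W w x y : conn W w predT x y -> root_of W w x = root_of W w y.
Proof.
move=> xy; rewrite /root_of; congr head; apply: eq_filter => r.
apply/asboolP/asboolP; apply: conn_trans => //; exact: conn_sym.
Qed.

Lemma good_ends_conn W w c x y : good W w c -> ends w c x y ->
  ~ conn W w (predC1 c) x y.
Proof.
by move=> [_ _ _ nc] [[<- <-]//|[<- <-]] /conn_sym.
Qed.

Lemma good_adj W w c ok x y : good W w c -> ok c -> ends w c x y -> adj W w ok x y.
Proof. by move=> [cm cW tW _] okc e; apply/adjP; exists c. Qed.

Lemma good_uniq W w c c' x y : good W w c -> good W w c' ->
  ends w c x y -> ends w c' x y -> c = c'.
Proof.
move=> gc gc' e e'; apply: contrapT => /eqP cc'.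
apply: (good_ends_conn gc e); apply: adj_conn; apply: good_adj gc' _ e'.
by rewrite /= eq_sym.
Qed.

(** After its last passage through [c] the path avoids [c], and there it stands at an end of [c]. *)
Lemma conn_split W w c x y r : ends w c x y -> conn W w predT x r ->
  conn W w (predC1 c) x r \/ conn W w (predC1 c) y r.
Proof.
move=> e [p px pr].
have gen : forall z, path (adj W w predT) z p -> last z p = r ->
    conn W w (predC1 c) z r \/ (conn W w (predC1 c) x r \/ conn W w (predC1 c) y r);
  last by case: (gen x px pr); [left|].
elim: p {px pr} => [|z' p IH] z /=.
  by move=> _ ->; left; exact: conn_refl.
move=> /andP[/adjP[c' [c'm _ c'W tW e']] zp] pr.
have [h|h] := IH _ zp pr; last by right.
have [cc'|cc'] := eqVneq c' c.
  right; rewrite {}cc' in e'.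
  have [z'x|z'y] : z' = x \/ z' = y.
    by case: e e' => [[<- <-]|[<- <-]] [[? ?]|[? ?]]; [right|left|left|right].
    by left; rewrite -z'x.
  by right; rewrite -z'y.
left; apply: conn_trans h; apply: adj_conn; apply/adjP.
by exists c'.
Qed.

(** Without the bridge, one end still reaches the root by [conn_split]; both cannot, as this would
    reconnect them. *)
Lemma parent_orient W w x y : edge W w x y ->
  (parent W w x y /\ ~ parent W w y x) \/ (parent W w y x /\ ~ parent W w x y).
Proof.
move=> [c gc e]; have e' := ends_sym e.
have xW : x \in W by case: (edge_in (ex_intro2 _ _ c gc e)).
have xy : conn W w predT x y by apply: adj_conn; exact: good_adj gc _ e.
have rxy := root_of_eq xy.
have parE a b : ends w c a b -> parent W w a b -> conn W w (predC1 c) b (root_of W w a).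
  by move=> eab [c' [gc' e1 h]]; rewrite (good_uniq gc gc' eab e1).
have nconn (r : G) : conn W w (predC1 c) x r -> conn W w (predC1 c) y r -> False.
  move=> h1 h2; apply: (good_ends_conn gc e); apply: conn_trans h1 _.
  exact: conn_sym.
have [h|h] := conn_split e (root_of_conn w xW).
  right; split; first by exists c; split=> //; rewrite -rxy.
  by move=> /(parE _ _ e); exact: nconn h.
left; split; first by exists c.
by move=> /(parE _ _ e'); rewrite -rxy => h'; exact: nconn h' h.
Qed.

(** A path that uses [c'] visits its end [x]; otherwise it avoids [c'] altogether. *)
Lemma conn_avoid W w c c' x y y' r : ends w c' x y' ->
  conn W w (predC1 c) y r ->
  conn W w (predC1 c) y x \/ conn W w (predC1 c') y r.
Proof.
move=> e' [p + <-]; elim: p y => [|z p IH] y /=.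
  by move=> _; right; exact: conn_refl.
move=> /andP[yz zp]; have [h|h] := IH _ zp.
  by left; apply: conn_trans h; exact: adj_conn.
have /adjP[d [dm dc dW tW e]] := yz.
have [dc'|dc'] := eqVneq d c'; last first.
  right; apply: conn_trans h; apply: adj_conn; apply/adjP.
  by exists d.
rewrite {}dc' in e; left.
have [yx|zx] : y = x \/ z = x.
  by case: e e' => [[<- <-]|[<- <-]] [[? ?]|[? ?]]; [left|right|right|left].
  by rewrite yx; exact: conn_refl.
by rewrite -zx; exact: adj_conn.
Qed.

(** Let [c] and [c'] be two bridges from [x] towards the root. By [conn_avoid] either [y] returns to
    [x] without [c], which puts [c] on a cycle, or it reaches the root without [c']; in the second
    case [x], [y], the root and [y'] are joined without [c'], which puts [c'] on a cycle. *)
Lemma parent_uniq W w x y y' : parent W w x y -> parent W w x y' -> y = y'.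
Proof.
move=> [c [gc e h]] [c' [gc' e' h']]; apply: contrapT => yy'.
have cc' : c != c'.
  apply/eqP => cc'; apply: yy'; rewrite cc' in e.
  by case: e e' => [[<- <-]|[<- <-]] [[? ?]|[? ?]] //; congruence.
have [h1|h1] := conn_avoid e' h.
  by apply: (good_ends_conn gc e); exact: conn_sym.
apply: (good_ends_conn gc' e').
have xy : conn W w (predC1 c') x y by apply: adj_conn; exact: good_adj gc _ e.
apply: conn_trans xy _; apply: conn_trans h1 _; exact: conn_sym.
Qed.

(** A smaller window has fewer paths that could close a cycle. Hence edges between two fixed
    vertices can only disappear as the window grows. *)
Lemma good_sub W W' w c : (W `<=` W')%fset -> c.1 \in W -> target w c \in W ->
  good W' w c -> good W w c.
Proof.
move=> WW' cW tW [cm _ _ nc]; split=> // h; apply: nc.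
by apply: conn_sub h.
Qed.

Lemma edge_sub W W' w x y : (W `<=` W')%fset -> x \in W -> y \in W ->
  edge W' w x y -> edge W w x y.
Proof.
move=> WW' xW yW [c gc e]; exists c => //.
by apply: good_sub gc => //; case: e => [[e1 e2]|[e1 e2]]; rewrite ?e1 ?e2.
Qed.

Definition translate g w : Om := fun d : G * nat * nat =>
  w ((g^-1 * d.1.1)%g, d.1.2, d.2).

Definition fset_translate g W : {fset G} := [fset (g * x)%g | x in W]%fset.

Lemma in_fset_translate g W x : ((g * x)%g \in fset_translate g W) = (x \in W).
Proof.
apply/imfsetP/idP => [[y /= yW /mulgI ->//]|xW].
by exists x.
Qed.

Lemma translateK g w : translate g^-1%g (translate g w) = w.
Proof.
apply/funext => -[[x j] i]; rewrite /translate/= invgK mulKg//.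
Qed.

Lemma fset_translateK g W : fset_translate g^-1%g (fset_translate g W) = W.
Proof.
apply/fsetP => x; rewrite -{1}(mulKg g x) in_fset_translate.
exact: in_fset_translate.
Qed.

Lemma target_translate g w x j :
  target (translate g w) ((g * x)%g, j) = (g * target w (x, j))%g.
Proof.
rewrite /target /= mulgA; congr (_ * eval_word _)%g; apply: eq_map => i.
by rewrite /translate/= mulKg.
Qed.

Let tl g c : G * nat := ((g * c.1)%g, c.2).

Lemma ends_translate g w c x y :
  ends w c x y -> ends (translate g w) (tl g c) (g * x)%g (g * y)%g.
Proof.
case: c => z j; rewrite /ends /tl/= target_translate.
by move=> [[-> ->]|[-> ->]]; [left|right].
Qed.

Lemma conn_translate g W w ok ok' x y : (forall c, ok c -> ok' (tl g c)) ->
  conn W w ok x y ->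
  conn (fset_translate g W) (translate g w) ok' (g * x)%g (g * y)%g.
Proof.
move=> okk [p + <-]; elim: p x => [|z p IH] x /=; first by move=> _; exact: conn_refl.
move=> /andP[/adjP[c [cm okc cW tW e]] zp].
apply: conn_trans (IH _ zp); apply: adj_conn; apply/adjP; exists (tl g c).
split=> //; [exact: okk| | |exact: ends_translate].
- by rewrite in_fset_translate.
- by case: c cm okc cW tW e => a j *; rewrite target_translate in_fset_translate.
Qed.

Lemma good_translate g W w c : good W w c ->
  good (fset_translate g W) (translate g w) (tl g c).
Proof.
case: c => z j [/= jm zW tW nc]; split=> //=; rewrite ?target_translate ?in_fset_translate//.
move=> /(@conn_translate g^-1%g _ _ _ (predC1 (z, j))) h; apply: nc.
rewrite fset_translateK translateK !mulKg in h; apply: h => -[a i] /= nai.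
apply: contra nai => /eqP[ag ->]; rewrite /tl -ag mulVKg//.
Qed.

Lemma edge_translate g W w x y : edge W w x y ->
  edge (fset_translate g W) (translate g w) (g * x)%g (g * y)%g.
Proof.
by move=> [c gc e]; exists (tl g c); [exact: good_translate|exact: ends_translate].
Qed.

Lemma edge_translateE g W w x y :
  edge (fset_translate g W) (translate g w) (g * x)%g (g * y)%g <-> edge W w x y.
Proof.
split=> [/(edge_translate g^-1%g)|]; last exact: edge_translate.
by rewrite fset_translateK translateK !mulKg.
Qed.

(** * Inside a window everything depends on finitely many labels *)

Definition coords W : seq (G * nat * nat) :=
  [seq (xj.1, xj.2, i) | xj <- [seq (x, j) | x <- enum_fset W, j <- iota 0 m],
                         i <- iota 0 k].

Lemma mem_coords W x j i :
  ((x, j, i) \in coords W) = [&& x \in W, (j < m)%N & (i < k)%N].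
Proof.
apply/allpairsP/and3P => [[[[x' j'] i'] /= [/allpairsP[[x'' j''] /= []]]]|[xW jm ik]].
  by rewrite !mem_iota /= => xW jm [-> ->] ik [-> -> ->].
exists ((x, j), i); split=> //=; last by rewrite mem_iota.
by apply/allpairsP; exists (x, j); split=> //=; rewrite mem_iota.
Qed.

Lemma uniq_coords W : uniq (coords W).
Proof.
apply: allpairs_uniq; [|exact: iota_uniq|by move=> [[a b] c] [[a' b'] c'] _ _ [-> -> ->]].
by apply: allpairs_uniq; [exact: fset_uniq|exact: iota_uniq|move=> [a b] [a' b'] _ _ [-> ->]].
Qed.

Section Agreement.
Variables (W : {fset G}) (w w' : Om).
Hypothesis ww' : {in coords W, w =1 w'}.

Lemma word_agree c : c.1 \in W -> (c.2 < m)%N -> word w c = word w' c.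
Proof.
move=> cW cm; apply/eq_in_map => i; rewrite mem_iota /= => ik.
by apply: ww'; rewrite mem_coords cW cm ik.
Qed.

Lemma target_agree c : c.1 \in W -> (c.2 < m)%N -> target w c = target w' c.
Proof. by move=> cW cm; rewrite /target word_agree. Qed.

Lemma adj_agree ok : adj W w ok =2 adj W w' ok.
Proof.
move=> x y; rewrite /adj; case xW : (x \in W) => //=; case yW : (y \in W) => //=.
apply: eq_in_has => j; rewrite mem_iota => /= jm.
by rewrite !target_agree.
Qed.

Lemma conn_agree ok x y : conn W w ok x y <-> conn W w' ok x y.
Proof.
by split=> -[p pp pl]; exists p => //; move: pp; rewrite (eq_path (adj_agree ok)).
Qed.

Lemma good_agree c : good W w c -> good W w' c.
Proof.
move=> [cm cW]; rewrite target_agree// => tW nc; split=> // h; apply: nc.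
exact/conn_agree.
Qed.

Lemma root_agree x : root_of W w x = root_of W w' x.
Proof.
rewrite /root_of; congr head; apply: eq_filter => r.
by apply/asboolP/asboolP => /conn_agree.
Qed.

Lemma ends_agree c x y : c.1 \in W -> (c.2 < m)%N -> ends w c x y -> ends w' c x y.
Proof. by move=> cW cm; rewrite /ends target_agree. Qed.

Lemma edge_agree x y : edge W w x y -> edge W w' x y.
Proof.
move=> [c gc e]; exists c; first exact: good_agree.
by case: gc => cm cW _ _; exact: ends_agree e.
Qed.

Lemma parent_agree x y : parent W w x y -> parent W w' x y.
Proof.
move=> [c [gc e h]]; exists c; split; first exact: good_agree.
  by case: gc => cm cW _ _; exact: ends_agree e.
by rewrite -root_agree; exact/conn_agree.
Qed.

End Agreement.

End RandomGraph.

(** * Counting words and sequences of steps *)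

Section WordSums.
Variables (K : numFieldType) (J : finType).

Fixpoint wsum (n : nat) (F : seq J -> K) : K :=
  if n is n'.+1 then \sum_(t : J) wsum n' (fun w => F (t :: w)) else F [::].

Lemma wsum_ge0 n F : (forall w, 0 <= F w) -> 0 <= wsum n F.
Proof.
elim: n F => [|n IH] F F0 /=; first exact: F0.
by apply: sumr_ge0 => t _; exact: IH.
Qed.

Lemma wsum_ge_term F t : (forall w, 0 <= F w) -> F t <= wsum (size t) F.
Proof.
elim: t F => [|j t IH] F F0 //=; apply: le_trans (IH (fun w => F (j :: w)) _) _ => //.
rewrite (bigD1 j)//= lerDl; apply: sumr_ge0 => i _; exact: wsum_ge0.
Qed.

Lemma eq_wsum n F H : (forall w, F w = H w) -> wsum n F = wsum n H.
Proof. by move=> FH; congr wsum; apply/funext. Qed.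

Lemma wsumZ n a F : wsum n (fun w => a * F w) = a * wsum n F.
Proof.
elim: n F => [//|n IH] F /=.
by rewrite mulr_sumr; apply: eq_bigr => t _; rewrite IH.
Qed.

Lemma wsum_le n F H : (forall w, size w = n -> F w <= H w) -> wsum n F <= wsum n H.
Proof.
elim: n F H => [|n IH] F H FH /=; first exact: FH.
by apply: ler_sum => t _; apply: IH => w wn; apply: FH => /=; rewrite wn.
Qed.

Lemma Ex_wsum (I : choiceType) (j0 : J) (l : seq I) n (F : seq J -> (I -> J) -> K) :
  Ex j0 l (fun w => wsum n (fun t => F t w)) = wsum n (fun t => Ex j0 l (F t)).
Proof.
elim: n F => [//|n IH] F /=; rewrite Ex_sum; apply: eq_bigr => t _.
exact: (IH (fun w => F (t :: w))).
Qed.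

End WordSums.

Section StepSums.
Variables (K : numFieldType) (J : finType) (m k : nat).
Local Notation step := (bool * nat * seq J)%type.

(* A step [(b, j, t)] follows the [j]-th edge of the current vertex if [b]
   holds, and otherwise enters it backwards from the vertex that chose it; [t]
   is the word on this edge. *)
Fixpoint ssum (n : nat) (F : seq step -> K) : K :=
  if n is n'.+1 then
    \sum_(b : bool) \sum_(0 <= j < m)
      wsum k (fun t => ssum n' (fun w => F ((b, j, t) :: w)))
  else F [::].

Definition valid_steps (s : seq step) :=
  all (fun l : step => (l.1.2 < m)%N && (size l.2 == k)) s.

Lemma ssum_ge0 n F : (forall w, 0 <= F w) -> 0 <= ssum n F.
Proof.
elim: n F => [|n IH] F F0 /=; first exact: F0.
by do 2 (apply: sumr_ge0 => ? _); apply: wsum_ge0 => t; exact: IH.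
Qed.

Lemma ssum_ge_term F s : (forall w, 0 <= F w) -> valid_steps s ->
  F s <= ssum (size s) F.
Proof.
elim: s F => [|[[b j] t] s IH] F F0 //= /andP[/andP[/= jm /eqP tk] vs].
apply: le_trans (IH (fun w => F ((b, j, t) :: w)) _ vs) _ => //.
have S0 b' j' t' : 0 <= ssum (size s) (fun w => F ((b', j', t') :: w)).
  exact: ssum_ge0.
have W0 b' j' : 0 <= wsum k (fun t => ssum (size s) (fun w => F ((b', j', t) :: w))).
  exact: wsum_ge0.
rewrite [leRHS](bigD1 b)//= -[leLHS]addr0 lerD//; last first.
  by apply: sumr_ge0 => b' _; apply: sumr_ge0.
rewrite big_mkord (bigD1 (Ordinal jm))//= -[leLHS]addr0 lerD//; last first.
  exact: sumr_ge0.
rewrite -{1}tk.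
exact: (wsum_ge_term (F := fun t => ssum (size s) (fun w => F ((b, j, t) :: w)))).
Qed.

Lemma ssum_le n F H : (forall w, size w = n -> valid_steps w -> F w <= H w) ->
  ssum n F <= ssum n H.
Proof.
elim: n F H => [|n IH] F H FH /=; first exact: FH.
apply: ler_sum => b _; rewrite !big_nat; apply: ler_sum => j /andP[_ jm].
apply: wsum_le => t tk; apply: IH => w wn vw; apply: FH => /=; first by rewrite wn.
by rewrite jm tk eqxx.
Qed.

Lemma ssumZ n a F : ssum n (fun w => a * F w) = a * ssum n F.
Proof.
elim: n F => [//|n IH] F /=; rewrite mulr_sumr; apply: eq_bigr => b _.
rewrite mulr_sumr; apply: eq_bigr => j _; rewrite -wsumZ.
by apply: eq_wsum => t; exact: IH.
Qed.

Lemma Ex_ssum (I : choiceType) (j0 : J) (l : seq I) n (F : seq step -> (I -> J) -> K) :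
  Ex j0 l (fun w => ssum n (fun s => F s w)) = ssum n (fun s => Ex j0 l (F s)).
Proof.
elim: n F => [//|n IH] F /=; rewrite Ex_sum; apply: eq_bigr => b _.
rewrite Ex_sum; apply: eq_bigr => j _; rewrite Ex_wsum; apply: eq_wsum => t.
exact: (IH (fun w => F ((b, j, t) :: w))).
Qed.

End StepSums.

Section ClosedSteps.
Variables (R : realType) (G : groupType) (J : finType) (ev : J -> G) (inv : J -> J).
Hypothesis invK : involutive inv.
Hypothesis ev_inv : forall j, ev (inv j) = (ev j)^-1%g.
Variables m k : nat.
Local Notation step := (bool * nat * seq J)%type.
Local Notation B := (translates ev : (G -> R) -> G -> R).
Implicit Types xi : G -> R.

Definition step_val (l : step) : G :=
  if l.1.1 then eval_word ev l.2 else (eval_word ev l.2)^-1%g.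

Definition steps_val (s : seq step) : G := foldr (fun l g => step_val l * g)%g 1%g s.

Lemma iter_translates_sum n (F : J -> G -> R) :
  iter n B (fun x => \sum_t F t x) = (fun x => \sum_t iter n B (F t) x).
Proof.
elim: n => [//|n IH] /=; rewrite IH; apply/funext => x.
by rewrite /translates exchange_big.
Qed.

Lemma wsum_translatesV n xi x :
  wsum n (fun t => xi ((eval_word ev t)^-1 * x)%g) = iter n B xi x.
Proof.
elim: n x => [|n IH] x /=; first by rewrite invg1 mul1g.
rewrite [RHS]/translates; apply: eq_bigr => t _; rewrite -IH.
by apply: eq_wsum => w /=; rewrite invgM mulgA.
Qed.

(** The generators are permuted by [inv], so words and their inverses contribute the same sums.
    Backward steps can therefore be counted like forward ones. *)
Lemma wsum_translates n xi x :
  wsum n (fun t => xi (eval_word ev t * x)%g) = iter n B xi x.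
Proof.
elim: n xi x => [|n IH] xi x /=; first by rewrite mul1g.
rewrite -iterS iterSr [B xi]/translates iter_translates_sum.
rewrite (reindex_inj (inv_inj invK)); apply: eq_bigr => t _ /=; rewrite -IH.
by apply: eq_wsum => w /=; rewrite ev_inv mulgA.
Qed.

(** Each step offers [2 * m] choices of direction and edge, and its word contributes [k]
    applications of [translates ev]. *)
Lemma ssum_translates n xi x :
  ssum m k n (fun s => xi ((steps_val s)^-1 * x)%g) =
  ((2 * m)%:R) ^+ n * iter (k * n) B xi x.
Proof.
elim: n xi x => [|n IH] xi x /=.
  by rewrite expr0 mul1r muln0 invg1 mul1g.
rewrite mulnS iterD.
have W b j : wsum k (fun t => ssum m k n (fun s =>
      xi ((steps_val ((b, j, t) :: s))^-1 * x)%g)) =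
    ((2 * m)%:R) ^+ n * iter k B (iter (k * n) B xi) x.
  have -> : (fun t => ssum m k n (fun s => xi ((steps_val ((b, j, t) :: s))^-1 * x)%g)) =
      (fun t => ((2 * m)%:R) ^+ n * iter (k * n) B xi ((step_val (b, j, t))^-1 * x)%g).
    apply/funext => t; rewrite -IH; congr ssum; apply/funext => s /=.
    by rewrite invgM mulgA.
  rewrite wsumZ; congr (_ * _); case: b => /=; rewrite /step_val/=.
    exact: wsum_translatesV.
  by rewrite -wsum_translates; apply: eq_wsum => t; rewrite invgK.
under eq_bigr => b _ do under eq_bigr => j _ do rewrite W.
rewrite big_bool/= sumr_const_nat subn0.
rewrite exprS natrM; set a := _ ^+ n; set b := iter k _ _ _.
by rewrite -[a * b *+ m]mulr_natl; ring.
Qed.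

Variable rho : R.
Hypothesis kest : forall n, iter n B (fun x => (x == 1%g)%:R) 1%g <= (rho * #|J|%:R) ^+ n.

Lemma ssum_closed n :
  ssum m k n (fun s => (steps_val s == 1%g)%:R) <=
  ((2 * m)%:R) ^+ n * (rho * #|J|%:R) ^+ (k * n) :> R.
Proof.
have := @ssum_translates n (fun x => (x == 1%g)%:R) 1%g.
have -> : (fun s => (((steps_val s)^-1 * 1)%g == 1%g)%:R) =
    (fun s => (steps_val s == 1%g)%:R : R).
  by apply/funext => s; rewrite mulg1 -(inj_eq invg_inj) invgK invg1.
move=> ->; rewrite ler_wpM2l ?exprn_ge0//; exact: kest.
Qed.

End ClosedSteps.

(** * An edge on a cycle starts a closed trail *)

Section BadEdges.
Variables (G : groupType) (J : finType) (ev : J -> G) (m k : nat).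
Local Notation Om := (G * nat * nat -> J).
Local Notation step := (bool * nat * seq J)%type.
Local Notation stepv := (step_val ev).
Implicit Types (W : {fset G}) (w : Om) (c : G * nat) (s : seq step).

Definition step_label (x : G) (l : step) : G * nat :=
  if l.1.1 then (x, l.1.2) else ((x * stepv l)%g, l.1.2).

Fixpoint step_labels (x : G) s : seq (G * nat) :=
  if s is l :: s' then step_label x l :: step_labels (x * stepv l)%g s' else [::].

Lemma size_step_labels x s : size (step_labels x s) = size s.
Proof. by elim: s x => //= l s IH x; rewrite IH. Qed.

(** The labels are distinct because the path is simple: all later edges have both ends among later
    vertices, while the first edge has the end [x]. *)
Lemma path_steps W w c x p : path (adj ev m k W w (predC1 c)) x p -> uniq (x :: p) ->
  exists s, [/\ size s = size p, valid_steps m k s,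
    (x * steps_val ev s)%g = last x p &
    [/\ uniq (step_labels x s), c \notin step_labels x s,
      forall c', c' \in step_labels x s ->
          [/\ c'.1 \in W, (c'.2 < m)%N, c'.1 \in x :: p & target ev k w c' \in x :: p] &
      [seq word k w c' | c' <- step_labels x s] = [seq l.2 | l <- s]]].
Proof.
elim: p x => [|y p IH] x.
  by move=> _ _; exists [::]; split=> //=; rewrite mulg1.
move=> /= /andP[/adjP[[z j] [/= jm zc zW tW e]] yp] /andP[xyp uyp].
have [s [sp vs sl [us cs sW sw]]] := IH _ yp uyp.
pose b := z == x.
pose l : step := (b, j, word k w (z, j)).
have xl : (x * stepv l)%g = y.
  rewrite /step_val /= /b; case: e => [[/= <- <-]|[/= zy tx]].
    by rewrite eqxx.
  case: eqVneq => [zx|_]; last by rewrite -tx /target/= -zy mulgK.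
  by move: xyp; rewrite -zx -zy mem_head.
have lab : step_label x l = (z, j).
  rewrite /step_label /= xl /b; case: eqVneq => [->//|zx].
  by case: e => [[/= zx']|[/= -> _]//]; rewrite zx' eqxx in zx.
exists (l :: s); split=> /=.
- by rewrite sp.
- by rewrite jm /word size_map size_iota eqxx.
- by rewrite mulgA xl.
split=> /=.
- rewrite lab xl us andbT; apply/negP => /sW[_ _ z1 z2].
  by move/negP: xyp; apply; case: e => [[/= <- _]//|[/= _ <-]//].
- by rewrite lab xl inE negb_or eq_sym zc.
- move=> c'; rewrite lab xl inE => /orP[/eqP ->|/sW[h1 h2 h3 h4]].
    by split=> //=; case: e => [[/= e1 e2]|[/= e1 e2]]; rewrite ?e2 ?e1 !inE eqxx ?orbT.
  by split=> //; rewrite inE ?h3 ?h4 orbT.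
- by rewrite lab xl /= sw.
Qed.

(* The labels on a trail are distinct edges, so that their words are
   independent. *)
Definition closed_trail W w x s :=
  [&& steps_val ev s == 1%g, uniq (step_labels x s),
      all (fun c => (c.1 \in W) && (c.2 < m)%N) (step_labels x s) &
      [seq word k w c | c <- step_labels x s] == [seq l.2 | l <- s]].

(** The edge itself, followed by a simple path that leads back to [x] without using it. The distinct
    vertices of that path bound the length by the size of the window. *)
Lemma bad_trail W w x j : x \in W -> (j < m)%N -> target ev k w (x, j) \in W ->
  ~ good ev m k W w (x, j) ->
  exists s, [/\ (0 < size s <= #|` W|)%N, valid_steps m k s & closed_trail W w x s].
Proof.
move=> xW jm tW ng.
set y := target _ _ _ _ in tW.
have /conn_sym[p0 pp0 pl0] : conn ev m k W w (predC1 (x, j)) x y.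
  by apply: contrapT => nc; apply: ng.
case/shortenP: pp0 pl0 => p pp up _ pl.
have [s [sp vs sl [us cs sW sw]]] := path_steps pp up.
have yE : (x * stepv (true, j, word k w (x, j)))%g = y by [].
have pW z : z \in y :: p -> z \in W.
  elim: p y pp {up pl sp us cs sW sw vs sl yE s} tW => [|y' p IH] y /=.
    by move=> _ yW; rewrite inE => /eqP ->.
  move=> /andP[/and3P[yW y'W _] pp] _; rewrite inE => /orP[/eqP ->//|].
  exact: IH.
exists ((true, j, word k w (x, j)) :: s); split.
- rewrite /= sp -[(size p).+1]/(size (y :: p)).
  exact: uniq_leq_size.
- by rewrite /= jm /word size_map size_iota eqxx.
- apply/and4P; split=> /=.
  + rewrite -(inj_eq (mulgI x)) mulgA yE sl pl mulg1//.
  + by rewrite /step_label/= yE cs.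
  + rewrite /step_label/= xW jm yE; apply/allP => c' /sW[-> -> _ _]//.
  + by rewrite yE sw.
Qed.

End BadEdges.

(** * An edge survives with probability at least one half *)

Section GoodEdgeProbability.
Variables (R : realType) (G : groupType) (J : finType) (ev : J -> G) (inv : J -> J).
Variables (j0 : J) (m k : nat).
Hypothesis invK : involutive inv.
Hypothesis ev_inv : forall j, ev (inv j) = (ev j)^-1%g.
Variable rho : R.
Hypothesis rho_ge0 : 0 <= rho.
Hypothesis kest : forall n,
  iter n (translates ev) (fun x => (x == 1%g)%:R) 1%g <= (rho * #|J|%:R) ^+ n.
Hypothesis small : (2 * m)%:R * rho ^+ k <= 4^-1.
Local Notation Om := (G * nat * nat -> J).
Local Notation step := (bool * nat * seq J)%type.
Implicit Types (W : {fset G}) (w : Om) (c : G * nat) (s : seq step).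

Definition trail_constraints (x : G) s : seq ((G * nat * nat) * J) :=
  zip [seq (c.1, c.2, i) | c <- step_labels ev x s, i <- iota 0 k]
      (flatten [seq l.2 | l <- s]).

Lemma size_trail x s : valid_steps m k s ->
  size [seq (c.1, c.2, i) | c <- step_labels ev x s, i <- iota 0 k] =
  size (flatten [seq l.2 | l <- s]) /\
  size (flatten [seq l.2 | l <- s]) = (k * size s)%N.
Proof.
move=> vs; have szF : size (flatten [seq l.2 | l <- s]) = (k * size s)%N.
  elim: s vs => [|l s IH] /=; first by rewrite muln0.
  by move=> /andP[/andP[_ /eqP lk] /IH h]; rewrite size_cat h lk mulnS.
by rewrite szF size_allpairs size_step_labels size_iota mulnC.
Qed.

Lemma trail_constraints_all w x s : valid_steps m k s ->
  [seq word k w c | c <- step_labels ev x s] == [seq l.2 | l <- s] ->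
  all (fun ct => w ct.1 == ct.2) (trail_constraints x s).
Proof.
move=> vs /eqP /(congr1 flatten) e; have [sz _] := size_trail x vs.
have e' : [seq w d | d <- [seq (c.1, c.2, i) | c <- step_labels ev x s, i <- iota 0 k]] =
    flatten [seq l.2 | l <- s].
  rewrite -e map_flatten -map_comp; congr flatten; apply: eq_map => c /=.
  by rewrite /word -map_comp.
rewrite /trail_constraints -e'; elim: [seq (_, _) | _ <- _, _ <- _] => //= d l ->.
by rewrite eqxx.
Qed.

(** Distinct labels occupy disjoint blocks of [k] coordinates, so a trail prescribes the values of
    [k * size s] independent letters. *)
Lemma trail_probability W x s : valid_steps m k s ->
  Ex j0 (coords m k W) (fun w => (closed_trail ev m k W w x s)%:R) <=
  (#|J|%:R^-1) ^+ (k * size s) * (steps_val ev s == 1%g)%:R :> R.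
Proof.
move=> vs; have [sz szE] := size_trail x vs.
have [nv|nv] := boolP [&& steps_val ev s == 1%g, uniq (step_labels ev x s) &
    all (fun c => (c.1 \in W) && (c.2 < m)%N) (step_labels ev x s)]; last first.
  have -> : (fun w => (closed_trail ev m k W w x s)%:R) = (fun=> 0 : R).
    apply/funext => w; rewrite /closed_trail !andbA -andbA.
    by move: nv; rewrite !andbA => /negbTE ->.
  by rewrite Ex_cst mulr_ge0// exprn_ge0// invr_ge0.
have /and3P[-> us /allP sW] := nv; rewrite mulr1.
have uz : unzip1 (trail_constraints x s) =
    [seq (c.1, c.2, i) | c <- step_labels ev x s, i <- iota 0 k].
  by rewrite /trail_constraints unzip1_zip// sz.
apply: le_trans (_ : Ex j0 (coords m k W)
    (fun w => (all (fun ct => w ct.1 == ct.2) (trail_constraints x s))%:R) <= _).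
  apply: Ex_le => w; have [/and4P[_ _ _ h]|_] := boolP (closed_trail _ _ _ _ _ _ _).
    by rewrite trail_constraints_all.
  by rewrite ler0n.
rewrite Ex_cylinder ?uniq_coords ?uz//.
- by rewrite /trail_constraints size_zip sz minnn szE.
- apply: allpairs_uniq => //; first exact: iota_uniq.
  by move=> [[a b] c] [[a' b'] c'] _ _ [-> -> ->].
- move=> _ /allpairsP[[c i] /= [cs + ->]]; rewrite mem_iota /= => ik.
  by rewrite mem_coords ik andbT; exact: sW.
Qed.

Lemma geometric_le (a : R) n : 0 <= a <= 4^-1 -> \sum_(i < n) a ^+ i.+1 <= 2^-1.
Proof.
move=> /andP[a0 a4].
(* The subtracted term makes the induction close: each new term is at most a quarter of the
   preceding power. *)
suff h : \sum_(i < n) a ^+ i.+1 <= 2^-1 - a ^+ n / 2.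
  by apply: le_trans h _; rewrite lerBlDr lerDl divr_ge0// exprn_ge0.
elim: n => [|n IH]; first by rewrite big_ord0 expr0; lra.
rewrite big_ord_recr/=.
have h1 : a * a ^+ n <= 4^-1 * a ^+ n by rewrite ler_wpM2r// exprn_ge0.
have h2 : 0 <= a ^+ n by rewrite exprn_ge0.
by rewrite exprS; lra.
Qed.

(** Union bound over closed trails. The number of closed step sequences of a given length from
    [ssum_closed], times the probability of each, is a power of [(2 * m) * rho ^ k], so the bound
    does not depend on the window. *)
Lemma bad_edge_probability W x j : x \in W -> (j < m)%N ->
  (forall t : seq J, size t = k -> (x * eval_word ev t)%g \in W) ->
  Ex j0 (coords m k W) (fun w => `[< ~ good ev m k W w (x, j) >]%:R) <= 2^-1 :> R.
Proof.
move=> xW jm tW; set p : R := #|J|%:R.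
have p0 : 0 < p by rewrite ltr0n; apply/card_gt0P; exists j0.
pose T n w : R := ssum m k n.+1 (fun s => (closed_trail ev m k W w x s)%:R).
have T0 n w : 0 <= T n w by exact: ssum_ge0.
apply: (@le_trans _ _ (Ex j0 (coords m k W) (fun w => \sum_(n < #|` W|) T n w))).
  apply: Ex_le => w; case: asboolP => [bad|_]; last by rewrite sumr_ge0.
  have tgt : target ev k w (x, j) \in W.
    by apply: tW; rewrite size_map size_iota.
  have [s [/andP[s0 sW] vs cs]] := bad_trail xW jm tgt bad.
  have sW' : ((size s).-1 < #|` W|)%N by rewrite prednK.
  rewrite (bigD1 (Ordinal sW'))//= -[leLHS]addr0 lerD ?sumr_ge0//.
  rewrite /T prednK//; apply: le_trans (ssum_ge_term _ vs); last by [].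
  by rewrite cs.
rewrite Ex_sum; apply: (@le_trans _ _ (\sum_(n < #|` W|) ((2 * m)%:R * rho ^+ k) ^+ n.+1)).
  apply: ler_sum => n _; rewrite /T Ex_ssum.
  apply: (@le_trans _ _ (ssum m k n.+1 (fun s => (p^-1) ^+ (k * n.+1) *
      (steps_val ev s == 1%g)%:R))).
    by apply: ssum_le => s sn vs; rewrite -sn; exact: trail_probability.
  rewrite ssumZ.
  apply: le_trans (ler_wpM2l _ (ssum_closed invK ev_inv m k kest n.+1)) _.
    by rewrite exprn_ge0// invr_ge0 ltW.
  rewrite le_eqVlt; apply/orP; left; apply/eqP.
  rewrite -/p [RHS]exprMn -exprM exprMn exprVn mulrCA; congr (_ * _).
  by rewrite mulrCA mulVf ?mulr1// expf_neq0// gt_eqF.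
apply: geometric_le.
by rewrite small andbT mulr_ge0// exprn_ge0.
Qed.

End GoodEdgeProbability.

(** * Expectation without reference to a list of coordinates *)

Section CylinderFunctions.
Variables (I : choiceType) (J : finType) (j0 : J).
Local Notation Om := (I -> J).

Definition cylinder (T : Type) (f : Om -> T) :=
  exists l : seq I, forall w w', {in l, w =1 w'} -> f w = f w'.

Lemma cylinder_cst (T : Type) (a : T) : cylinder (fun=> a).
Proof. by exists [::]. Qed.

Lemma cylinder_comp (T U : Type) (h : T -> U) (f : Om -> T) :
  cylinder f -> cylinder (fun w => h (f w)).
Proof. by move=> [l fl]; exists l => w w' ww'; rewrite (fl w w'). Qed.

Lemma cylinder2 (T U V : Type) (h : T -> U -> V) (f : Om -> T) (g : Om -> U) :
  cylinder f -> cylinder g -> cylinder (fun w => h (f w) (g w)).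
Proof.
move=> [l fl] [l' gl]; exists (l ++ l') => w w' ww'.
rewrite (fl w w') 1?(gl w w')// => d dl; apply: ww'; rewrite mem_cat dl ?orbT//.
Qed.

Lemma cylinder_reindex (T : Type) (f : Om -> T) (s : I -> I) :
  cylinder f -> cylinder (fun w => f (w \o s)).
Proof.
move=> [l fl]; exists (map s l) => w w' ww'; apply: fl => d dl /=.
by apply: ww'; exact: map_f.
Qed.

Variable K : numFieldType.
Implicit Types (f g : Om -> K).

Lemma cylinder_big (T : Type) (op : K -> K -> K) (e : K) (r : seq T) (f : T -> Om -> K) :
  (forall i, cylinder (f i)) -> cylinder (fun w => \big[op/e]_(i <- r) f i w).
Proof.
move=> cf; elim: r => [|i r IH].
  by under eq_fun do rewrite big_nil; exact: cylinder_cst.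
under eq_fun do rewrite big_cons.
exact: cylinder2.
Qed.

(* The value on functions that depend on infinitely many coordinates is junk. *)
Definition Ecyl f : K :=
  if pselect (cylinder f) is left h then Ex j0 (undup (projT1 (cid h))) f else 0.

Lemma EcylE l f : uniq l -> depends_on l f -> Ecyl f = Ex j0 l f.
Proof.
move=> ul fl; rewrite /Ecyl; case: pselect => [h|[]]; last by exists l.
case: cid => l' /= fl'; have fu : depends_on (undup l') f.
  by move=> w w' ww'; apply: fl' => d dl; apply: ww'; rewrite mem_undup.
rewrite -(@Ex_depends _ _ _ j0 l (undup (l ++ l')))//; last first.
- by move=> d dl; rewrite mem_undup mem_cat dl.
- exact: undup_uniq.
rewrite -(@Ex_depends _ _ _ j0 (undup l') (undup (l ++ l')))//.
- exact: undup_uniq.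
- exact: undup_uniq.
- by move=> d; rewrite !mem_undup mem_cat => ->; rewrite orbT.
Qed.

Lemma cylinder_uniq f : cylinder f -> exists l, uniq l /\ depends_on l f.
Proof.
move=> [l fl]; exists (undup l); split; first exact: undup_uniq.
by move=> w w' ww'; apply: fl => d dl; apply: ww'; rewrite mem_undup.
Qed.

Lemma cylinder_uniq2 f g : cylinder f -> cylinder g ->
  exists l, [/\ uniq l, depends_on l f & depends_on l g].
Proof.
move=> [l fl] [l' gl]; exists (undup (l ++ l')); split; first exact: undup_uniq.
  by move=> w w' ww'; apply: fl => d dl; apply: ww'; rewrite mem_undup mem_cat dl.
by move=> w w' ww'; apply: gl => d dl; apply: ww'; rewrite mem_undup mem_cat dl orbT.
Qed.

Lemma Ecyl_lin a f g : cylinder f -> cylinder g ->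
  Ecyl (fun w => a * f w + g w) = a * Ecyl f + Ecyl g.
Proof.
move=> cf cg; have [l [ul fl gl]] := cylinder_uniq2 cf cg.
rewrite (EcylE ul fl) (EcylE ul gl) -Ex_lin; apply: EcylE => // w w' ww'.
by rewrite (fl w w')// (gl w w').
Qed.

Lemma Ecyl_cst a : Ecyl (fun=> a) = a.
Proof. by rewrite (@EcylE [::])// Ex_cst. Qed.

Lemma Ecyl_le f g : cylinder f -> cylinder g -> (forall w, f w <= g w) ->
  Ecyl f <= Ecyl g.
Proof.
move=> cf cg fg; have [l [ul fl gl]] := cylinder_uniq2 cf cg.
by rewrite (EcylE ul fl) (EcylE ul gl); exact: Ex_le.
Qed.

Lemma Ecyl_ge0 f : cylinder f -> (forall w, 0 <= f w) -> 0 <= Ecyl f.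
Proof.
move=> cf f0; rewrite -[0]Ecyl_cst; apply: Ecyl_le => //; exact: cylinder_cst.
Qed.

Lemma EcylD f g : cylinder f -> cylinder g ->
  Ecyl (fun w => f w + g w) = Ecyl f + Ecyl g.
Proof.
move=> cf cg; have := Ecyl_lin 1 cf cg; rewrite mul1r => <-.
by congr Ecyl; apply/funext => w; rewrite mul1r.
Qed.

Lemma EcylB f g : cylinder f -> cylinder g ->
  Ecyl (fun w => f w - g w) = Ecyl f - Ecyl g.
Proof.
move=> cf cg; rewrite addrC -mulN1r -Ecyl_lin//; congr Ecyl; apply/funext => w.
by rewrite mulN1r addrC.
Qed.

Lemma Ecyl_sum (T : Type) (r : seq T) (f : T -> Om -> K) :
  (forall i, cylinder (f i)) ->
  Ecyl (fun w => \sum_(i <- r) f i w) = \sum_(i <- r) Ecyl (f i).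
Proof.
move=> cf; elim: r => [|i r IH].
  by rewrite big_nil; under eq_fun do rewrite big_nil; rewrite Ecyl_cst.
rewrite big_cons -IH -EcylD//; last exact: cylinder_big.
by congr Ecyl; apply/funext => w; rewrite big_cons.
Qed.

Lemma Ecyl_reindex (s : I -> I) f : injective s -> cylinder f ->
  Ecyl (fun w => f (w \o s)) = Ecyl f.
Proof.
move=> sI /cylinder_uniq[l [ul fl]]; rewrite (EcylE ul fl) -(Ex_reindex _ _ _ sI).
apply: EcylE; first by rewrite map_inj_uniq.
by move=> w w' ww'; apply: fl => d dl /=; apply: ww'; exact: map_f.
Qed.

End CylinderFunctions.

Section ComplexCylinders.
Variables (R : realType) (I : choiceType) (J : finType) (j0 : J).
Local Notation C := R[i].
Local Notation Om := (I -> J).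

Lemma Ecyl_real (f : Om -> R) : cylinder f ->
  Ecyl j0 (fun w => (f w)%:C%C) = (Ecyl j0 f)%:C%C.
Proof.
move=> /cylinder_uniq[l [ul fl]]; rewrite (EcylE j0 ul fl) -Ex_real.
by apply: EcylE => // w w' ww'; rewrite (fl w w').
Qed.

Lemma cabs_Ecyl (f : Om -> C) : cylinder f ->
  cabs (Ecyl j0 f) <= Ecyl j0 (fun w => cabs (f w)).
Proof.
move=> cf; have [l [ul fl]] := cylinder_uniq cf.
rewrite (EcylE j0 ul fl) (EcylE j0 ul); last first.
  by move=> w w' ww'; rewrite (fl w w').
rewrite -lecR -cabsE -Ex_real; apply: le_trans (Ex_norm_le _ _ _) _.
by apply: Ex_le => w; rewrite cabsE.
Qed.

Lemma Ecyl_conj (f : Om -> C) : cylinder f ->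
  Ecyl j0 (fun w => (f w)^*%C) = ((Ecyl j0 f)^*)%C.
Proof.
move=> cf; have [l [ul fl]] := cylinder_uniq cf.
rewrite (EcylE j0 ul fl) (@EcylE _ _ _ _ l)//; last first.
  by move=> w w' ww'; rewrite (fl w w').
elim: l {cf ul fl} f => [//|c l IH] f /=; rewrite -IH; congr Ex.
apply/funext => w; rewrite /avg rmorphM rmorph_sum fmorphV; congr (_^-1 * _).
by rewrite rmorph_nat.
Qed.

End ComplexCylinders.

(** * Weighted sums over windows *)

Section FsetSums.
Variables (K : numDomainType) (I : choiceType).

Lemma fset_sum_support (V : nmodType) (S W : {fset I}) (f : I -> V) : (S `<=` W)%fset ->
  (forall x, x \notin S -> f x = 0) -> \sum_(x <- W) f x = \sum_(x <- S) f x.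
Proof. by move=> SW fS; rewrite (big_fset_incl _ SW)// => x _; exact: fS. Qed.

Lemma fset_sum_le (S W : {fset I}) (f : I -> K) : (forall x, 0 <= f x) ->
  (forall x, x \notin S -> f x = 0) -> \sum_(x <- W) f x <= \sum_(x <- S) f x.
Proof.
move=> f0 fS; rewrite -(fset_sum_support (fsubsetUl S W) fS).
rewrite (big_fsetID _ (mem W) (S `|` W)%fset)/=.
have -> : [fset x in (S `|` W)%fset | x \in W]%fset = W.
  by apply/fsetP => x; rewrite !inE/= andb_orl andbb orbC; case: (x \in W); rewrite // andbF.
by rewrite lerDl sumr_ge0.
Qed.

End FsetSums.

(** * Random kernels summed over related pairs of vertices *)

Section KernelSums.
Variables (G : groupType) (J : finType) (j0 : J).
Local Notation X := (nat * G)%type.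
Local Notation Om := (G * nat * nat -> J).
Local Notation weight := ({fset X} -> Om -> X -> X -> Prop).
Implicit Types (W S : {fset X}) (w : Om) (x y : X) (g : G).

Definition shift_vertex g x : X := (x.1, (g * x.2)%g).

Lemma moveK g : cancel (shift_vertex g) (shift_vertex g^-1%g).
Proof. by move=> [m x]; rewrite /shift_vertex/= mulKg. Qed.

Lemma moveVK g : cancel (shift_vertex g^-1%g) (shift_vertex g).
Proof. by move=> [m x]; rewrite /shift_vertex/= mulVKg. Qed.

Lemma translateVK g w : translate g (translate g^-1%g w) = w.
Proof. by have := translateK g^-1%g w; rewrite invgK. Qed.

Definition move_fset g W : {fset X} := [fset shift_vertex g x | x in W]%fset.

Lemma in_move_fset g W x : (shift_vertex g x \in move_fset g W) = (x \in W).
Proof.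
apply/imfsetP/idP => [[y /= yW /(can_inj (moveK g)) ->//]|xW].
by exists x.
Qed.

Section Ring.
Variable K : numFieldType.
Implicit Types (r : weight) (Phi Psi : X -> X -> Om -> K).

Definition cylinder_weight r := forall W x y, cylinder (fun w => r W w x y).

Definition supported S Phi := forall x y w, Phi x y w != 0 -> x \in S /\ y \in S.

Definition finite_kernel Phi :=
  (exists S, supported S Phi) /\ forall x y, cylinder (Phi x y).

Definition kterm r W Phi x y : K := Ecyl j0 (fun w => `[< r W w x y >]%:R * Phi x y w).

Definition ksum r W Phi : K := \sum_(x <- W) \sum_(y <- W) kterm r W Phi x y.

Lemma cylinder_kterm r W Phi x y : cylinder_weight r -> cylinder (Phi x y) ->
  cylinder (fun w => `[< r W w x y >]%:R * Phi x y w).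
Proof.
move=> cr cP; apply: cylinder2 => //.
by apply: (cylinder_comp (fun P : Prop => `[< P >]%:R)).
Qed.

Lemma ksum_lin r W a Phi Psi : cylinder_weight r ->
  (forall x y, cylinder (Phi x y)) -> (forall x y, cylinder (Psi x y)) ->
  ksum r W (fun x y w => a * Phi x y w + Psi x y w) = a * ksum r W Phi + ksum r W Psi.
Proof.
move=> cr cP cQ; rewrite /ksum mulr_sumr -big_split/=; apply: eq_bigr => x _.
rewrite mulr_sumr -big_split/=; apply: eq_bigr => y _.
rewrite /kterm -Ecyl_lin; [|exact: cylinder_kterm..].
by congr Ecyl; apply/funext => w; rewrite mulrDr mulrCA.
Qed.

Lemma ksum_split r r1 r2 W Phi :
  cylinder_weight r -> cylinder_weight r1 -> cylinder_weight r2 ->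
  (forall x y, cylinder (Phi x y)) ->
  (forall w x y, `[< r W w x y >]%:R = `[< r1 W w x y >]%:R + `[< r2 W w x y >]%:R :> K) ->
  ksum r W Phi = ksum r1 W Phi + ksum r2 W Phi.
Proof.
move=> cr c1 c2 cP h; rewrite /ksum -big_split/=; apply: eq_bigr => x _.
rewrite -big_split/=; apply: eq_bigr => y _.
rewrite /kterm -EcylD; [|exact: cylinder_kterm..].
by congr Ecyl; apply/funext => w; rewrite h mulrDl.
Qed.

Definition flip r : weight := fun W w x y => r W w y x.

Lemma ksum_flip r W Phi : ksum (flip r) W Phi = ksum r W (fun x y => Phi y x).
Proof. by rewrite /ksum exchange_big. Qed.

Lemma kterm_support r W S Phi x y : supported S Phi -> kterm r W Phi x y != 0 ->
  x \in S /\ y \in S.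
Proof.
move=> sP; apply: contra_neqP => nxy; rewrite /kterm.
have -> : (fun w => `[< r W w x y >]%:R * Phi x y w) = (fun=> 0); last exact: Ecyl_cst.
apply/funext => w; have [->|/sP//] := eqVneq (Phi x y w) 0; rewrite mulr0//.
Qed.

Lemma ksum_support r W S Phi : supported S Phi -> (S `<=` W)%fset ->
  ksum r W Phi = \sum_(x <- S) \sum_(y <- S) kterm r W Phi x y.
Proof.
move=> sP SW; rewrite /ksum.
have z x y : (x \notin S) || (y \notin S) -> kterm r W Phi x y = 0.
  move=> nxy; apply/eqP; apply: contraT => /(kterm_support sP)[xS yS].
  by rewrite xS yS in nxy.
rewrite (fset_sum_support SW) => [|x xS]; last first.
  by rewrite big1// => y _; rewrite z ?xS.
apply: eq_bigr => x _; rewrite (fset_sum_support SW)// => y yS.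
by rewrite z ?yS ?orbT.
Qed.

Definition kmove g Phi : X -> X -> Om -> K := fun x y w =>
  Phi (shift_vertex g^-1%g x) (shift_vertex g^-1%g y) (translate g^-1%g w).

Definition equivariant r := forall g W w x y,
  r (move_fset g W) (translate g w) (shift_vertex g x) (shift_vertex g y) <-> r W w x y.

Lemma Ecyl_translate g (f : Om -> K) : cylinder f ->
  Ecyl j0 (fun w => f (translate g w)) = Ecyl j0 f.
Proof.
pose s (d : G * nat * nat) := ((g^-1 * d.1.1)%g, d.1.2, d.2).
have sI : injective s by move=> [[a b] c] [[a' b'] c'] [/mulgI -> -> ->].
exact: (Ecyl_reindex j0 sI).
Qed.

Lemma ksum_move g r W Phi : cylinder_weight r -> equivariant r ->
  (forall x y, cylinder (Phi x y)) ->
  ksum r (move_fset g W) (kmove g Phi) = ksum r W Phi.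
Proof.
move=> cr er cP; have mI : injective (shift_vertex g) := can_inj (moveK g).
rewrite /ksum big_imfset/=; last by move=> ? ? _ _; exact: mI.
apply: eq_bigr => x _; rewrite big_imfset/=; last by move=> ? ? _ _; exact: mI.
apply: eq_bigr => y _; rewrite /kterm -[RHS](Ecyl_translate g^-1%g); last first.
  exact: cylinder_kterm.
congr Ecyl; apply/funext => w; rewrite /kmove !moveK; congr (_%:R * _).
have := er g W (translate g^-1%g w) x y; rewrite translateVK => e.
by congr nat_of_bool; apply/asboolP/asboolP => /e.
Qed.

Lemma cylinder_translate (T : Type) g (f : Om -> T) : cylinder f ->
  cylinder (fun w => f (translate g w)).
Proof.
exact: (cylinder_reindex (fun d : G * nat * nat => ((g^-1 * d.1.1)%g, d.1.2, d.2))).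
Qed.

Lemma finite_kernel_move g Phi : finite_kernel Phi -> finite_kernel (kmove g Phi).
Proof.
move=> [[S sP] cP]; split; last by move=> x y; exact: cylinder_translate.
exists (move_fset g S) => x y w /sP.
by rewrite -{2}(moveVK g x) -{2}(moveVK g y) !in_move_fset.
Qed.

End Ring.

Section Complex.
Variable R : realType.
Local Notation C := R[i].
Implicit Types (r : weight) (Phi Psi : X -> X -> Om -> C).

Definition kabs Phi : X -> X -> Om -> R := fun x y w => cabs (Phi x y w).

Lemma cabs_ksum r W Phi : cylinder_weight r -> (forall x y, cylinder (Phi x y)) ->
  cabs (ksum r W Phi) <= ksum r W (kabs Phi).
Proof.
move=> cr cP; rewrite /ksum; apply: le_trans (cabs_sum _ _ _) _.
apply: ler_sum => x _; apply: le_trans (cabs_sum _ _ _) _.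
apply: ler_sum => y _; apply: le_trans (cabs_Ecyl _ _) _.
  exact: cylinder_kterm.
rewrite le_eqVlt; apply/orP; left; apply/eqP; congr Ecyl; apply/funext => w; rewrite cabsM /kabs; congr (_ * _).
by case: asbool; rewrite /= ?cabs1 ?cabs0.
Qed.

Lemma kabs_finite Phi : finite_kernel Phi -> finite_kernel (kabs Phi).
Proof.
move=> [[S sP] cP]; split.
  by exists S => x y w; rewrite /kabs cabs_eq0; exact: sP.
by move=> x y; exact: cylinder_comp.
Qed.

Lemma kterm_le r W (Phi : X -> X -> Om -> R) x y : cylinder_weight r ->
  (forall x y, cylinder (Phi x y)) -> (forall x y w, 0 <= Phi x y w) ->
  0 <= kterm r W Phi x y <= Ecyl j0 (Phi x y).
Proof.
move=> cr cP P0; rewrite /kterm; apply/andP; split.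
  by apply: Ecyl_ge0 => [|w]; [exact: cylinder_kterm|rewrite mulr_ge0].
apply: Ecyl_le => // [|w]; first exact: cylinder_kterm.
by rewrite ler_piMl// lern1 leq_b1.
Qed.

Lemma ksum_cbounded r Phi : cylinder_weight r -> finite_kernel Phi ->
  cbounded (fun W => ksum r W Phi).
Proof.
move=> cr fP; have [[S sP] cP] := kabs_finite fP.
have h x y W := kterm_le W x y cr cP (fun x y w => cabs_ge0 (Phi x y w)).
exists (\sum_(x <- S) \sum_(y <- S) Ecyl j0 (kabs Phi x y)) => W.
apply: le_trans (cabs_ksum _ cr fP.2) _; rewrite /ksum.
have z x y : (x \notin S) || (y \notin S) -> kterm r W (kabs Phi) x y = 0.
  move=> nxy; apply/eqP; apply: contraT => /(kterm_support sP)[xS yS].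
  by rewrite xS yS in nxy.
apply: (@le_trans _ _ (\sum_(x <- S) \sum_(y <- W) kterm r W (kabs Phi) x y)).
  apply: fset_sum_le => x; first by apply: sumr_ge0 => y _; have /andP[] := h x y W.
  by move=> xS; rewrite big1// => y _; rewrite z ?xS.
apply: ler_sum => x _.
apply: (@le_trans _ _ (\sum_(y <- S) kterm r W (kabs Phi) x y)).
  apply: fset_sum_le => y; first by have /andP[] := h x y W.
  by move=> yS; rewrite z ?yS ?orbT.
by apply: ler_sum => y _; have /andP[] := h x y W.
Qed.

Variable U : set_system {fset X}.
Hypothesis UU : UltraFilter U.
Hypothesis Usup : forall d (A : set {fset X}), (forall e, (d `<=` e)%fset -> A e) -> U A.

Definition kernel_lim r Phi : C := culim U (fun W => ksum r W Phi).

Lemma klim_lin r a Phi Psi : cylinder_weight r -> finite_kernel Phi -> finite_kernel Psi ->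
  kernel_lim r (fun x y w => a * Phi x y w + Psi x y w) = a * kernel_lim r Phi + kernel_lim r Psi.
Proof.
move=> cr fP fQ; rewrite /kernel_lim.
have -> : (fun W => ksum r W (fun x y w => a * Phi x y w + Psi x y w)) =
    (fun W => a * ksum r W Phi + ksum r W Psi).
  by apply/funext => W; apply: ksum_lin => //; [exact: fP.2|exact: fQ.2].
have bP := ksum_cbounded cr fP; have bQ := ksum_cbounded cr fQ.
by rewrite (culimD UU)// ?(culimZ UU)//; exact: cboundedZ.
Qed.

Lemma klim_split r r1 r2 Phi :
  cylinder_weight r -> cylinder_weight r1 -> cylinder_weight r2 -> finite_kernel Phi ->
  (forall W w x y, `[< r W w x y >]%:R = `[< r1 W w x y >]%:R + `[< r2 W w x y >]%:R :> C) ->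
  kernel_lim r Phi = kernel_lim r1 Phi + kernel_lim r2 Phi.
Proof.
move=> cr c1 c2 fP h; rewrite /kernel_lim -(culimD UU); [|exact: ksum_cbounded..].
congr culim; apply/funext => W; apply: ksum_split => //; exact: fP.2.
Qed.

Lemma klim_flip r Phi : kernel_lim (flip r) Phi = kernel_lim r (fun x y => Phi y x).
Proof. by rewrite /kernel_lim; congr culim; apply/funext => W; exact: ksum_flip. Qed.

Definition decreasing r := forall W W' w x y, (W `<=` W')%fset -> x \in W -> y \in W ->
  r W' w x y -> r W w x y.

(** For a decreasing relation the difference of the two indicators is again 0 or 1, so moduli can be
    taken inside the sum without losing the difference. *)
Lemma ksum_cauchy_sub r Phi S W W' : cylinder_weight r -> finite_kernel Phi ->
  decreasing r -> supported S Phi -> (S `<=` W)%fset -> (W `<=` W')%fset ->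
  cabs (ksum r W Phi - ksum r W' Phi) <= ksum r W (kabs Phi) - ksum r W' (kabs Phi).
Proof.
move=> cr fP dr sP SW WW'; have SW' := fsubset_trans SW WW'.
have fA := kabs_finite fP; have [_ cP] := fP; have [_ cA] := fA.
have sA : supported S (kabs Phi).
  by move=> x y w; rewrite /kabs cabs_eq0; exact: sP.
rewrite (ksum_support _ sP SW) (ksum_support _ sP SW').
rewrite (ksum_support _ sA SW) (ksum_support _ sA SW') -!sumrB !big_seq.
apply: le_trans (cabs_sum _ _ _) _; apply: ler_sum => x xS.
rewrite -!sumrB !big_seq; apply: le_trans (cabs_sum _ _ _) _; apply: ler_sum => y yS.
rewrite /kterm -!EcylB; [|exact: cylinder_kterm..].
apply: le_trans (cabs_Ecyl _ _) _; first by apply: (cylinder2 (fun a b => a - b)); exact: cylinder_kterm.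
rewrite le_eqVlt; apply/orP; left; apply/eqP; congr Ecyl; apply/funext => w; rewrite -!mulrBl cabsM /kabs; congr (_ * _).
have [rW'|_] := asboolP (r W' w x y).
  rewrite asboolT ?subrr ?cabs0//; apply: dr rW' => //; exact: (fsubsetP SW).
by rewrite !subr0; case: asbool; rewrite /= ?cabs1 ?cabs0.
Qed.

(* The sums of [kabs Phi] decrease with the window, hence are Cauchy, and they
   dominate the variation of the sums of [Phi]. *)
Lemma ksum_cauchy r Phi (eps : R) : cylinder_weight r -> finite_kernel Phi ->
  decreasing r -> 0 < eps -> exists W0, forall W W', (W0 `<=` W)%fset ->
  (W0 `<=` W')%fset -> cabs (ksum r W Phi - ksum r W' Phi) <= eps.
Proof.
move=> cr fP dr e0; have [[S sP] cP] := fP; have [_ cA] := kabs_finite fP.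
have sA : supported S (kabs Phi).
  by move=> x y w; rewrite /kabs cabs_eq0; exact: sP.
pose v W := ksum r W (kabs Phi).
pose A : set R := [set v W | W in [set W | (S `<=` W)%fset]].
have v0 W : 0 <= v W.
  apply: sumr_ge0 => x _; apply: sumr_ge0 => y _.
  by have /andP[] := kterm_le W x y cr cA (fun x y w => cabs_ge0 (Phi x y w)).
have hA : has_inf A.
  by split; [exists (v S); exists S => //=; exact: fsubset_refl|exists 0 => _ [W _ <-]].
have [_ [W0 /= SW0 <-] vW0] := inf_adherent (divr_gt0 e0 (ltr0n _ 2)) hA.
have key W : (W0 `<=` W)%fset -> cabs (ksum r W0 Phi - ksum r W Phi) <= eps / 2.
  move=> W0W; apply: le_trans (ksum_cauchy_sub cr fP dr sP SW0 W0W) _.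
  have : inf A <= v W.
    apply: ge_inf; first by case: hA.
    by exists W => //=; exact: fsubset_trans W0W.
  by rewrite -/(v W0) -/(v W); lra.
exists W0 => W W' /key h /key h'.
have -> : ksum r W Phi - ksum r W' Phi =
    (ksum r W0 Phi - ksum r W' Phi) - (ksum r W0 Phi - ksum r W Phi) by ring.
by apply: le_trans (cabsB _ _) _; lra.
Qed.

(** Moving the kernel is the same as moving the window; by [ksum_cauchy] all large windows, moved or
    not, give nearly the same sum. *)
Lemma klim_move g r Phi : cylinder_weight r -> equivariant r -> decreasing r ->
  finite_kernel Phi -> kernel_lim r (kmove g Phi) = kernel_lim r Phi.
Proof.
move=> cr er dr fP; have fQ := finite_kernel_move g fP.
have bP := ksum_cbounded cr fP; have bQ := ksum_cbounded cr fQ.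
apply/eqP; rewrite -subr_eq0 -cabs_eq0 eq_le cabs_ge0 andbT.
apply/ler_addgt0Pr => e e0; rewrite add0r.
have [W0 hW0] := ksum_cauchy cr fQ dr e0.
rewrite -mulN1r addrC /kernel_lim -(culimZ UU)// -(culimD UU)//; last exact: cboundedZ.
apply: (cabs_culim_le UU).
- exact: cboundedD (cboundedZ _ bP) bQ.
- apply: (Usup (d := (W0 `|` move_fset g^-1%g W0)%fset)) => W.
  rewrite fsubUset => /andP[W0W gW0W].
  rewrite mulN1r -(ksum_move g W cr er fP.2) addrC; apply: hW0 => //.
  apply/fsubsetP => x xW0; rewrite -(moveVK g x) in_move_fset.
  by apply: (fsubsetP gW0W); rewrite in_move_fset.
Qed.

End Complex.

End KernelSums.

(** * Forms on random functions of vertices *)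

Section KernelForms.
Variables (R : realType) (G : groupType) (J : finType) (j0 : J).
Local Notation C := R[i].
Local Notation X := (nat * G)%type.
Local Notation Om := (G * nat * nat -> J).
Local Notation weight := ({fset X} -> Om -> X -> X -> Prop).
Implicit Types (W S : {fset X}) (w : Om) (x y : X) (g : G).

(** A dense space of square-integrable random functions on vertices: the support is finite uniformly
    in the configuration, and each value depends on finitely many labels. *)
Definition vfun_pred : {pred X -> Om -> C} := fun xi => `[<
  (exists S, forall x w, xi x w != 0 -> x \in S) /\ forall x, cylinder (xi x) >].

Lemma vfun_submod : submod_closed vfun_pred.
Proof.
split=> [|a f g /asboolP[[S fS] cf] /asboolP[[T gT] cg]]; apply/asboolP; split.
- by exists fset0 => x w; rewrite eqxx.
- by move=> x; exact: cylinder_cst.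
- exists (S `|` T)%fset => x w h; rewrite inE; apply/orP.
  have [f0|/fS] := eqVneq (f x w) 0; last by left.
  have [g0|/gT] := eqVneq (g x w) 0; last by right.
  by move: h; rewrite !fctE f0 g0 scaler0 addr0 eqxx.
- by move=> x; apply: (cylinder2 (fun b c => a *: b + c)).
Qed.

HB.instance Definition _ := GRing.isSubmodClosed.Build _ _ vfun_pred vfun_submod.

Record vfun := Vfun { vval :> X -> Om -> C; vvalP : vval \in vfun_pred }.

HB.instance Definition _ := [isSub for vval].
HB.instance Definition _ := [Choice of vfun by <:].
HB.instance Definition _ := [SubChoice_isSubLmodule of vfun by <:].

Implicit Types xi eta zeta : vfun.

Lemma vfun_ext xi eta : (forall x w, xi x w = eta x w) -> xi = eta.
Proof. by move=> h; apply/val_inj/funext => x; apply/funext => w; exact: h. Qed.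

Lemma vfun_linE a xi eta x w : (a *: xi + eta) x w = a * xi x w + eta x w.
Proof. by []. Qed.

Lemma vfun_support xi : exists S, forall x w, xi x w != 0 -> x \in S.
Proof. by case: xi => f /= /asboolP[]. Qed.

Lemma vfun_cylinder xi x : cylinder (xi x).
Proof. by case: xi => f /= /asboolP[]. Qed.

Fact vact_subproof g xi :
  (fun x w => xi (shift_vertex g^-1%g x) (translate g^-1%g w)) \in vfun_pred.
Proof.
apply/asboolP; split; last by move=> x; apply: cylinder_translate; exact: vfun_cylinder.
have [S xS] := vfun_support xi; exists (move_fset g S) => x w /xS.
by rewrite -{2}(moveVK g x) in_move_fset.
Qed.
Definition vact g xi : vfun := Vfun (vact_subproof g xi).

Lemma vact1 xi : vact 1%g xi = xi.
Proof.
apply: vfun_ext => -[m x] w /=; rewrite /shift_vertex/= invg1 mul1g; congr (xi _ _).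
by apply/funext => -[[a j] i]; rewrite /translate/= invg1 mul1g.
Qed.

Lemma vactM g h xi : vact (g * h)%g xi = vact g (vact h xi).
Proof.
apply: vfun_ext => -[m x] w /=; rewrite /shift_vertex/= invgM mulgA; congr (xi _ _).
by apply/funext => -[[a j] i]; rewrite /translate/= !invgK invgM !invgK mulgA.
Qed.

Lemma vactVK g xi : vact g (vact g^-1%g xi) = xi.
Proof. by rewrite -vactM mulgV vact1. Qed.

Definition tensor xi eta : X -> X -> Om -> C := fun x y w => xi x w * ((eta y w)^*)%C.

Lemma tensor_finite xi eta : finite_kernel (tensor xi eta).
Proof.
have [S xS] := vfun_support xi; have [T eT] := vfun_support eta; split.
  exists (S `|` T)%fset => x y w; rewrite /tensor mulf_eq0 negb_or conjc_eq0 !inE.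
  by move=> /andP[/xS -> /eT ->]; rewrite orbT.
move=> x y; apply: cylinder2; first exact: vfun_cylinder.
by apply: cylinder_comp; exact: vfun_cylinder.
Qed.

Lemma kmove_tensor g xi eta : kmove g (tensor xi eta) = tensor (vact g xi) (vact g eta).
Proof. by []. Qed.

Definition diagw : weight := fun W w x y => x = y.

Lemma diagw_cylinder : cylinder_weight diagw.
Proof. by move=> W x y; exact: cylinder_cst. Qed.

Lemma diagw_equivariant : equivariant diagw.
Proof. by move=> g W w x y; split=> [/(can_inj (moveK g))|->]. Qed.

Lemma ksum_diag (K : numFieldType) W (Phi : X -> X -> Om -> K) :
  ksum j0 diagw W Phi = \sum_(x <- W) Ecyl j0 (Phi x x).
Proof.
apply: eq_big_seq => x xW; rewrite (bigD1_seq x)//=.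
rewrite big1 => [|y yx].
  by rewrite addr0 /kterm; congr Ecyl; apply/funext => w; rewrite asboolT// mul1r.
rewrite -[RHS](@Ecyl_cst (G * nat * nat)%type J j0); congr Ecyl.
by apply/funext => w; rewrite asboolF ?mul0r// => xy; rewrite xy eqxx in yx.
Qed.

Variable U : set_system {fset X}.
Hypothesis UU : UltraFilter U.
Hypothesis Usup : forall d (A : set {fset X}), (forall e, (d `<=` e)%fset -> A e) -> U A.
Local Notation klim := (kernel_lim j0 U).

Definition kform (r : weight) xi eta : C := klim r (tensor xi eta).

Lemma kform_linl r a xi eta zeta : cylinder_weight r ->
  kform r (a *: xi + eta) zeta = a * kform r xi zeta + kform r eta zeta.
Proof.
move=> cr; rewrite /kform -(klim_lin j0 UU)//; [|exact: tensor_finite..].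
congr klim; apply/funext => x; apply/funext => y; apply/funext => w.
by rewrite /tensor vfun_linE mulrDl mulrA.
Qed.

Lemma kform_linr r a xi eta zeta : cylinder_weight r ->
  kform r zeta (a *: xi + eta) = (a^*)%C * kform r zeta xi + kform r zeta eta.
Proof.
move=> cr; rewrite /kform -(klim_lin j0 UU)//; [|exact: tensor_finite..].
congr klim; apply/funext => x; apply/funext => y; apply/funext => w.
by rewrite /tensor vfun_linE rmorphD rmorphM mulrDr mulrCA.
Qed.

Lemma kform_diagE S xi eta : (forall x w, xi x w != 0 -> x \in S) ->
  kform diagw xi eta = \sum_(x <- S) Ecyl j0 (fun w => xi x w * ((eta x w)^*)%C).
Proof.
move=> xS; rewrite /kform /kernel_lim.
rewrite -[RHS](culim_cst UU); apply: (culim_near UU).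
  by exists (cabs (\sum_(x <- S) Ecyl j0 (fun w => xi x w * ((eta x w)^*)%C))).
apply: (Usup (d := S)) => W SW /=; rewrite ksum_diag.
apply: fset_sum_support => // x xnS.
rewrite -[RHS](@Ecyl_cst (G * nat * nat)%type J j0); congr Ecyl.
apply/funext => w; rewrite /tensor; have [->|/xS] := eqVneq (xi x w) 0.
  by rewrite mul0r.
by rewrite (negbTE xnS).
Qed.

Lemma tensor_cylinder xi eta x y : cylinder (tensor xi eta x y).
Proof. by have [_] := tensor_finite xi eta. Qed.

Lemma fsq_kform S xi : (forall x w, xi x w != 0 -> x \in S) ->
  fsq (kform diagw) xi = \sum_(x <- S) Ecyl j0 (fun w => cabs (xi x w) ^+ 2).
Proof.
move=> xS; rewrite /fsq (kform_diagE _ xS) (raddf_sum (@complex.Re R))/=.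
apply: eq_bigr => x _.
have -> : (fun w => xi x w * ((xi x w)^*)%C) = (fun w => (cabs (xi x w) ^+ 2)%:C%C).
  by apply/funext => w; rewrite cabs_sqrC.
rewrite Ecyl_real//.
by apply: (cylinder_comp (fun z => cabs z ^+ 2)); exact: vfun_cylinder.
Qed.

Lemma kform_diag_psd : psd_form (kform diagw).
Proof.
split=> [a x y z|x y|x].
- by apply: kform_linl; exact: diagw_cylinder.
- have [S xS] := vfun_support x; have [T yT] := vfun_support y.
  have xS' z w : x z w != 0 -> z \in (S `|` T)%fset by rewrite inE => /xS ->.
  have yT' z w : y z w != 0 -> z \in (S `|` T)%fset by rewrite inE orbC => /yT ->.
  rewrite (kform_diagE _ xS') (kform_diagE _ yT') rmorph_sum; apply: eq_bigr => z _.
  apply: etrans _ (Ecyl_conj j0 (tensor_cylinder x y z z)).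
  by congr Ecyl; apply/funext => w; rewrite rmorphM/= conjcK mulrC.
have [S xS] := vfun_support x; have := fsq_kform xS; rewrite /fsq => ->.
apply: sumr_ge0 => y _; apply: Ecyl_ge0 => [|w]; last exact: sqr_ge0.
by apply: (cylinder_comp (fun z => cabs z ^+ 2)); exact: vfun_cylinder.
Qed.

Lemma kform_diag_act g xi eta :
  kform diagw (vact g xi) (vact g eta) = kform diagw xi eta.
Proof.
rewrite /kform -kmove_tensor; apply: klim_move => //.
- exact: diagw_cylinder.
- exact: diagw_equivariant.
- exact: tensor_finite.
Qed.

Section Multiplication.
Variable c : X -> Om -> C.
Hypothesis cyl_c : forall x, cylinder (c x).

Fact vmul_subproof xi : (fun x w => c x w * xi x w) \in vfun_pred.
Proof.
apply/asboolP; split; last by move=> x; apply: cylinder2 => //; exact: vfun_cylinder.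
have [S xS] := vfun_support xi; exists S => x w; rewrite mulf_eq0 negb_or.
by move=> /andP[_ /xS].
Qed.
Definition vmul xi : vfun := Vfun (vmul_subproof xi).

End Multiplication.

Lemma cylinder_conj c : (forall x, cylinder (c x)) ->
  forall x, cylinder (fun w => ((c x w : C)^*)%C).
Proof. by move=> cc x; exact: cylinder_comp. Qed.

(** Related vertices carry the same multiplier, so it may be moved from one end to the other. This
    is how functions of the labels commute with [p]. *)
Lemma kform_vmul r c (cc : forall x, cylinder (c x)) xi eta :
  (forall W w x y, r W w x y -> c x w = c y w) ->
  kform r (vmul cc xi) eta = kform r xi (vmul (cylinder_conj cc) eta).
Proof.
move=> rc; rewrite /kform /kernel_lim; congr culim; apply/funext => W.
apply: eq_bigr => x _; apply: eq_bigr => y _; congr Ecyl; apply/funext => w.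
have [/rc e|_] := asboolP (r W w x y); last by rewrite !mul0r.
by rewrite /tensor /= rmorphM/= conjcK e; ring.
Qed.

Definition unique_target (r : weight) := forall W w x y y',
  r W w x y -> r W w x y' -> y = y'.

(** For each [x] at most one [y] contributes, and its contribution is at most the square of the
    modulus of [xi x]. *)
Lemma schur_bound r Phi xi : cylinder_weight r -> unique_target r -> finite_kernel Phi ->
  (forall x y w, cabs (Phi x y w) <= cabs (xi x w) ^+ 2) ->
  cabs (klim r Phi) <= fsq (kform diagw) xi.
Proof.
move=> cr ur fP Pxi; apply: (cabs_culim_le UU); first exact: ksum_cbounded.
have [S xS] := vfun_support xi; rewrite (fsq_kform xS).
have c2 x : cylinder (fun w => cabs (xi x w) ^+ 2).
  by apply: (cylinder_comp (fun z => cabs z ^+ 2)); exact: vfun_cylinder.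
apply: (Usup (d := S)) => W SW; apply: le_trans (cabs_ksum j0 W cr fP.2) _.
have [_ cA] := kabs_finite fP.
rewrite -(@fset_sum_support _ _ S W _ SW); last first.
  move=> x xnS; rewrite -[RHS](@Ecyl_cst (G * nat * nat)%type J j0); congr Ecyl.
  apply/funext => w; have [->|/xS] := eqVneq (xi x w) 0; last by rewrite (negbTE xnS).
  by rewrite cabs0 expr0n.
apply: ler_sum => x _; rewrite /kterm -Ecyl_sum; last by move=> y; exact: cylinder_kterm.
apply: Ecyl_le => // [|w]; first by apply: cylinder_big => y; exact: cylinder_kterm.
have one : \sum_(y <- W) `[< r W w x y >]%:R <= 1 :> R.
  have [[y0 y0W ry0]|no] := pselect (exists2 y, y \in W & r W w x y).
    rewrite (bigD1_seq y0)//=.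
    rewrite asboolT// big1 ?addr0// => y yy0; rewrite asboolF// => ry.
    by rewrite (ur _ _ _ _ _ ry ry0) eqxx in yy0.
  rewrite big_seq big1 => [|y yW]; first exact: ler01.
  by rewrite asboolF// => ry; apply: no; exists y.
apply: (@le_trans _ _ (\sum_(y <- W) `[< r W w x y >]%:R * cabs (xi x w) ^+ 2)).
  by apply: ler_sum => y _; rewrite ler_wpM2l//; exact: Pxi.
by rewrite -mulr_suml ler_piMl// sqr_ge0.
Qed.

Section Orientation.
Variables P F : weight.
Hypotheses (cP : cylinder_weight P) (cF : cylinder_weight F).
Hypothesis uP : unique_target P.
Hypothesis eF : equivariant F.
Hypothesis dF : decreasing F.
Hypothesis FP : forall W w x y,
  (F W w x y <-> P W w x y \/ P W w y x) /\ ~ (P W w x y /\ P W w y x).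

Lemma flip_cylinder : cylinder_weight (flip P).
Proof. by move=> W x y; exact: cP. Qed.

Lemma klim_orient (Phi : X -> X -> Om -> C) : finite_kernel Phi ->
  klim F Phi = klim P Phi + klim P (fun x y => Phi y x).
Proof.
move=> fP; rewrite -(klim_flip j0 U P Phi).
apply: (klim_split j0 UU cF cP flip_cylinder fP).
move=> W w x y; have [h1 h2] := FP W w x y; rewrite /flip.
have [p1|p1] := asboolP (P W w x y); have [p2|p2] := asboolP (P W w y x).
- by case: h2.
- by rewrite asboolT ?addr0//; apply/h1; left.
- by rewrite asboolT ?add0r//; apply/h1; right.
- by rewrite asboolF ?addr0// => /h1[].
Qed.

Lemma kflip_finite (K : numFieldType) (Phi : X -> X -> Om -> K) :
  finite_kernel Phi -> finite_kernel (fun x y => Phi y x).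
Proof.
move=> [[S sP] cQ]; split; last by move=> x y; exact: cQ.
by exists S => x y w /sP[].
Qed.

(** The sum of the limits for [P] and for its transpose is the limit for [F], and this does not
    change under [g]. *)
Lemma klim_commutator g (Phi : X -> X -> Om -> C) : finite_kernel Phi ->
  klim P (kmove g Phi) - klim P Phi =
  klim P (fun x y => Phi y x) - klim P (kmove g (fun x y => Phi y x)).
Proof.
move=> fP; have := klim_orient (finite_kernel_move g fP).
rewrite klim_move// klim_orient// => e.
by apply/eqP; rewrite subr_eq addrAC eq_sym subr_eq addrC e addrC.
Qed.

(* Where [|zeta_y| <= |xi_x|], uniqueness of the target bounds the sum by
   [|xi|^2].  On the complement invariance of [F] trades [P] for minus its
   transpose, and the sum is bounded by [|zeta|^2]. *)
Lemma commutator_quadratic g xi zeta :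
  cabs (klim P (kmove g (tensor xi zeta)) - klim P (tensor xi zeta)) <=
  2 * fsq (kform diagw) xi + 2 * fsq (kform diagw) zeta.
Proof.
have [[S sT] cT] := tensor_finite xi zeta.
pose big x y w := cabs (zeta y w) <= cabs (xi x w).
pose Phi1 x y w := (big x y w)%:R * tensor xi zeta x y w : C.
pose Phi2 x y w := (~~ big x y w)%:R * tensor xi zeta x y w : C.
have cb x y : cylinder (big x y).
  by apply: (cylinder2 (fun a b : C => cabs a <= cabs b)); exact: vfun_cylinder.
have f1 : finite_kernel Phi1.
  split; first by exists S => x y w; rewrite mulf_eq0 negb_or => /andP[_ /sT].
  by move=> x y; apply: (cylinder2 (fun (b : bool) (z : C) => b%:R * z)).
have f2 : finite_kernel Phi2.
  split; first by exists S => x y w; rewrite mulf_eq0 negb_or => /andP[_ /sT].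
  by move=> x y; apply: (cylinder2 (fun (b : bool) (z : C) => (~~ b)%:R * z)).
have fsq_act eta : fsq (kform diagw) (vact g eta) = fsq (kform diagw) eta.
  by rewrite /fsq kform_diag_act.
have b1 x y w : cabs (Phi1 x y w) <= cabs (xi x w) ^+ 2.
  rewrite /Phi1 /tensor /big !cabsM cabs_conj; case: (leP (cabs (zeta y w)) _) => h.
    by rewrite cabs1 mul1r expr2 ler_wpM2l ?cabs_ge0.
  by rewrite cabs0 mul0r sqr_ge0.
have b2 x y w : cabs (Phi2 x y w) <= cabs (zeta y w) ^+ 2.
  rewrite /Phi2 /tensor /big !cabsM cabs_conj; case: (leP (cabs (zeta y w)) _) => h.
    by rewrite cabs0 mul0r sqr_ge0.
  by rewrite cabs1 mul1r expr2 ler_wpM2r ?cabs_ge0 ?(ltW h).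
have s1 : cabs (klim P Phi1) <= fsq (kform diagw) xi by exact: schur_bound.
have s1' : cabs (klim P (kmove g Phi1)) <= fsq (kform diagw) xi.
  rewrite -fsq_act; apply: schur_bound => //; first exact: finite_kernel_move.
  by move=> x y w; exact: b1.
have s2 : cabs (klim P (fun x y => Phi2 y x)) <= fsq (kform diagw) zeta.
  by apply: schur_bound => //; exact: kflip_finite.
have s2' : cabs (klim P (kmove g (fun x y => Phi2 y x))) <= fsq (kform diagw) zeta.
  rewrite -fsq_act; apply: schur_bound => //.
    by apply: finite_kernel_move; exact: kflip_finite.
  by move=> x y w; exact: b2.
have e : tensor xi zeta = (fun x y w => 1 * Phi1 x y w + Phi2 x y w).
  apply/funext => x; apply/funext => y; apply/funext => w.
  by rewrite /Phi1 /Phi2; case: (big x y w); rewrite /= !mul1r ?mul0r ?addr0 ?add0r.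
have eg : kmove g (tensor xi zeta) = (fun x y w => 1 * kmove g Phi1 x y w + kmove g Phi2 x y w).
  by rewrite e.
rewrite eg e !(klim_lin j0 UU)//; [|exact: finite_kernel_move..].
rewrite !mul1r opprD addrACA (klim_commutator g f2).
apply: le_trans (cabsD _ _) _; rewrite (mulr_natl _ 2) (mulr_natl _ 2) !mulr2n.
by apply: lerD; apply: le_trans (cabsB _ _) _; exact: lerD.
Qed.

(** The quadratic estimate for [t xi] and [zeta] bounds [t D] by [2 t^2 A + 2 B]; the discriminant
    in [t] gives [D^2 <= 16 A B], whence the constant 4. *)
Lemma kform_commutator g xi eta :
  cabs (kform P (vact g xi) eta - kform P xi (vact g^-1%g eta)) <=
  4 * (fnorm (kform diagw) xi * fnorm (kform diagw) eta).
Proof.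
have hs := kform_diag_psd; set zeta := vact g^-1%g eta.
have zE : vact g zeta = eta by rewrite vactVK.
have -> : fnorm (kform diagw) eta = fnorm (kform diagw) zeta.
  by rewrite /fnorm /fsq kform_diag_act.
rewrite -zE; set D := cabs _.
pose A := fsq (kform diagw) xi; pose B := fsq (kform diagw) zeta.
have A0 : 0 <= A by exact: psd_ge0.
have B0 : 0 <= B by exact: psd_ge0.
have D0 : 0 <= D by exact: cabs_ge0.
have kZ r (a : C) (v z : vfun) : cylinder_weight r ->
    kform r (a *: v) z = a * kform r v z.
  move=> cr; have h0 : kform r 0 z = 0.
    have := kform_linl 1 0 0 z cr; rewrite scale1r addr0 mul1r.
    by move=> /eqP; rewrite -subr_eq subrr eq_sym => /eqP.
  by rewrite -[a *: v]addr0 kform_linl// h0 addr0.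
have vZ (a : C) (v : vfun) : vact g (a *: v) = a *: vact g v.
  by apply: vfun_ext.
have key t : 0 <= 2 * B + 2 * t * (- (D / 2)) + t ^+ 2 * (2 * A).
  have [t0|t0] := leP t 0.
    have h1 : 0 <= - t * D by rewrite mulr_ge0// oppr_ge0.
    have h2 : 0 <= t ^+ 2 * (2 * A) by rewrite mulr_ge0 ?sqr_ge0// mulr_ge0.
    have -> : 2 * t * - (D / 2) = - t * D by field.
    by rewrite addr_ge0// addr_ge0// mulr_ge0.
  have := commutator_quadratic g (t%:C%C *: xi) zeta.
  rewrite kmove_tensor -!/(kform _ _ _) vZ !kZ// -mulrBr cabsM cabs_real ger0_norm ?(ltW t0)//.
  rewrite (fsqZ hs) cabs_real ger0_norm ?(ltW t0)// -/D -/A -/B.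
  have -> : 2 * t * - (D / 2) = - (t * D) by field.
  by move=> h; lra.
have DAB := discriminant_le (mulr_ge0 (ler0n _ 2) B0) (mulr_ge0 (ler0n _ 2) A0) key.
rewrite /fnorm -/A -/B; clearbody D A B; rewrite -(ler_pXn2r (n := 2)) ?nnegrE ?mulr_ge0//.
rewrite !exprMn !sqr_sqrtr//.
by move: DAB; rewrite sqrrN exprMn; lra.
Qed.

End Orientation.

End KernelForms.

(** * The wreath product acting on functions of vertices and labels *)

Section ForestWeights.
Variables (G : groupType) (J : finType) (ev : J -> G) (k : nat -> nat).
Local Notation X := (nat * G)%type.
Local Notation Om := (G * nat * nat -> J).
Implicit Types (W : {fset X}) (w : Om) (x y : X) (g : G).

(* In a vertex [(m, x)] the first component is the level: a single
   representation has to contain the forests of all levels, as the bound on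
   the form that implements the derivation must not depend on [m]. *)
Definition slice m W : {fset G} := [fset x.2 | x in W & x.1 == m]%fset.

Lemma in_slice m W z : (z \in slice m W) = ((m, z) \in W).
Proof.
apply/imfsetP/idP => [[[m' z'] /= + ->]|zW].
  by rewrite !inE /= => /andP[+ /eqP <-].
by exists (m, z) => //=; rewrite !inE /= zW eqxx.
Qed.

Lemma slice_move g m W : slice m (move_fset g W) = fset_translate g (slice m W).
Proof.
apply/fsetP => z; rewrite in_slice -[z](mulVKg g).
by rewrite in_fset_translate in_slice -(in_move_fset g W).
Qed.

Lemma slice_sub m W W' : (W `<=` W')%fset -> (slice m W `<=` slice m W')%fset.
Proof. by move=> /fsubsetP s; apply/fsubsetP => z; rewrite !in_slice => /s. Qed.

Definition edgew W w x y := x.1 = y.1 /\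
  edge ev x.1 (k x.1) (slice x.1 W) w x.2 y.2.

Definition parentw W w x y := x.1 = y.1 /\
  parent ev x.1 (k x.1) (slice x.1 W) w x.2 y.2.

Lemma edgew_cylinder : cylinder_weight edgew.
Proof.
move=> W x y; exists (coords x.1 (k x.1) (slice x.1 W)) => w w' ww'.
apply/propext; rewrite /edgew; split=> -[e h]; split=> //; apply: edge_agree h => //.
by move=> d /ww'.
Qed.

Lemma parentw_cylinder : cylinder_weight parentw.
Proof.
move=> W x y; exists (coords x.1 (k x.1) (slice x.1 W)) => w w' ww'.
apply/propext; rewrite /parentw; split=> -[e h]; split=> //; apply: parent_agree h => //.
by move=> d /ww'.
Qed.

Lemma parentw_unique : unique_target parentw.
Proof.
move=> W w [m x] [m1 y] [m2 y'] [/= <- p1] [/= <- p2].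
by rewrite (parent_uniq p1 p2).
Qed.

Lemma edgew_equivariant : equivariant edgew.
Proof.
by move=> g W w x y; rewrite /edgew /= slice_move; split=> -[-> /edge_translateE].
Qed.

Lemma edgew_decreasing : decreasing edgew.
Proof.
move=> W W' w [m x] [m' y] WW' xW yW [/= mm' h]; subst m'; split=> //=.
by apply: edge_sub h; rewrite ?in_slice//; exact: slice_sub.
Qed.

Lemma edgew_orient W w x y :
  (edgew W w x y <-> parentw W w x y \/ parentw W w y x) /\
  ~ (parentw W w x y /\ parentw W w y x).
Proof.
case: x y => [m x] [m' y]; rewrite /edgew /parentw /=; split.
  split=> [[<- h]|[[<- h]|[<- h]]].
  - by case: (parent_orient h) => -[? _]; [left|right].
  - by split=> //; exact: parent_edge h.
  - by split=> //; apply: edge_sym; exact: parent_edge h.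
move=> [[<- h] [_ h']].
by case: (parent_orient (parent_edge h)) => -[].
Qed.

Lemma parentw_level W w x y : parentw W w x y -> x.1 = y.1.
Proof. by case. Qed.

End ForestWeights.

Section WreathAction.
Variables (R : realType) (A G : groupType) (J : finType) (j0 : J) (k : nat -> nat).
Local Notation C := R[i].
Local Notation X := (nat * G)%type.
Local Notation Om := (G * nat * nat -> J).
Local Notation label m := {ffun 'I_m * 'I_(k m) -> J}.
Implicit Types (w : Om) (x y : X) (g h : G) (a b : restricted_power A G).
Implicit Types xi eta : vfun R G J.

Definition table m w g : label m := [ffun ji => w (g, val ji.1, val ji.2)].

Lemma table_cylinder m g : cylinder (fun w => table m w g).
Proof.
exists [seq (g, (ji : nat * nat).1, ji.2) | ji <- [seq (j, i) | j <- iota 0 m, i <- iota 0 (k m)]].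
move=> w w' ww'; apply/ffunP => -[j i]; rewrite !ffunE /=; apply: ww'.
by apply/mapP; exists (val j, val i) => //; apply/allpairsP; exists (val j, val i);
  rewrite !mem_iota /= !ltn_ord.
Qed.

Lemma table_translate m g w h : table m (translate g w) h = table m w (g^-1 * h)%g.
Proof. by apply/ffunP => ji; rewrite !ffunE. Qed.

Variable chi : forall m, label m -> A -> C.
Hypothesis chiP : forall m t, is_character (chi (m := m) t).

Lemma character1 (phi : A -> C) : is_character phi -> phi 1%g = 1.
Proof.
move=> [phiM phi1]; have := phiM 1%g 1%g; rewrite mulg1 => e.
by apply: (mulIf (cabs1_neq0 (phi1 1%g))); rewrite -e mul1r.
Qed.

(* The value [a h] acts by the character that is indexed by the labels
   at [h]. *)
Definition coef a x w : C :=
  \prod_(h <- finsupp a) chi (table x.1 w h) (rp_fun a h).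

Lemma coefE (S : {fset G}) a x w : (finsupp a `<=` S)%fset ->
  coef a x w = \prod_(h <- S) chi (table x.1 w h) (rp_fun a h).
Proof.
move=> aS; apply: big_fset_incl => // h _ ha.
by rewrite /rp_fun fsfun_dflt// (character1 (chiP _)).
Qed.

Lemma coef_cylinder a x : cylinder (coef a x).
Proof.
apply: cylinder_big => h.
by apply: (cylinder_comp (fun t => chi t (rp_fun a h))); exact: table_cylinder.
Qed.

Lemma cabs_coef a x w : cabs (coef a x w) = 1.
Proof.
rewrite /coef; elim/big_rec: _ => [|h z _ z1]; first exact: cabs1.
by rewrite cabsM z1 mulr1; case: (chiP (table x.1 w h)).
Qed.

Lemma coef1 x w : coef 1%g x w = 1.
Proof.
rewrite /coef big1// => h _; rewrite rp1; exact: character1.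
Qed.

Lemma coefM a b x w : coef (a * b)%g x w = coef a x w * coef b x w.
Proof.
pose S := (finsupp a `|` finsupp b `|` finsupp (a * b)%g)%fset.
have Sa : (finsupp a `<=` S)%fset by rewrite /S -fsetUA fsubsetUl.
have Sb : (finsupp b `<=` S)%fset.
  exact: fsubset_trans (fsubsetUr (finsupp a) _) (fsubsetUl _ _).
rewrite (coefE _ _ Sa) (coefE _ _ Sb) (@coefE S) ?fsubsetUr//.
rewrite -big_split /=; apply: eq_bigr => h _; rewrite rpM.
by case: (chiP (table x.1 w h)).
Qed.

Lemma coefV a x w : coef a^-1%g x w = ((coef a x w)^*)%C.
Proof.
have c0 : coef a x w != 0 by rewrite cabs1_neq0// cabs_coef.
apply: (mulfI c0); rewrite -coefM mulgV coef1 -cabs_sqrC cabs_coef expr1n.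
by [].
Qed.

(** Translating the labels compensates for translating [a]; this makes [wact] multiplicative. *)
Lemma coef_shift g a x w :
  coef (shift g a) x w = coef a (shift_vertex g^-1%g x) (translate g^-1%g w).
Proof.
pose S := (finsupp a `|` fset_translate g^-1%g (finsupp (shift g a)))%fset.
rewrite (@coefE S a) ?fsubsetUl// (@coefE (fset_translate g S)); last first.
  apply/fsubsetP => h hs; rewrite -(mulVKg g h) in_fset_translate inE.
  by rewrite in_fset_translate hs orbT.
rewrite /fset_translate big_imfset/=; last by move=> ? ? _ _ /mulgI.
apply: eq_bigr => h _; rewrite shiftE mulKg table_translate invgK.
by [].
Qed.

Definition wact (u : wreath A G) xi : vfun R G J :=
  vmul (coef_cylinder u.1) (vact u.2 xi).

Lemma wactE u xi x w :
  wact u xi x w = coef u.1 x w * xi (shift_vertex u.2^-1%g x) (translate u.2^-1%g w).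
Proof. by []. Qed.

Lemma wact_lin u : linear (wact u).
Proof.
move=> a xi eta; apply: vfun_ext => x w; rewrite vfun_linE !wactE vfun_linE.
by rewrite mulrDr mulrCA.
Qed.

Lemma wact1 xi : wact 1%g xi = xi.
Proof.
apply: vfun_ext => x w; have -> : wact 1%g xi x w = coef 1%g x w * vact 1%g xi x w by [].
by rewrite vact1 coef1 mul1r.
Qed.

Lemma wactM u v xi : wact (u * v)%g xi = wact u (wact v xi).
Proof.
apply: vfun_ext => x w.
have -> : wact (u * v)%g xi x w = coef (u.1 * shift u.2 v.1)%g x w * vact (u.2 * v.2)%g xi x w by [].
by rewrite vactM coefM coef_shift !wactE mulrA.
Qed.

Variable U : set_system {fset X}.
Hypothesis UU : UltraFilter U.
Hypothesis Usup : forall d (B : set {fset X}), (forall e, (d `<=` e)%fset -> B e) -> U B.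
Local Notation s := (kform j0 U (@diagw G J)).

Lemma wact_unitary_coef a xi : vmul (cylinder_conj (coef_cylinder a)) (vmul (coef_cylinder a) xi) = xi.
Proof.
apply: vfun_ext => x w /=; rewrite mulrA [_ * coef _ _ _]mulrC -cabs_sqrC cabs_coef.
by rewrite expr1n mul1r.
Qed.

Lemma wact_iso u xi eta : s (wact u xi) (wact u eta) = s xi eta.
Proof.
rewrite kform_vmul; last by move=> W w x y ->.
by rewrite wact_unitary_coef kform_diag_act.
Qed.

Lemma wactV u eta :
  wact u^-1%g eta = vact u.2^-1%g (vmul (cylinder_conj (coef_cylinder u.1)) eta).
Proof.
apply: vfun_ext => x w.
have -> : wact u^-1%g eta x w = coef (shift u.2^-1 u.1^-1)%g x w * vact u.2^-1%g eta x w by [].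
by rewrite coef_shift coefV.
Qed.

Variables (ev : J -> G).
Local Notation p := (kform j0 U (parentw ev k)).

(** The multiplier of a vertex depends only on its level and on the configuration, and parents stay
    on the same level. So the part of [u] in the restricted power moves across [p], and only the
    commutator with an element of [G] remains. *)
Lemma wact_commutator u xi eta :
  cabs (p (wact u xi) eta - p xi (wact u^-1%g eta)) <= 4 * (fnorm s xi * fnorm s eta).
Proof.
rewrite wactV kform_vmul; last first.
  move=> W w x y /parentw_level e; apply: eq_bigr => h _.
  by rewrite e.
set eta' := vmul _ _.
have -> : fnorm s eta = fnorm s eta'.
  have [S eS] := vfun_support eta.
  have e'S x w : eta' x w != 0 -> x \in S by rewrite mulf_eq0 negb_or => /andP[_ /eS].
  rewrite /fnorm (fsq_kform j0 UU Usup eS) (fsq_kform j0 UU Usup e'S); congr Num.sqrt.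
  apply: eq_bigr => x _; congr Ecyl; apply/funext => w.
  by rewrite cabsM cabs_conj cabs_coef mul1r.
apply: (kform_commutator j0 UU Usup (F := edgew ev k)).
- exact: parentw_cylinder.
- exact: edgew_cylinder.
- exact: parentw_unique.
- exact: edgew_equivariant.
- exact: edgew_decreasing.
- exact: edgew_orient.
Qed.

End WreathAction.

(** * Non-amenable groups *)

Section LabelMultipliers.
Variables (R : realType) (A G : groupType) (J : finType) (k : nat -> nat).
Local Notation C := R[i].
Local Notation X := (nat * G)%type.
Local Notation Om := (G * nat * nat -> J).
Local Notation label m := {ffun 'I_m * 'I_(k m) -> J}.
Local Notation V := (vfun R G J).
Variable chi : forall m, label m -> A -> C.
Hypothesis chiP : forall m t, is_character (chi (m := m) t).
Hypothesis chi_sep : forall m (t t' : label m), t != t' -> exists a, chi t a != chi t' a.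
Variable e : V -> V -> C.
Hypothesis e_linl : forall a x y z, e (a *: x + y) z = a * e x z + e y z.
Hypothesis e_linr : forall a x y z, e z (a *: x + y) = (a^*)%C * e z x + e z y.
Hypothesis e_inv : forall u x y, e (wact chi u x) y = e x (wact chi u^-1%g y).
Variable m : nat.
Implicit Types (f h : label m -> C) (xi eta : V) (w : Om).

(** An element of the restricted power acts on different levels by characters attached to different
    tables, so identities between multipliers are confined to one level. *)
Definition onlevel xi := forall x w, x.1 != m -> xi x w = 0.

Lemma vtab_cylinder f : forall x : X, cylinder (fun w => f (table k m w 1%g)).
Proof. by move=> _; apply: cylinder_comp; exact: table_cylinder. Qed.

Definition vtab f xi : V := vmul (vtab_cylinder f) xi.

Lemma vtab_onlevel f xi : onlevel xi -> onlevel (vtab f xi).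
Proof. by move=> lx x w xm; rewrite /= lx// mulr0. Qed.

Definition adjointable f := forall xi eta, onlevel xi -> onlevel eta ->
  e (vtab f xi) eta = e xi (vtab (fun t => ((f t)^*)%C) eta).

Lemma coef_single a z w : coef chi (rp_single 1%g a) (m, z) w = chi (table k m w 1%g) a.
Proof.
rewrite (@coefE _ _ _ _ _ _ chiP [fset 1%g]%fset); last first.
  apply/fsubsetP => h; rewrite mem_finsupp inE; apply: contraNT => h1.
  by have := rp_singleE 1%g a h; rewrite (negbTE h1) /rp_fun => ->.
by rewrite big_seq_fset1/= rp_singleE eqxx.
Qed.

(** On level [m] the element of the restricted power with the single value [a] at 1 acts as this
    multiplier, and its inverse acts as the conjugate one. *)
Lemma adjointable_character a : adjointable (fun t => chi t a).
Proof.
move=> xi eta lx le; pose u : wreath A G := (rp_single 1%g a, 1%g).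
have -> : vtab (fun t => chi t a) xi = wact chi u xi.
  apply: vfun_ext => -[m' z] w.
  have -> : wact chi u xi (m', z) w = coef chi u.1 (m', z) w * vact 1%g xi (m', z) w by [].
  rewrite vact1 /=; have [->|mm'] := eqVneq m' m; first by rewrite coef_single.
  by rewrite lx// !mulr0.
rewrite e_inv (wactV chiP) /= invg1 vact1; congr e.
apply: vfun_ext => -[m' z] w /=.
have [->|mm'] := eqVneq m' m; first by rewrite coef_single.
by rewrite le// !mulr0.
Qed.

Lemma adjointable_lin a f h : adjointable f -> adjointable h ->
  adjointable (fun t => a * f t + h t).
Proof.
move=> af ah xi eta lx le.
have -> : vtab (fun t => a * f t + h t) xi = a *: vtab f xi + vtab h xi.
  by apply: vfun_ext => x w; rewrite vfun_linE /= mulrDl mulrA.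
have -> : vtab (fun t => ((a * f t + h t)^*)%C) eta =
    (a^*)%C *: vtab (fun t => ((f t)^*)%C) eta + vtab (fun t => ((h t)^*)%C) eta.
  by apply: vfun_ext => x w; rewrite vfun_linE /= rmorphD rmorphM/= mulrDl mulrA.
by rewrite e_linl e_linr conjcK af// ah.
Qed.

Lemma adjointable_mul f h : adjointable f -> adjointable h ->
  adjointable (fun t => f t * h t).
Proof.
move=> af ah xi eta lx le.
have -> : vtab (fun t => f t * h t) xi = vtab f (vtab h xi).
  by apply: vfun_ext => x w /=; rewrite mulrA.
have -> : vtab (fun t => ((f t * h t)^*)%C) eta =
    vtab (fun t => ((h t)^*)%C) (vtab (fun t => ((f t)^*)%C) eta).
  by apply: vfun_ext => x w /=; rewrite rmorphM/= mulrA [_^*%C * _^*%C]mulrC.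
by rewrite af ?ah//; exact: vtab_onlevel.
Qed.

Lemma adjointable_cst a : adjointable (fun=> a).
Proof.
move=> xi eta _ _.
have vE b z : vtab (fun=> b) z = b *: z + 0.
  by apply: vfun_ext => x w; rewrite vfun_linE /= addr0.
have e0l z : e 0 z = 0.
  have := e_linl 1 0 0 z; rewrite scale1r addr0 mul1r.
  by move=> /eqP; rewrite -subr_eq subrr eq_sym => /eqP.
have e0r z : e z 0 = 0.
  have := e_linr 1 0 0 z; rewrite scale1r addr0 rmorph1 mul1r.
  by move=> /eqP; rewrite -subr_eq subrr eq_sym => /eqP.
by rewrite !vE e_linl e_linr conjcK e0l e0r.
Qed.

(** Adjointable functions form an algebra that contains the constants and the functions [chi t a] of
    [t]; the latter separate tables, so interpolation produces the indicator of each table. *)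
Lemma adjointable_all f : adjointable f.
Proof.
have sum (r : seq (label m)) (F : label m -> label m -> C) :
    (forall i, adjointable (F i)) -> adjointable (fun t => \sum_(i <- r) F i t).
  move=> aF; elim: r => [|i r IH].
    by under eq_fun do rewrite big_nil; exact: adjointable_cst.
  under eq_fun do rewrite big_cons -[F i _]mul1r.
  exact: adjointable_lin.
have prod (r : seq (label m)) (F : label m -> label m -> C) :
    (forall i, i \in r -> adjointable (F i)) -> adjointable (fun t => \prod_(i <- r) F i t).
  elim: r => [|i r IH] aF.
    by under eq_fun do rewrite big_nil; exact: adjointable_cst.
  under eq_fun do rewrite big_cons.
  apply: adjointable_mul; first by apply: aF; rewrite mem_head.
  by apply: IH => i' i'r; apply: aF; rewrite inE i'r orbT.
have ind t0 : adjointable (fun t => (t == t0)%:R).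
  have /choice[a aP] (t' : label m) : exists a, t' != t0 -> chi t0 a != chi t' a.
    have [->|tt0] := eqVneq t' t0; first by exists 1%g.
    by have [a] := chi_sep tt0; rewrite eq_sym; exists a.
  (* An affine function of a character value that is 1 at [t0] and 0 at [t']. *)
  pose F (t' t : label m) := (chi t0 (a t') - chi t' (a t'))^-1 * chi t (a t') +
                 - (chi t' (a t') / (chi t0 (a t') - chi t' (a t'))).
  pose r := [seq t' <- enum {: label m} | t' != t0].
  have -> : (fun t => (t == t0)%:R) = (fun t => \prod_(t' <- r) F t' t).
    apply/funext => t; have [->|tt0] := eqVneq t t0.
      rewrite big_seq big1// => t'; rewrite mem_filter => /andP[/aP d _].
      have d0 : chi t0 (a t') - chi t' (a t') != 0 by rewrite subr_eq0.
      by rewrite /F mulrC -mulrBl divff.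
    have tr : t \in r by rewrite mem_filter tt0 mem_enum.
    by rewrite (big_rem t)//= /F [_^-1 * _]mulrC subrr mul0r.
  apply: prod => t' _; apply: adjointable_lin; first exact: adjointable_character.
  exact: adjointable_cst.
have -> : f = (fun t => \sum_(t' <- enum {: label m}) f t' * (t == t')%:R).
  apply/funext => t; rewrite (bigD1_seq t)/= ?mem_enum ?enum_uniq// eqxx mulr1.
  by rewrite big1 ?addr0// => t' tt'; rewrite eq_sym (negbTE tt') mulr0.
apply: sum => t'; apply: adjointable_mul; [exact: adjointable_cst|exact: ind].
Qed.

End LabelMultipliers.

Lemma sum_bool (K : pzSemiRingType) (T : Type) (s : seq T) (P : pred T) :
  \sum_(y <- s) (P y)%:R = (count P s)%:R :> K.
Proof.
elim: s => [|y s IH] /=; first by rewrite big_nil.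
by rewrite big_cons IH natrD.
Qed.

(** * The vertices chosen by 1 and those choosing 1 *)

Section Hits.
Variables (R : realType) (G : groupType) (J : finType) (j0 : J) (ev : J -> G) (k : nat -> nat).
Variable m : nat.
Local Notation C := R[i].
Local Notation X := (nat * G)%type.
Local Notation Om := (G * nat * nat -> J).
Local Notation label := {ffun 'I_m * 'I_(k m) -> J}.
Local Notation V := (vfun R G J).
Implicit Types (w : Om) (x : X) (y : G) (s : seq G) (t : label).

Definition label_value t (j : 'I_m) : G :=
  eval_word ev [seq t (j, i) | i <- enum 'I_(k m)].

Definition hit y t : bool := [exists j : 'I_m, label_value t j == y].

Lemma label_value_word w (j : 'I_m) :
  label_value (table k m w 1%g) j = eval_word ev (word (k m) w (1%g, val j)).
Proof.
rewrite /label_value /word -val_enum_ord -map_comp; congr eval_word.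
by apply: eq_map => i /=; rewrite ffunE.
Qed.

Definition word_values : {fset G} :=
  [fset eval_word ev (val t) | t in [set: (k m).-tuple J]%SET]%fset.

Lemma word_valuesP (t : seq J) : size t = k m -> eval_word ev t \in word_values.
Proof.
move=> tk; apply/imfsetP; have tk' : size t == k m by apply/eqP.
by exists (Tuple tk'); rewrite /= ?inE.
Qed.

Lemma sum_hit (Y : {fset G}) t : \sum_(y <- Y) (hit y t)%:R <= m%:R :> R.
Proof.
rewrite sum_bool ler_nat -size_filter -[m in leqRHS]size_enum_ord.
rewrite -(size_map (label_value t)); apply: uniq_leq_size.
  exact: filter_uniq.
move=> y; rewrite mem_filter => /andP[/existsP[j /eqP <-] _].
by apply: map_f; rewrite mem_enum.
Qed.

Definition hits (sg : G -> X) (F : G -> Om -> bool) s x w : bool :=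
  has (fun y => (x == sg y) && F y w) s.

Fact hits_subproof sg F (cF : forall y, cylinder (F y)) s :
  (fun x w => (hits sg F s x w)%:R : C) \in vfun_pred (J := J).
Proof.
apply/asboolP; split=> [|x].
  exists [fset sg y | y in s]%fset => x w; rewrite pnatr_eq0 eqb0 negbK.
  move=> /hasP[y ys /andP[/eqP -> _]]; exact: in_imfset.
apply: (cylinder_comp (fun b : bool => b%:R)); elim: s => [|y s IH] /=.
  exact: cylinder_cst.
exact: (cylinder2 (fun b c => (x == sg y) && b || c) (cF y) IH).
Qed.
Definition vhits sg F cF s : V := Vfun (@hits_subproof sg F cF s).

Lemma hits_cons sg F y s x w : injective sg -> uniq (y :: s) ->
  (hits sg F (y :: s) x w)%:R = ((x == sg y) && F y w)%:R + (hits sg F s x w)%:R :> C.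
Proof.
move=> sI /= /andP[ys _]; case: (boolP (_ && _)) => [/andP[/eqP -> _]|_] /=.
  rewrite (_ : hits _ _ _ _ _ = false) ?addr0//; apply/hasPn => z zs.
  by rewrite (inj_eq sI); apply: contra ys => /andP[/eqP ->].
by rewrite add0r.
Qed.

Fact vdelta_subproof (x0 : X) : (fun x (w : Om) => (x == x0)%:R : C) \in vfun_pred (J := J).
Proof.
apply/asboolP; split=> [|x]; last exact: cylinder_cst.
exists [fset x0]%fset => x w; rewrite inE.
by case: (x == x0); rewrite // eqxx.
Qed.
Definition vdelta x0 : V := Vfun (vdelta_subproof x0).

(* The indicators of the vertices that 1 chooses, and of those that choose 1. *)
Definition hits_out : V :=
  vhits (fun y => (m, y)) (F := fun y w => hit y (table k m w 1%g))
    (fun y => cylinder_comp (hit y) (table_cylinder J k m 1%g)) word_values.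

Definition hits_in : V :=
  vhits (fun y => (m, y^-1%g))
    (F := fun y w => hit y (table k m (translate y w) 1%g))
    (fun y => cylinder_translate y (cylinder_comp (hit y) (table_cylinder J k m 1%g)))
    word_values.

Section Adjoint.
Variable A : groupType.
Local Notation labels n := {ffun 'I_n * 'I_(k n) -> J}.
Variable chi : forall n, labels n -> A -> C.
Hypothesis chiP : forall n (t : labels n), is_character (chi t).
Hypothesis chi_sep : forall n (t t' : labels n), t != t' -> exists a, chi t a != chi t' a.
Variable e : V -> V -> C.
Hypothesis e_linl : forall a (x y z : V), e (a *: x + y) z = a * e x z + e y z.
Hypothesis e_linr : forall a (x y z : V), e z (a *: x + y) = (a^*)%C * e z x + e z y.
Hypothesis e_inv : forall u (x y : V), e (wact chi u x) y = e x (wact chi u^-1%g y).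

Lemma vdelta_level x0 : x0.1 = m -> onlevel m (vdelta x0).
Proof.
move=> xm x w nx /=; have [xx0|//] := eqVneq x x0.
by rewrite xx0 xm eqxx in nx.
Qed.

(** [hits_out] is the sum over [y] of the indicator of [hit y] times the translate of delta by [y].
    The real multiplier moves to the second argument by [adjointable_all], then [y] moves as [y^-1]
    by invariance, and the terms add up to [hits_in]. *)
Lemma hits_adjoint : e hits_out (vdelta (m, 1%g)) = e (vdelta (m, 1%g)) hits_in.
Proof.
rewrite /hits_out /hits_in; set c1 := (X in e (vhits _ X _) _); set c2 := (X in e _ (vhits _ X _)).
have e0l z : e 0 z = 0.
  have := e_linl 1 0 0 z; rewrite scale1r addr0 mul1r.
  by move=> /eqP; rewrite -subr_eq subrr eq_sym => /eqP.
have e0r z : e z 0 = 0.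
  have := e_linr 1 0 0 z; rewrite scale1r addr0 rmorph1 mul1r.
  by move=> /eqP; rewrite -subr_eq subrr eq_sym => /eqP.
have : uniq (enum_fset word_values) by exact: fset_uniq.
elim: (enum_fset _) => [|y s IH] us.
  have -> : vhits (fun y : G => (m, y)) c1 [::] = 0 :> V by apply: vfun_ext => x w.
  have -> : vhits (fun y : G => (m, y^-1%g)) c2 [::] = 0 :> V by apply: vfun_ext => x w.
  by rewrite e0l e0r.
have /= /andP[_ us'] := us.
pose d := vdelta (m, 1%g); pose hy t : C := (hit y t)%:R.
have ld : onlevel m d by exact: vdelta_level.
have e1 : vhits (fun y : G => (m, y)) c1 (y :: s) = 1 *: vtab hy (vact y d) + vhits (fun y : G => (m, y)) c1 s.
  apply: vfun_ext => x w; rewrite vfun_linE mul1r /= hits_cons//; last first.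
    by move=> ? ? [].
  congr (_ + _); rewrite /hy -natrM mulnb andbC; congr (_ && _)%:R.
  by rewrite -(inj_eq (can_inj (moveK y^-1%g))) /shift_vertex/= mulVg.
have e2 : vhits (fun y : G => (m, y^-1%g)) c2 (y :: s) = 1 *: vact y^-1%g (vtab hy d) + vhits (fun y : G => (m, y^-1%g)) c2 s.
  apply: vfun_ext => x w; rewrite vfun_linE mul1r /= hits_cons//; last first.
    by move=> ? ? [/invg_inj].
  congr (_ + _); rewrite /hy -natrM mulnb andbC !invgK; congr (_ && _)%:R.
  by rewrite -(inj_eq (can_inj (moveK y))) /shift_vertex/= mulgV.
rewrite e1 e2 e_linl e_linr rmorph1 !mul1r IH//; congr (_ + _).
have lyd : onlevel m (vact y d).
  by move=> x w xm; rewrite /= /shift_vertex; case: eqVneq => // -[x1]; rewrite x1 eqxx in xm.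
rewrite (adjointable_all chiP chi_sep e_linl e_linr e_inv)//.
have -> : vtab (fun t => ((hy t)^*)%C) d = vtab hy d.
  by apply: vfun_ext => x w /=; rewrite /hy rmorph_nat.
have actE g z : vact g z = wact chi (1%g, g) z.
  apply: vfun_ext => x w; rewrite wactE/=.
  by rewrite (_ : coef chi _ x w = 1) ?mul1r//; exact: coef1.
rewrite actE e_inv; congr e; rewrite actE; congr (wact chi _ _).
by rewrite -[LHS]/(shift y^-1%g 1^-1, y^-1)%g invg1 shift_one.
Qed.

End Adjoint.

Variable U : set_system {fset X}.
Hypothesis UU : UltraFilter U.
Hypothesis Usup : forall d (A : set {fset X}), (forall e, (d `<=` e)%fset -> A e) -> U A.
Local Notation form := (kform j0 U).
Local Notation sform := (form (@diagw G J)).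
Local Notation delta := (vdelta (m, 1%g)).

Lemma fsq_delta : fsq sform delta = 1.
Proof.
rewrite (fsq_kform j0 UU Usup (S := [fset (m, 1%g)]%fset)); last first.
  by move=> x w; rewrite inE /=; case: (x == _); rewrite // eqxx.
rewrite big_seq_fset1 -[RHS](@Ecyl_cst (G * nat * nat)%type J j0); congr Ecyl.
by apply/funext => w; rewrite /= eqxx cabs1 expr1n.
Qed.

Lemma cabs_bool (b : bool) : cabs (b%:R : C) = b%:R.
Proof. by case: b; rewrite ?cabs1 ?cabs0. Qed.

Lemma fsq_hits sg F (cF : forall y, cylinder (F y)) (Y : {fset G}) : injective sg ->
  fsq sform (vhits sg cF Y) = \sum_(y <- Y) Ecyl j0 (fun w => (F y w)%:R).
Proof.
move=> sI; rewrite (fsq_kform j0 UU Usup (S := [fset sg y | y in Y]%fset)); last first.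
  move=> x w; rewrite pnatr_eq0 eqb0 negbK.
  by move=> /hasP[y ys /andP[/eqP -> _]]; exact: in_imfset.
rewrite big_imfset/=; last by move=> ? ? _ _; exact: sI.
apply: eq_big_seq => y yY; congr Ecyl; apply/funext => w.
have -> : hits sg F Y (sg y) w = F y w.
  apply/hasP/idP => [[z _ /andP[/eqP/sI -> //]]|Fy].
  by exists y => //; rewrite eqxx.
by rewrite cabs_bool; case: (F y w); rewrite ?expr1n ?expr0n.
Qed.

Lemma sum_Ecyl_hit :
  \sum_(y <- word_values) Ecyl j0 (fun w => (hit y (table k m w 1%g))%:R) <= m%:R :> R.
Proof.
have ch y : cylinder (fun w => (hit y (table k m w 1%g))%:R : R).
  exact: (cylinder_comp (fun t => (hit y t)%:R)) (table_cylinder J k m 1%g).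
rewrite -Ecyl_sum// -[leRHS](@Ecyl_cst (G * nat * nat)%type J j0).
apply: Ecyl_le => [||w]; [exact: cylinder_big|exact: cylinder_cst|exact: sum_hit].
Qed.

Lemma fsq_hits_out : fsq sform hits_out <= m%:R.
Proof. by rewrite fsq_hits; [exact: sum_Ecyl_hit|move=> ? ? []]. Qed.

(** The distribution of labels is translation invariant, so being chosen has the same expected count
    as choosing. *)
Lemma fsq_hits_in : fsq sform hits_in <= m%:R.
Proof.
rewrite fsq_hits; last by move=> ? ? [/invg_inj].
apply: le_trans sum_Ecyl_hit; rewrite le_eqVlt; apply/orP; left; apply/eqP.
apply: eq_bigr => y _.
have ch : cylinder (fun w => (hit y (table k m w 1%g))%:R : R).
  exact: (cylinder_comp (fun t => (hit y t)%:R)) (table_cylinder J k m 1%g).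
exact: (Ecyl_translate j0 y ch).
Qed.

(** Both functions are indicators, so the kernel is dominated by the square of delta: the unit
    vertex has at most one parent. *)
Lemma parent_hits_le sg F (cF : forall y, cylinder (F y)) s :
  cabs (form (parentw ev k) delta (vhits sg cF s)) <= 1.
Proof.
rewrite -fsq_delta; apply: (schur_bound j0 UU Usup).
- exact: parentw_cylinder.
- exact: parentw_unique.
- exact: tensor_finite.
move=> x y w; rewrite /tensor cabsM cabs_conj !cabs_bool.
by case: (_ == _); case: hits; rewrite /= ?expr1n ?expr0n ?mul0r ?mulr0 ?mul1r.
Qed.

End Hits.

(** * The expected number of surviving edges at 1 *)

Section EdgeMass.
Variables (R : realType) (G : groupType) (J : finType) (ev : J -> G) (inv : J -> J).
Variables (j0 : J) (k : nat -> nat).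
Hypothesis invK : involutive inv.
Hypothesis ev_inv : forall j, ev (inv j) = (ev j)^-1%g.
Variable rho : R.
Hypothesis rho_ge0 : 0 <= rho.
Hypothesis kest : forall n,
  iter n (translates ev) (fun x => (x == 1%g)%:R) 1%g <= (rho * #|J|%:R) ^+ n.
Hypothesis small : forall m, (2 * m)%:R * rho ^+ k m <= 4^-1.
Local Notation C := R[i].
Local Notation X := (nat * G)%type.
Local Notation Om := (G * nat * nat -> J).
Local Notation V := (vfun R G J).
Variable U : set_system {fset X}.
Hypothesis UU : UltraFilter U.
Hypothesis Usup : forall d (A : set {fset X}), (forall e, (d `<=` e)%fset -> A e) -> U A.
Local Notation form := (kform j0 U).
Local Notation sform := (form (@diagw G J)).
Local Notation p := (form (parentw ev k)).
Variable m : nat.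
Local Notation delta := (vdelta R J (m, 1%g)).
Local Notation Y := (word_values ev k m).
Local Notation eta := (hits_out R ev k m).

Lemma ksum_real r (W : {fset X}) (Psi : X -> X -> Om -> R) : cylinder_weight r ->
  (forall x y, cylinder (Psi x y)) ->
  ksum j0 r W (fun x y w => (Psi x y w)%:C%C) = (ksum j0 r W Psi)%:C%C.
Proof.
move=> cr cP; rewrite /ksum rmorph_sum; apply: eq_bigr => x _.
rewrite rmorph_sum; apply: eq_bigr => y _.
apply: etrans _ (Ecyl_real j0 (cylinder_kterm W cr (cP x y))).
by congr Ecyl; apply/funext => w; rewrite rmorphM rmorph_nat.
Qed.

Lemma good_probability (W : {fset G}) (j : nat) : (j < m)%N -> 1%g \in W -> (Y `<=` W)%fset ->
  cylinder (fun w : Om => `[< good ev m (k m) W w (1%g, j) >]%:R : R) /\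
  2^-1 <= Ecyl j0 (fun w => `[< good ev m (k m) W w (1%g, j) >]%:R) :> R.
Proof.
move=> jm W1 YW.
have dep : depends_on (coords m (k m) W)
    (fun w => `[< ~ good ev m (k m) W w (1%g, j) >]%:R : R).
  move=> w w' ww'; congr (nat_of_bool _)%:R.
  by apply/asboolP/asboolP => h g; apply: h; apply: good_agree g => // d /ww'.
have cb : cylinder (fun w : Om => `[< ~ good ev m (k m) W w (1%g, j) >]%:R : R).
  by exists (coords m (k m) W).
have e : (fun w => `[< good ev m (k m) W w (1%g, j) >]%:R) =
    (fun w => 1 - `[< ~ good ev m (k m) W w (1%g, j) >]%:R : R).
  by apply/funext => w; rewrite asbool_neg; case: asbool; rewrite ?subr0 ?subrr.
rewrite e; split; first exact: (cylinder_comp (fun z => 1 - z)).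
rewrite EcylB//; last exact: cylinder_cst.
rewrite Ecyl_cst (EcylE j0 (uniq_coords m (k m) W) dep).
have := bad_edge_probability j0 invK ev_inv rho_ge0 kest (small m) W1 jm.
have YW' t : size t = k m -> (1 * eval_word ev t)%g \in W.
  by move=> tk; rewrite mul1g; apply: (fsubsetP YW); exact: word_valuesP.
by move=> /(_ YW'); lra.
Qed.

(** Each of the [m] choices of 1 survives with probability at least 1/2, in every window that
    contains 1 and all word values. *)
Lemma edge_mass : m%:R / 2 <=
  complex.Re (kernel_lim j0 U (edgew ev k) (tensor delta eta)).
Proof.
pose H y w : bool := hits (fun y => (m, y)) (fun y w => hit ev y (table k m w 1%g)) Y y w.
pose Psi (x y : X) w : R := (x == (m, 1%g))%:R * (H y w)%:R.
have cH y : cylinder (fun w => (H y w)%:R : R).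
  have [l hl] := vfun_cylinder eta y; exists l => w w' ww'.
  by have /(congr1 (@complex.Re R)) := hl w w' ww'; rewrite /= /H; do 2 case: hits.
have cPsi x y : cylinder (Psi x y) by apply: (cylinder_comp (fun z => _ * z)).
have tE : tensor delta eta = (fun x y w => (Psi x y w)%:C%C).
  apply/funext => x; apply/funext => y; apply/funext => w.
  by rewrite /tensor /Psi rmorphM !rmorph_nat.
have ce := edgew_cylinder ev k.
have -> : m%:R / 2 = complex.Re (culim U (fun=> (m%:R / 2)%:C%C)) :> R.
  by rewrite (culim_cst UU).
apply: (Re_culim_le UU).
- by exists (cabs (m%:R / 2 : R)%:C%C).
- by apply: ksum_cbounded => //; exact: tensor_finite.
apply: (Usup (d := ((m, 1%g) |` [fset (m, y) | y in Y])%fset)) => W.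
rewrite fsubUset fsub1set => /andP[W1 YW].
have W1' : 1%g \in slice m W by rewrite in_slice.
have YW' : (Y `<=` slice m W)%fset.
  apply/fsubsetP => y yY; rewrite in_slice; apply: (fsubsetP YW).
  exact: (in_imfset _ (fun y => (m, y))).
rewrite tE ksum_real//=.
have t0 x y : 0 <= kterm j0 (edgew ev k) W Psi x y.
  by apply: Ecyl_ge0 => [|w]; [exact: cylinder_kterm|rewrite !mulr_ge0].
rewrite /ksum (bigD1_seq (m, 1%g)) ?fset_uniq//= -[leLHS]addr0 lerD//; last first.
  by apply: sumr_ge0 => x _; apply: sumr_ge0.
have gP (j : 'I_m) := good_probability (ltn_ord j) W1' YW'.
apply: (@le_trans _ _ (\sum_(j < m) Ecyl j0
    (fun w => `[< good ev m (k m) (slice m W) w (1%g, val j) >]%:R))).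
  apply: (@le_trans _ _ (\sum_(j < m) 2^-1)).
    by rewrite sumr_const card_ord -[leRHS]mulr_natl lexx.
  by apply: ler_sum => j _; have [] := gP j.
rewrite -Ecyl_sum; last by move=> j; have [] := gP j.
rewrite /kterm -Ecyl_sum; last by move=> y; exact: cylinder_kterm.
apply: Ecyl_le => [||w].
- by apply: cylinder_big => j; have [] := gP j.
- by apply: cylinder_big => y; exact: cylinder_kterm.
pose gd (j : 'I_m) := `[< good ev m (k m) (slice m W) w (1%g, val j) >].
pose T y := `[< edgew ev k W w (m, 1%g) y >] && H y w.
have -> : \sum_(y <- W) `[< edgew ev k W w (m, 1%g) y >]%:R * Psi (m, 1%g) y w =
    \sum_(y <- W) (T y)%:R.
  by apply: eq_bigr => y _; rewrite /Psi eqxx mul1r -natrM mulnb.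
have -> : \sum_(j < m) `[< good ev m (k m) (slice m W) w (1%g, val j) >]%:R =
    (count gd (enum 'I_m))%:R :> R by rewrite -sum_bool big_enum.
rewrite sum_bool ler_nat -!size_filter.
pose tg (j : 'I_m) : X := (m, target ev (k m) w (1%g, val j)).
have edj (j : 'I_m) : gd j -> ends ev (k m) w (1%g, val j) 1%g (target ev (k m) w (1%g, val j)).
  by move=> _; left.
rewrite -(size_map tg); apply: uniq_leq_size.
  rewrite map_inj_in_uniq => [|i j]; first by apply/filter_uniq/enum_uniq.
  rewrite !mem_filter => /andP[gi _] /andP[gj _] [tij].
  (* Two surviving choices with the same target would lie on a cycle of length two, so surviving
     choices have distinct targets. *)
  have := edj _ gi; rewrite tij => ei.
  have [/val_inj//] := good_uniq (asboolW gi) (asboolW gj) ei (edj _ gj).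
move=> _ /mapP[j + ->]; rewrite !mem_filter => /andP[gj _].
have /asboolP gj' := gj; have [_ _ tW _] := gj'.
rewrite -in_slice tW andbT; apply/andP; split.
  by apply/asboolP; split=> //=; exists (1%g, val j) => //; left.
apply/hasP; exists (target ev (k m) w (1%g, val j)).
  by rewrite /target mul1g; apply: word_valuesP; rewrite size_map size_iota.
rewrite eqxx /=; apply/existsP; exists j.
by rewrite label_value_word /target mul1g.
Qed.

Lemma edge_mass_forms : m%:R / 2 <= complex.Re (p delta eta + p eta delta).
Proof.
apply: le_trans edge_mass _; rewrite (klim_orient j0 UU (P := parentw ev k)).
- rewrite le_eqVlt; apply/orP; left; apply/eqP; congr (complex.Re (_ + _)).
  rewrite /kform; congr kernel_lim; apply/funext => x; apply/funext => y; apply/funext => w.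
  by rewrite /tensor /= !rmorph_nat mulrC.
- exact: parentw_cylinder.
- exact: edgew_cylinder.
- exact: edgew_orient.
- exact: tensor_finite.
Qed.

End EdgeMass.

(** * The contradiction for a non-amenable group *)

Section HardDirection.
Variables (R : realType) (A G : groupType).
Hypothesis Acomm : forall x y : A, (x * y = y * x)%g.
Hypothesis Ainf : infinite_set [set: A].
Local Notation C := R[i].

Lemma amenable_of_unitarizable_wreath : unitarizable R (wreath A G) -> amenable R G.
Proof.
move=> uW; apply: contrapT => /kesten[J [ev [inv [j0 [rho [invK ev_inv rho01 kest]]]]]].
have /andP[rho0 _] := rho01.
have /choice[k small] (m : nat) : exists k, (2 * m)%:R * rho ^+ k <= 4^-1.
  have [|n nP] := @expr_small _ rho (4^-1 / (2 * m).+1%:R) rho01.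
    by rewrite divr_gt0// invr_gt0.
  exists n; apply: (@le_trans _ _ ((2 * m).+1%:R * rho ^+ n)).
    by rewrite ler_wpM2r ?exprn_ge0// ler_nat.
  by rewrite mulrC -ler_pdivlMr// ltW.
have chars m := character_family R Acomm {ffun 'I_m * 'I_(k m) -> J} Ainf.
pose chi m := projT1 (cid (chars m)).
have chiP m t : is_character (chi m t) by rewrite /chi; case: cid => ? /= [].
have chi_sep m t t' : t != t' -> exists a, chi m t a != chi m t' a.
  by rewrite /chi; case: cid => ? /= [_]; exact.
pose X : choiceType := (nat * G)%type.
have [U [UU Usup]] := @directed_ultrafilter {fset X}
  (fun X Y => X `<=` Y)%fset fset0 (fun X => fsubset_refl X)
  (fun X Y Z XY YZ => fsubset_trans XY YZ)
  (fun X Y => ex_intro2 _ _ (X `|` Y)%fset (fsubsetUl X Y) (fsubsetUr X Y)).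
pose s := kform (R := R) j0 U (@diagw G J); pose p := kform (R := R) j0 U (parentw ev k).
have hs : psd_form s := kform_diag_psd R j0 UU Usup.
have cp := parentw_cylinder ev k.
have pl a x y z : p (a *: x + y) z = a * p x z + p y z by exact: kform_linl.
have pr a x y z : p z (a *: x + y) = (a^*)%C * p z x + p z y by exact: kform_linr.
have [b [K [K0 bl br bK bE]]] := inner_derivation hs (wact_lin chi)
  (wact1 chiP) (wactM chiP) (wact_iso j0 chiP UU Usup) pl pr (ler0n R 4)
  (wact_commutator j0 chiP UU Usup ev) uW.
pose e x y := p x y - b x y.
have el a x y z : e (a *: x + y) z = a * e x z + e y z.
  by rewrite /e pl bl; ring.
have er a x y z : e z (a *: x + y) = (a^*)%C * e z x + e z y.
  by rewrite /e pr br; ring.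
have einv u x y : e (wact chi u x) y = e x (wact chi u^-1%g y).
  apply/eqP; rewrite -subr_eq0; apply/eqP.
  rewrite (_ : _ - _ = (p (wact chi u x) y - p x (wact chi u^-1%g y)) -
    (b (wact chi u x) y - b x (wact chi u^-1%g y))); last by rewrite /e; ring.
  by rewrite bE subrr.
(* Replace [p eta d] by [e eta d + b eta d], then [e eta d] by [e d eta'], which is
   [p d eta' - b d eta']. The two remaining values of [p] have modulus at most 1, whence the 2, and
   the two values of [b] at most [K * M] each. *)
have defect (d eta eta' : vfun R G J) (M : R) : fnorm s d = 1 ->
    fnorm s eta <= M -> fnorm s eta' <= M -> cabs (p d eta) <= 1 ->
    cabs (p d eta') <= 1 -> e eta d = e d eta' ->
    complex.Re (p d eta + p eta d) <= 2 + 2 * K * M.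
  move=> nd ne ne' h1 h2 adj.
  have -> : p d eta + p eta d = p d eta + p d eta' + (b eta d - b d eta').
    have -> : p d eta' = e eta d + b d eta' by rewrite adj /e subrK.
    by rewrite /e; ring.
  have h3 := bK eta d; rewrite nd mulr1 in h3.
  have h4 := bK d eta'; rewrite nd mul1r in h4.
  have h5 := ler_wpM2l K0 ne; have h6 := ler_wpM2l K0 ne'.
  have h7 := cabsD (p d eta) (p d eta'); have h8 := cabsB (b eta d) (b d eta').
  apply: le_trans (ler_norm _) _; apply: le_trans (Re_le_cabs _) _.
  by apply: le_trans (cabsD _ _) _; lra.
have key m : m%:R / 2 <= 2 + 2 * K * Num.sqrt (m%:R : R).
  apply: le_trans (edge_mass_forms j0 invK ev_inv rho0 kest small UU Usup m) _.
  apply: defect (hits_adjoint ev m chiP chi_sep el er einv).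
  - by rewrite /fnorm (fsq_delta R j0 m UU Usup) sqrtr1.
  - by apply: ler_wsqrtr; exact: fsq_hits_out.
  - by apply: ler_wsqrtr; exact: fsq_hits_in.
  - exact: parent_hits_le.
  - exact: parent_hits_le.
(* For [m = n^2] the inequality reads [n^2 / 2 <= 2 + 2 K n], which fails once [n > 4 K + 4]. *)
pose n := Num.bound (4 * K + 4).
have nK : 4 * K + 4 < n%:R by apply: archi_boundP; rewrite addr_ge0// mulr_ge0.
have := key (n * n)%N; rewrite natrM -expr2 sqrtr_sqr ger0_norm// expr2.
have : n%:R * (4 * K + 4) <= n%:R * n%:R :> R by rewrite ler_wpM2l// ltW.
nra.
Qed.

End HardDirection.

Theorem corollary16 (R : realType) (G : groupType) :
  [<-> amenable R G;
       exists A : groupType,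
         [/\ infinite_set [set: A]%classic,
             forall x y : A, (x * y)%g = (y * x)%g &
             unitarizable R (wreath A G)];
       forall A : groupType, amenable R A -> unitarizable R (wreath A G)].
Proof.
have easy A : amenable R A -> amenable R G -> unitarizable R (wreath A G).
  by move=> aA aG; apply: Dixmier; exact: amenable_wreath.
tfae.
- move=> aG; exists infinite_abelian; split.
  + exact: infinite_abelian_infinite.
  + exact: infinite_abelian_comm.
  + by apply: easy => //; exact: infinite_abelian_amenable.
- move=> [A [Ainf Acomm uA]] A' aA'; apply: easy => //.
  exact: amenable_of_unitarizable_wreath uA.
(* Condition (iii) is tested on one amenable group that is also infinite and Abelian. *)
- move=> h; apply: (amenable_of_unitarizable_wreath infinite_abelian_comm).
    exact: infinite_abelian_infinite.
  by apply: h; exact: infinite_abelian_amenable.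
Qed.
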